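(* Let $G$ be a two-player ($I=\{1,2\}$) dynamic game with perfect information, with or without Nature, which is zero-sum or, more generally, fixed-sum (there is a constant $c\in\mathbb{R}$ with $u_1+u_2\equiv c$ on $H_\infty$). Then every mixed-strategy subgame-perfect equilibrium $f=\{f_1,f_2\}$ of $G$ has the no-mixing property: every pure-strategy profile $g=\{g_1,g_2\}$ satisfying $g_{ti}(h_{t-1})\in \operatorname{support}(f_{ti}(\cdot|h_{t-1}))$ for all $t\ge 1$, $i\in I$ and $h_{t-1}\in H_{t-1}$ is a subgame-perfect equilibrium of $G$.
   Context: **Dynamic game with perfect information.** The set of active players is $I=\{1,\dots,n\}$; player $0$ is Nature and $I_0=I\cup\{0\}$. Stages are $t=0,1,2,\dots$. The set of starting points is $H_0=X_0\times S_0$, with $X_0$ a compact metric space and $S_0$ a Polish space. For $t\ge1$ let $X_{ti}$ ($i\in I$) and $S_t$ be Polish spaces, $X_t=\prod_{i\in I}X_{ti}$, $X^t=\prod_{0\le k\le t}X_k$, $S^t=\prod_{0\le k\le t}S_k$. The sets of histories $H_t\subseteq X^t\times S^t$ are defined recursively, together with the following data for $t\ge 1$: - for each $i\in I$, a continuous (upper and lower hemicontinuous), nonempty compact valued action correspondence $A_{ti}$ from $H_{t-1}$ to $X_{ti}$; put $A_t=\prod_{i\in I}A_{ti}$; - Nature's move $f_{t0}:H_{t-1}\to\mathcal{M}(S_t)$, continuous, where $\mathcal{M}(\cdot)$ denotes the set of Borel probability measures with the topology of weak convergence; - $H_t=\mathrm{Gr}(A_t)\times S_t$, where $\mathrm{Gr}(A_t)$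 is the graph of $A_t$ (coordinates are reordered so that $H_t\subseteq X^t\times S^t$). Perfect information: at each stage $t\ge1$ there is only one mover, who may depend on the history $h_{t-1}$. That is, if $A_{ti}(h_{t-1})$ is not a single point for some $i\in I$ (player $i$ is the mover), then $A_{tj}(h_{t-1})$ is a single point for all $j\in I$, $j\ne i$, and $f_{t0}(h_{t-1})=\delta_{s_t}$ for some $s_t\in S_t$. If $f_{t0}(h_{t-1})$ is not a Dirac measure (Nature is the mover), then $A_{ti}(h_{t-1})$ is a single point for every $i\in I$. ''Without Nature'' means that Nature has no nontrivial move ($S_t$ is a singleton for all $t\ge1$). $H_\infty$ is the set of $(x,s)\in X^\infty\times S^\infty$ whose truncations satisfy $(x^t,s^t)\in H_t$ for all $t\ge0$, with the product topology. Each payoff function $u_i:H_\infty\to\mathbb{R}$ ($i\in I$) is bounded and continuous, and the game is continuous at infinity: $w^T\to0$ as $T\to\infty$, where $w^T=\sup|u_i(x,s)-u_i(\bar x,\bar s)|$ over all $i\in I$ and $(x,s),(\bar x,\bar s)\in H_\infty$ with $x^{T-1}=\bar x^{T-1}$, $s^{T-1}=\bar s^{T-1}$. **Strategies.** A mixed strategy of player $i\in I$ is a sequence $f_i=\{f_{ti}\}_{t\ge1}$ of Borel measurable maps $f_{ti}:H_{t-1}\to\mathcal{M}(X_{ti})$ with $\operatorname{support}(f_{ti}(\cdot|h_{t-1}))\subseteq A_{ti}(h_{t-1})$ for all $h_{t-1}\in H_{t-1}$, where the support of a measure is the smallest closed set of measure $1$. It is a pure strategy if all $f_{ti}(\cdot|h_{t-1})$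 are Dirac measures; a pure strategy $g_i$ is identified with the maps $g_{ti}:H_{t-1}\to X_{ti}$, $g_{ti}(h_{t-1})\in A_{ti}(h_{t-1})$. A strategy profile is $f=\{f_i\}_{i\in I}$. **Payoffs.** Given a profile $f$ and $h_t\in H_t$ ($t\ge0$), let $\tau_t=\delta_{h_t}$ and, for $t'\ge t$, $\tau_{t'+1}=\tau_{t'}\diamond(\otimes_{i\in I_0}f_{(t'+1)i})$, where $\lambda\diamond\nu(A\times B)=\int_A\nu(B|x)\,\lambda(dx)$. Let $\tau\in\mathcal{M}(H_\infty)$ be the unique measure with marginal $\tau_{t'}$ on $H_{t'}$ for all $t'\ge t$. Player $i$'s payoff from $f$ in the subgame beginning at $h_t$ is $\int_{H_\infty}u_i\,d\tau$. **Subgame-perfect equilibrium.** A profile $f$ such that for all $i\in I$, $t\ge0$ and $h_t\in H_t$, player $i$ cannot improve his payoff in the subgame beginning at $h_t$ by a unilateral change of his (mixed) strategy. *)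

(* Defs.v *)
From HB Require Import structures.
From mathcomp Require Import all_boot all_order all_algebra.
From mathcomp Require Import all_classical all_reals all_analysis.

Set Implicit Arguments.
Unset Strict Implicit.
Unset Printing Implicit Defensive.

Import Order.TTheory GRing.Theory Num.Theory.
Import numFieldNormedType.Exports.

Local Open Scope classical_set_scope.
Local Open Scope ring_scope.

(* Spaces are pointed because the library puts sigma-algebras on nonempty types
   only.  This excludes nothing but games that have no history at all. *)

#[short(type="pointedMetricType")]
HB.structure Definition PointedMetric (R : numDomainType) :=
  {T of Metric R T & isPointed T}.

HB.mixin Record isSeparable T & Topological T := {
  separableT : exists2 D : set T, countable D & dense D }.

(* A Polish space, presented with a complete compatible metric. *)
#[short(type="polishType")]
HB.structure Definition Polish (R : numDomainType) :=
  {T of CompletePseudoMetric R T & Metric R T & isSeparable T}.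

HB.instance Definition _ (T U : ptopologicalType) := Pointed.on (T * U)%type.
HB.instance Definition _ (I : Type) (T : I -> ptopologicalType) :=
  Pointed.copy (prod_topology T) (forall i, T i).

Definition borel (T : ptopologicalType) := g_sigma_algebraType (@open T).
HB.instance Definition _ (T : ptopologicalType) := Measurable.on (borel T).

Section borel_probability.
Variables (R : realType) (T : ptopologicalType).

(* The space M(T).  A measure of the library is a function on all subsets whose
   values on non-measurable ones are irrelevant, so that two elements of [prob]
   are the same measure when they agree on [measurable] sets. *)
Definition prob := probability (borel T) R.

Definition dirac_prob (x : T) : prob := \d_(x : borel T).

Definition is_dirac (mu : prob) (x : T) : Prop :=
  forall B : set (borel T), measurable B -> mu B = dirac_prob x B.

Definition bounded_continuous : Type :=
  {phi : T -> R | continuous phi /\ exists M : R, forall x, `|phi x| <= M}.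

Definition integrals (mu : prob) : prod_topology (fun _ : bounded_continuous => R) :=
  fun phi => \int[mu]_x sval phi x.

(* The topology of weak convergence. *)
HB.instance Definition _ := Choice.on prob.
HB.instance Definition _ := Topological.copy prob (initial_topology integrals).
HB.instance Definition _ := isPointed.Build prob (dirac_prob point).

Definition prob_support (mu : prob) : set T :=
  \bigcap_(C in [set C : set T | closed C /\ mu C = 1%E]) C.

End borel_probability.

Section correspondences.
Variables (T U : topologicalType) (D : set T) (F : T -> set U).

Definition upper_hemicontinuous : Prop :=
  forall x, D x -> forall V, open V -> F x `<=` V ->
  \forall y \near within D (nbhs x), F y `<=` V.

Definition lower_hemicontinuous : Prop :=
  forall x, D x -> forall V, open V -> F x `&` V !=set0 ->
  \forall y \near within D (nbhs x), F y `&` V !=set0.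

End correspondences.

Definition single_point (T : Type) (A : set T) : Prop := exists x, A = [set x].

(* Stages t >= 1 are indexed by t - 1: below, [act_space t i] and [nat_space t]
   are X_{(t+1) i} and S_{t+1}, and likewise [action t], [nature t] and the t-th
   component of a strategy are defined on histories of H_t and describe the
   moves made at stage t + 1. *)
Record spaces (n : nat) (R : realType) := Spaces {
  start_act : pointedMetricType R;
  start_nat : polishType R;
  act_space : nat -> 'I_n -> polishType R;
  nat_space : nat -> polishType R;
  start_act_compact : compact [set: start_act] }.

Section histories.
Variables (n : nat) (R : realType) (E : spaces n R).

Definition stage (t : nat) : ptopologicalType :=
  match t with
  | 0 => (start_act E * start_nat E)%type
  | t'.+1 => (prod_topology (fun i => act_space E t' i) * nat_space E t')%type
  end.

(* X^t * S^t and X^oo * S^oo, with the coordinates grouped by stages. *)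
Fixpoint hist (t : nat) : ptopologicalType :=
  match t with
  | 0 => stage 0
  | t'.+1 => (hist t' * stage t'.+1)%type
  end.

Definition play : ptopologicalType := prod_topology stage.

Fixpoint trunc (t : nat) (w : play) : hist t :=
  match t return hist t with
  | 0 => w 0
  | t'.+1 => (trunc t' w, w t'.+1)
  end.

Fixpoint hist_set (A : forall t i, hist t -> set (act_space E t i)) (t : nat) :
    set (hist t) :=
  match t return set (hist t) with
  | 0 => setT
  | t'.+1 => [set h | @hist_set A t' h.1 /\ forall i, A t' i h.1 (h.2.1 i)]
  end.

End histories.

Arguments hist_set {n R E} A t _.

Section plays.
Variables (n : nat) (R : realType) (E : spaces n R).

Definition play_set (A : forall t i, hist E t -> set (act_space E t i)) : set (play E) :=
  [set w | forall t, hist_set A t (trunc t w)].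

(* [oscillation _ u T] is w^{T+1}. *)
Definition oscillation (A : forall t i, hist E t -> set (act_space E t i))
    (u : 'I_n -> play E -> R) (T : nat) : R :=
  sup [set r | exists i w w', [/\ play_set A w, play_set A w',
    trunc T w = trunc T w' & r = `|u i w - u i w'|]].

End plays.

(* Functions of a history or of a play are total; their values outside
   [hist_set] and [play_set] are irrelevant. *)
Record game (n : nat) (R : realType) := Game {
  game_spaces :> spaces n R;
  action : forall t i, hist game_spaces t -> set (act_space game_spaces t i);
  nature : forall t, hist game_spaces t -> prob R (nat_space game_spaces t);
  utility : 'I_n -> play game_spaces -> R;
  action_uhc : forall t i, upper_hemicontinuous (hist_set action t) (@action t i);
  action_lhc : forall t i, lower_hemicontinuous (hist_set action t) (@action t i);
  action_nonempty : forall t i (h : hist game_spaces t), hist_set action t h -> @action t i h !=set0;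
  action_compact : forall t i (h : hist game_spaces t), hist_set action t h -> compact (@action t i h);
  nature_continuous : forall t, {within hist_set action t, continuous (@nature t)};
  utility_bounded : forall i, exists M : R, forall w, play_set action w ->
    `|utility i w| <= M;
  utility_continuous : forall i, {within play_set action, continuous (utility i)};
  continuous_at_infinity : oscillation action utility @ \oo --> (0 : R) }.

Arguments action {n R} g t i _.
Arguments nature {n R} g t _.
Arguments utility {n R} g i _.

Section games.
Variables (n : nat) (R : realType) (G : game n R).

Local Notation X := (act_space G).
Local Notation H := (hist_set (action G)).
Local Notation Hinf := (play_set (action G)).

Definition perfect_information : Prop :=
  forall t h, H t h ->
  (forall i, ~ single_point (action G t i h) ->
     (forall j, j != i -> single_point (action G t j h)) /\
     exists s, is_dirac (nature G t h) s) /\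
  (~ (exists s, is_dirac (nature G t h) s) ->
     forall i, single_point (action G t i h)).

Definition fixed_sum : Prop :=
  exists c : R, forall w, Hinf w -> \sum_(i < n) utility G i w = c.

Definition strategy (i : 'I_n) := forall t, hist G t -> prob R (X t i).

Definition mixed_strategy (i : 'I_n) (fi : strategy i) : Prop :=
  forall t,
  measurable_fun (H t : set (borel (hist G t)))
    (fi t : borel (hist G t) -> borel (prob R (X t i))) /\
  forall h, H t h -> prob_support (fi t h) `<=` action G t i h.

Definition mixed_profile (f : forall i, strategy i) : Prop :=
  forall i, mixed_strategy (f i).

Definition pure_to_mixed (g : forall i t, hist G t -> X t i) : forall i, strategy i :=
  fun i t h => dirac_prob R (g i t h).

Definition pure_profile (g : forall i t, hist G t -> X t i) : Prop :=
  mixed_profile (pure_to_mixed g).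

(* [p] is the product of the [mu i] and of [nu], that is, the unique measure
   with the values below on measurable boxes. *)
Definition is_product t (mu : forall i, prob R (X t i)) (nu : prob R (nat_space G t))
    (p : prob R (stage G t.+1)) : Prop :=
  forall (C : forall i, set (borel (X t i))) (D : set (borel (nat_space G t))),
  (forall i, measurable (C i)) -> measurable D ->
  p [set z | (forall i, C i (z.1 i)) /\ D z.2] =
  ((\big[mule/1]_(i < n) mu i (C i)) * nu D)%E.

(* [p] is the composition of [lambda] on H_t with the transition [nu]. *)
Definition is_diamond t (lambda : prob R (hist G t))
    (nu : hist G t -> prob R (stage G t.+1)) (p : prob R (hist G t.+1)) : Prop :=
  forall (A : set (borel (hist G t))) (B : set (borel (stage G t.+1))),
  measurable A -> measurable B ->
  p (A `*` B) = (\int[lambda]_(h in H t `&` A) nu h B)%E.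

Definition outcome (f : forall i, strategy i) t (h : hist G t)
    (tau : prob R (play G)) : Prop :=
  exists (lambda : forall k, prob R (hist G k))
         (nu : forall k, hist G k -> prob R (stage G k.+1)),
  [/\ is_dirac (lambda t) h,
      forall k h', (t <= k)%N -> H k h' ->
        is_product (fun i => f i k h') (nature G k h') (nu k h'),
      forall k, (t <= k)%N -> is_diamond (lambda k) (nu k) (lambda k.+1) &
      forall k (B : set (borel (hist G k))), (t <= k)%N -> measurable B ->
        tau (trunc k @^-1` B) = lambda k B].

(* The integral of the utility for the unique outcome measure. *)
Definition payoff (f : forall i, strategy i) t (h : hist G t) (i : 'I_n) : R :=
  get [set v | exists2 tau : prob R (play G),
    outcome f h tau & v = \int[tau]_(w in Hinf) utility G i w].

Definition subgame_perfect (f : forall i, strategy i) : Prop :=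
  mixed_profile f /\
  forall i t (h : hist G t), H t h ->
  forall fi : strategy i, mixed_strategy fi ->
  payoff (dfwith f i fi) h i <= payoff f h i.

End games.

(* Main.v *)
Require Import Defs.
From HB Require Import structures.
From mathcomp Require Import all_boot all_order all_algebra.
From mathcomp Require Import all_classical all_reals all_analysis.
From mathcomp Require finmap.
From mathcomp Require Import measurable_realfun giry zify lra ring.

Set Implicit Arguments.
Unset Strict Implicit.
Unset Printing Implicit Defensive.

Import Order.TTheory GRing.Theory Num.Theory.
Import numFieldNormedType.Exports.

Local Open Scope classical_set_scope.
Local Open Scope ring_scope.

(* Let V_i(h) be the payoff of player i from the equilibrium f in the subgame at h.
   Only one player moves at a time and the sum of the payoffs is fixed, so at each
   h player i has an action that secures V_i(h) in one step, and conversely an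
   action that secures r in one step gives V_i(h) >= r.  By compactness and
   hemicontinuity of the action sets this carries lower semicontinuity of V_i,
   up to a defect, from stage t+1 to stage t.  At stage T the defect is at most
   twice the oscillation of the utilities, which tends to 0, so every V_i is lower
   semicontinuous.  Hence no action in the support of f_j(h) can give j less than
   V_j(h): a whole neighbourhood of it, charged by f_j(h), would give less, and no
   action gives more.  So if j follows the selection g_j, then V_i is a
   supermartingale along the play whatever i does, and i gets at most V_i(h).
   Applied to both players, this shows that g itself gives V_i(h). *)

(** * Countable bases and Borel sets *)

(** Nothing ties the play of [f] in nearby subgames together, because [f i t] is only measurable in
    the history. What survives a small change of history is a guarantee against every reply. In a
    fixed-sum game the equilibrium value is such a guarantee for both players, so semicontinuity is
    carried by securing actions and not by [f] itself. The fixed sum also turns an indifference of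
    the mover into one of the opponent; otherwise a selection from the supports could change what
    the opponent gets. [payoff] is defined by [get] on a set of integrals over outcome measures, so
    a large share of the proof shows that an outcome measure exists and is unique. The horizon is
    infinite and strategies are merely measurable, so existence is the Ionescu-Tulcea theorem, for
    kernels read off Borel maps into spaces of measures. The equilibrium condition enters only
    through deviations at a single history; the supermartingale bound then handles arbitrary
    deviations from the selection. *)

Definition indexed_basis (T : topologicalType) (C : Type) (b : C -> set T) :=
  (forall c, open (b c)) /\
  forall x U, nbhs x U -> exists2 c, b c x & b c `<=` U.

Definition countable_basis (T : topologicalType) :=
  exists b : nat -> set T, indexed_basis b.

Lemma indexed_basis_countable (T : topologicalType) (C : countType)
  (b : C -> set T) : indexed_basis b -> countable_basis T.
Proof.
move=> [ob bU]; exists (fun n => oapp b set0 (unpickle n)); split.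
  by move=> n; case: (unpickle n) => [c|] /=; [exact: ob|exact: open0].
by move=> x U /bU[c bcx cU]; exists (pickle c); rewrite pickleK.
Qed.

(** Balls need not be open, so interiors of balls of radius [r n + r n] around dense points are
    taken. If the centre lies within [r n] of [x], such a ball contains the ball of radius [r n]
    around [x], which puts [x] in its interior, and lies in the ball of radius three times [r n]
    around [x]; hence the [e / 3]. *)
Lemma separable_countable_basis (R : realType) (T : pseudoMetricType R) (D : set T) :
  countable D -> dense D -> countable_basis T.
Proof.
move=> cD dD.
have [D0|[f]] := pfcard_geP cD.
  exists (fun=> set0); split; first by move=> _; exact: open0.
  move=> x U _; exfalso.
  have [|y []] := dD setT _ openT; first by exists x.
  by rewrite D0.
pose r n : R := n.+1%:R^-1; have r0 n : 0 < r n by rewrite invr_gt0.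
apply: (@indexed_basis_countable _ (nat * nat)%type
  (fun p : nat * nat => (ball (f p.1) (r p.2 + r p.2))°)).
split => [p|x U /nbhs_ballP[e /= e0 xeU]]; first exact: open_interior.
have [|n] := @ltr_add_invr R 0 (e / 3).
  by rewrite divr_gt0.
rewrite add0r -/(r n) => rne.
have [|y [xy Dy]] := dD (ball x (r n))° _ (open_interior _).
  by exists x; exact: nbhsx_ballx.
have xny : ball x (r n) y by exact: interior_subset.
have [k _ fky] := @surj _ _ _ _ f y Dy.
exists (k, n); rewrite /= fky.
  apply/nbhs_ballP; exists (r n); first exact: r0.
  by move=> z xz; apply: ball_triangle xz; exact: ball_sym.
move=> z /interior_subset yz; apply: xeU.
by apply: le_ball (ball_triangle xny yz); lra.
Qed.

Lemma open_setX (T U : topologicalType) (A : set T) (B : set U) :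
  open A -> open B -> open (A `*` B).
Proof.
move=> oA oB; rewrite openE => -[x y] [/= Ax By].
by exists (A, B) => //=; split; apply: open_nbhs_nbhs; split => //=.
Qed.

Lemma indexed_basis_setX (T U : topologicalType) (C C' : Type)
    (b : C -> set T) (c : C' -> set U) : indexed_basis b -> indexed_basis c ->
  indexed_basis (fun p => b p.1 `*` c p.2).
Proof.
move=> [ob bP] [oc cP]; split => [p|]; first exact: open_setX.
move=> [x y] W [[A B]] /= [/bP[n bnx bnA] /cP[m cmy cmB]] ABW.
by exists (n, m) => //= -[x' y'] [/= /bnA Ax /cmB By]; exact: ABW.
Qed.

Lemma countable_basis_prod (T U : topologicalType) :
  countable_basis T -> countable_basis U -> countable_basis (T * U)%type.
Proof.
move=> [b bb] [c bc].
exact: (@indexed_basis_countable _ (nat * nat)%type _ (indexed_basis_setX bb bc)).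
Qed.

(** The sets that contain a finite box around [f] form a filter. It converges to [f] in each
    coordinate, so, the product topology being a supremum of initial topologies, it contains every
    neighbourhood of [f]. *)
Lemma prod_nbhsP (I : eqType) (T : I -> topologicalType) (f : prod_topology T)
    (U : set (prod_topology T)) : nbhs f U ->
  exists (V : forall i, set (T i)) (s : seq I),
    (forall i, open_nbhs (f i) (V i)) /\
    [set g | forall i, i \in s -> V i (g i)] `<=` U.
Proof.
pose F := [set U : set (prod_topology T) |
  exists (V : forall i, set (T i)) (s : seq I),
    (forall i, open_nbhs (f i) (V i)) /\
    [set g | forall i, i \in s -> V i (g i)] `<=` U].
have FF : Filter F.
  constructor.
  - by exists (fun=> setT), [::]; split => // i; split; first exact: openT.
  - move=> P Q [V [s [oV VP]]] [W [r [oW WQ]]].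
    exists (fun i => V i `&` W i), (s ++ r); split.
      move=> i; have [[oVi Vi] [oWi Wi]] := (oV i, oW i).
      by split; [exact: openI|split].
    move=> g gs; split; [apply: VP => i ir|apply: WQ => i ir].
      by have [] := gs i _; rewrite // mem_cat ir.
    by have [] := gs i _; rewrite // mem_cat ir orbT.
  - by move=> P Q PQ [V [s [oV VP]]]; exists V, s; split => // g /VP/PQ.
suff : cvg_to F (nbhs f) by apply.
apply/cvg_sup => i A [_ [[B oB] <-] /= Bf BA].
exists (fun j => if pselect (i = j) is left e then eq_rect i (fun k => set (T k)) B j e else setT), [:: i].
split.
  move=> j; case: pselect => [e|_].
    by case: _ / e.
  by split; first exact: openT.
move=> g /(_ i); rewrite mem_head => /(_ isT).
by case: pselect => // e; rewrite (Prop_irrelevance e erefl) => /BA.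
Qed.

Lemma cvg_prod_topology (I : eqType) (T : I -> topologicalType) (A : Type)
    (F : set_system A) (f : A -> prod_topology T) (l : prod_topology T) :
  Filter F -> (forall i, (fun x => f x i) @ F --> l i) -> f @ F --> l.
Proof.
move=> FF fl U /prod_nbhsP[V [s [oV sU]]].
have : F [set x | forall i, i \in s -> V i (f x i)].
  elim: s {sU} => [|i s ih]; first by apply: filterE => x i; rewrite in_nil.
  have Vi : F [set x | V i (f x i)] := fl i _ (open_nbhs_nbhs (oV i)).
  have sub : [set x | V i (f x i)] `&` [set x | forall j, j \in s -> V j (f x j)] `<=`
      [set x | forall j, j \in i :: s -> V j (f x j)].
    by move=> x [/= xi xs] j; rewrite inE => /predU1P[->|/xs].
  exact: (filterS sub (filterI Vi ih)).
by move=> Fs; exact: (filterS (fun x xs => sU _ xs) Fs).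
Qed.

Lemma nbhs_prod_topology (I : eqType) (T : I -> topologicalType)
    (f : prod_topology T) (V : forall i, set (T i)) (s : seq I) :
  (forall i, i \in s -> nbhs (f i) (V i)) ->
  nbhs f [set g | forall i, i \in s -> V i (g i)].
Proof.
elim: s => [|i s ih] Vs.
  by apply: filterS (@filterT _ (nbhs f) _) => g _ i; rewrite in_nil.
have Vi : nbhs f [set g : prod_topology T | V i (g i)].
  by apply: (@proj_continuous I T i f); apply: Vs; exact: mem_head.
have Vss : nbhs f [set g | forall i, i \in s -> V i (g i)].
  by apply: ih => k ks; apply: Vs; rewrite inE ks orbT.
apply: filterS (filterI Vi Vss) => g [/= gi gs] k.
by rewrite inE => /predU1P[->|/gs].
Qed.

Lemma open_proj (I : eqType) (T : I -> topologicalType) i (V : set (T i)) :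
  open V -> open [set g : prod_topology T | V (g i)].
Proof. by move=> oV; apply: (open_comp _ oV) => g _; exact: proj_continuous. Qed.

(** Basic open sets are coded by finite lists of constraints (coordinate, index in the base), so
    that the codes form a countable type as soon as [I] does. *)
Definition proj_sets (I : eqType) (T : I -> topologicalType)
    (b : forall i, nat -> set (T i)) (s : seq (I * nat)) : set (prod_topology T) :=
  [set g | forall p, p \in s -> b p.1 p.2 (g p.1)].

Lemma open_proj_sets (I : eqType) (T : I -> topologicalType)
    (b : forall i, nat -> set (T i)) (s : seq (I * nat)) :
  (forall i n, open (b i n)) -> open (proj_sets b s).
Proof.
move=> ob; elim: s => [|p s ih].
  by rewrite (_ : proj_sets b [::] = setT)//; [exact: openT|exact/seteqP].
rewrite (_ : proj_sets b (p :: s) =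
    [set g : prod_topology T | b p.1 p.2 (g p.1)] `&` proj_sets b s).
  by apply: openI => //; exact: open_proj.
apply/seteqP; split => [g gs|g [gp gs] q].
  by split => [|q qs]; apply: gs; rewrite inE ?eqxx// qs orbT.
by rewrite inE => /predU1P[->|/gs].
Qed.

Lemma indexed_basis_proj_sets (I : eqType) (T : I -> topologicalType)
    (b : forall i, nat -> set (T i)) :
  (forall i, indexed_basis (b i)) -> indexed_basis (proj_sets b).
Proof.
move=> bb; split => [s|f U /prod_nbhsP[V [s [oV sU]]]].
  by apply: open_proj_sets => i n; case: (bb i).
have /choice[n nP] : forall i, exists n, b i n (f i) /\ b i n `<=` V i.
  move=> i; have [_ /(_ (f i) (V i))[|n]] := bb i; first exact: open_nbhs_nbhs.
  by exists n.
exists [seq (i, n i) | i <- s].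
  by move=> _ /mapP[i _ ->] /=; case: (nP i).
move=> g gs; apply: sU => i si.
by apply: (nP i).2; apply: (gs (i, n i)); apply/mapP; exists i.
Qed.

Lemma countable_basis_prod_topology (I : countType) (T : I -> topologicalType) :
  (forall i, countable_basis (T i)) -> countable_basis (prod_topology T).
Proof.
move=> h; pose b i := sval (cid (h i)).
apply: (indexed_basis_countable (b := proj_sets b)).
by apply: indexed_basis_proj_sets => i; exact: (svalP (cid (h i))).
Qed.

Lemma indexed_basis_bigcup (T : topologicalType) (C : Type) (b : C -> set T) U :
  indexed_basis b -> open U -> U = \bigcup_(c in [set c | b c `<=` U]) b c.
Proof.
move=> [_ bP] oU; apply/seteqP; split => [x Ux|x [c cU /cU//]].
by have [c bcx cU] := bP x U (open_nbhs_nbhs (conj oU Ux)); exists c.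
Qed.

Lemma countable_bigcup_measurable d (T : measurableType d) (C : countType)
    (D : set C) (F : C -> set T) :
  (forall c, D c -> measurable (F c)) -> measurable (\bigcup_(c in D) F c).
Proof.
move=> mF; rewrite bigcup_mkcond; apply: countable_bigcupT_measurable => // c.
by case: ifPn => // /set_mem; exact: mF.
Qed.

Section borel_measurability.
Variables (T : ptopologicalType) (C : countType) (b : C -> set T).
Hypothesis bb : indexed_basis b.

Lemma open_borel (U : set T) : open U -> measurable (U : set (borel T)).
Proof. by move=> oU; exact: (@sub_sigma_algebra T setT open). Qed.

Lemma closed_borel (U : set T) : closed U -> measurable (U : set (borel T)).
Proof.
move=> cU; rewrite -[U]setCK; apply: measurableC; apply: open_borel.
exact: closed_openC.
Qed.

Lemma measurable_fun_basis d (aT : measurableType d) (D : set aT) (f : aT -> borel T) :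
  (measurable D -> forall c, measurable (D `&` f @^-1` b c)) -> measurable_fun D f.
Proof.
move=> fb mD; apply: (@measurability _ _ _ (borel T) D f open erefl) => //.
move=> _ [U oU <-]; rewrite (indexed_basis_bigcup bb oU) preimage_bigcup setI_bigcupr.
apply: countable_bigcup_measurable => c _; exact: fb.
Qed.

(** Every open set is a countable union of members of the base, so generation need only be checked
    on the base. *)
Lemma borel_sigma (G : set (set T)) : (forall c, <<s G >> (b c)) ->
  G `<=` (@measurable _ (borel T)) -> @measurable _ (borel T) = <<s G >>.
Proof.
move=> Gb Gm; apply/seteqP; split; last first.
  by apply: smallest_sub => //; exact: sigma_algebra_measurable.
apply: smallest_sub => [|U oU]; first exact: smallest_sigma_algebra.
rewrite (indexed_basis_bigcup bb oU).
pose GT := g_sigma_algebraType G.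
by apply: (@countable_bigcup_measurable _ GT) => c _; exact: Gb.
Qed.

End borel_measurability.

(** * Borel probability measures *)

Lemma polish_countable_basis (R : realType) (T : polishType R) : countable_basis T.
Proof. by have [D cD dD] := @separableT R T; exact: separable_countable_basis dD. Qed.

Lemma continuous_borel_measurable (R : realType) (T : ptopologicalType)
    (f : T -> R) : continuous f -> measurable_fun setT (f : borel T -> R).
Proof.
move=> cf; apply: (measurability _ (RGenOInfty.measurableE R)).
move=> /= _ [_ [r ->] <-]; rewrite setTI; apply: open_borel.
by apply: open_comp => // x _; exact: cf.
Qed.

Lemma nondecreasing_measure_gt d (T : measurableType d) (R : realType)
    (mu : {measure set T -> \bar R}) (F : nat -> set T) (r : \bar R) :
  (forall n, measurable (F n)) -> nondecreasing_seq F ->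
  (r < mu (\bigcup_n F n))%E -> exists n, (r < mu (F n))%E.
Proof.
move=> mF ndF rF; apply: contrapT => /forallNP h; move: rF; apply/negP; rewrite -leNgt.
have cvgF := nondecreasing_cvg_mu (mu := mu) mF (bigcupT_measurable _ mF) ndF.
rewrite -(cvg_lim _ cvgF)//; apply: lime_le; first by apply/cvg_ex; eexists; exact: cvgF.
by apply: nearW => k /=; rewrite leNgt; exact/negP/h.
Qed.

(* [phi] is a Urysohn function for the complement of [O] and the set of points at
   distance at least [(n.+1)^-1] from it, with [n] large. *)
Lemma bounded_continuous_below (R : realType) (T : polishType R) (mu : prob R T)
    (O : set T) (r : R) : open O -> (r%:E < mu O)%E ->
  exists phi : bounded_continuous R T,
    (forall x, 0 <= sval phi x <= \1_O x) /\ r < \int[mu]_x sval phi x.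
Proof.
move=> oO rO.
pose e n : R := n.+1%:R^-1; have e0 n : 0 < e n by rewrite invr_gt0.
pose C n := ~` \bigcup_(y in ~` O) (ball y (e n))°.
have cC n : closed (C n).
  by apply: open_closedC; apply: bigcup_open => y _; exact: open_interior.
have mC n : measurable (C n : set (borel T)) by exact: closed_borel.
have UC : \bigcup_n C n = O.
  apply/seteqP; split => [x [n _ Cx]|x Ox].
    apply: contrapT => nOx; apply: Cx; exists x => //.
    exact: nbhsx_ballx.
  have /nbhs_ballP[d /= d0 xdO] := open_nbhs_nbhs (conj oO Ox).
  have [n] := ltr_add_invr d0; rewrite add0r -/(e n) => end_.
  exists n => // -[y nOy /interior_subset yx]; apply: nOy; apply: xdO.
  by apply: (le_ball (ltW end_)); exact: ball_sym.
have ndC : nondecreasing_seq C.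
  apply/nondecreasing_seqP => n; apply/subsetPset => x Cx [y nOy yx]; apply: Cx.
  exists y => //; apply: interiorS yx; apply: le_ball.
  by rewrite lef_pV2 ?posrE// ler_nat.
have [n rCn] : exists n, (r%:E < mu (C n))%E.
  by apply: nondecreasing_measure_gt => //; rewrite UC.
have sep : uniform_separator (~` O) (C n).
  apply: uniform_separatorW.
  exists [set xy | ball xy.1 (e n / 2) xy.2].
    have en2 : 0 < e n / 2 by rewrite divr_gt0.
    exact: (entourage_ball T (PosNum en2)).
  rewrite -subset0 => -[y x] [[/= nOy Cx] yx]; apply: Cx; exists y => //.
  apply/nbhs_ballP; exists (e n / 2) => /=; first by rewrite divr_gt0.
  by move=> z xz; rewrite (splitr (e n)); exact: ball_triangle xz.
pose U : T -> R := Urysohn (~` O) (C n).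
have c01 x : 0 <= U x <= 1.
  have := @Urysohn_range T R (~` O) (C n) (U x).
  by rewrite /= in_itv/=; apply; exists x.
have U0 x : ~ O x -> U x = 0.
  by move=> nOx; have := @Urysohn_sub0 T R _ _ sep (U x) => ->//; exists x.
have U1 x : C n x -> U x = 1.
  by move=> Cx; have := @Urysohn_sub1 T R _ _ sep (U x) => ->//; exists x.
have cU : continuous U by exact: Urysohn_continuous.
have bphi : continuous U /\ exists M : R, forall x, `|U x| <= M.
  by split => //; exists 1 => x; have /andP[? ?] := c01 x; rewrite ger0_norm.
exists (exist (fun phi : T -> R =>
  continuous phi /\ exists M : R, forall x, `|phi x| <= M) _ bphi); split => [x|] /=.
  have /andP[-> Ux1] := c01 x; rewrite indicE.
  case: (boolP (x \in O)) => // /negP nOx.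
  by rewrite U0 ?lexx//= => Ox; apply: nOx; rewrite inE.
rewrite /Rintegral.
have mU : measurable_fun setT (EFin \o (U : borel T -> R)).
  by apply/measurable_EFinP; exact: continuous_borel_measurable.
have U_ge0 x : (0 <= (U x)%:E)%E by have /andP[] := c01 x; rewrite lee_fin.
have fin : (\int[mu]_x (U x)%:E <= 1)%E.
  rewrite -(probability_setT mu) -[leRHS]mul1e -integral_cst//.
  by apply: ge0_le_integral => // x _; rewrite lee_fin; case/andP: (c01 x).
rewrite -lte_fin fineK; last first.
  by rewrite ge0_fin_numE ?integral_ge0// (le_lt_trans fin)// ltry.
apply: (lt_le_trans rCn).
rewrite -[C n]setIT -integral_indic//; apply: ge0_le_integral => //.
- by apply/measurable_EFinP; exact: measurable_indic.
- move=> x _; rewrite lee_fin indicE; case: (boolP (x \in C n)) => [/set_mem Cx|_].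
    by rewrite U1.
  by have /andP[] := c01 x.
Qed.

(** Half of the portmanteau theorem: a bounded continuous function below the indicator of [O] whose
    integral exceeds [r] at [mu] still has an integral above [r] at all measures weakly close to
    [mu]. *)
Lemma open_prob_gt (R : realType) (T : polishType R) (O : set T) (r : R) :
  open O -> open [set mu : prob R T | (r%:E < mu O)%E].
Proof.
move=> oO; rewrite openE => mu /(bounded_continuous_below oO)[phi [phi01 rphi]].
have /cvg_sup/(_ phi) cphi : nbhs (integrals mu) --> integrals mu by exact: cvg_id.
have : nbhs mu ((@integrals R T) @^-1` [set g | r < g phi]).
  apply: (@initial_continuous _ _ (@integrals R T) mu); apply: cphi.
  exists [set g | r < g phi]; split => //.
  by exists [set x | r < x] => //; exact: open_gt.
apply: filterS => nu /= rnu.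
have mphi : measurable_fun setT (EFin \o (sval phi : borel T -> R)).
  by apply/measurable_EFinP; apply: continuous_borel_measurable; case: (svalP phi).
have phi0 x : (0 <= (sval phi x)%:E)%E by have /andP[] := phi01 x; rewrite lee_fin.
have phiO : (\int[nu]_x (sval phi x)%:E <= nu O)%E.
  have mO : measurable (O : set (borel T)) by exact: open_borel.
  rewrite -[X in nu X]setIT -integral_indic//; apply: ge0_le_integral => //.
    by apply/measurable_EFinP; exact: measurable_indic.
  by move=> x _; rewrite lee_fin; have /andP[] := phi01 x.
apply: (lt_le_trans _ phiO); rewrite -[X in (_ < X)%E]fineK ?lte_fin//.
rewrite ge0_fin_numE ?integral_ge0//; apply: (le_lt_trans phiO).
by rewrite (le_lt_trans (probability_le1 _ _)) ?ltry//; exact: open_borel.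
Qed.

Lemma measurable_prob_dynkin (R : realType) (T : ptopologicalType) d
    (X : measurableType d) (D : set X) (k : X -> prob R T) (G : set (set T)) :
  measurable D -> @measurable _ (borel T) = <<s G >> -> setI_closed G ->
  (forall A, G A -> measurable_fun D (fun x => k x A)) ->
  forall B : set (borel T), measurable B -> measurable_fun D (fun x => k x B).
Proof.
move=> mD GE GI mG B; rewrite GE.
apply: (@dynkin_induction _ (borel T) G
  [set B | measurable_fun D (fun x => k x B)] GE GI) => //=.
- by under eq_fun do rewrite probability_setT; exact: measurable_cst.
- move=> S mS kS.
  rewrite (_ : (fun x => _) = (cst 1 \- (fun x => k x S))%E).
    exact: emeasurable_funB.
  by apply/funext => x; rewrite probability_setC.
- move=> F mF tF kF.
  rewrite (_ : (fun x => _) = fun x => \sum_(0 <= n <oo) k x (F n))%E.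
    by apply: ge0_emeasurable_sum => // n x _ _; exact: measure_ge0.
  by apply/funext => x; rewrite measure_semi_bigcup//; exact: bigcupT_measurable.
Qed.

(** This makes kernels out of strategies and of Nature's moves, which are only known to be Borel for
    the weak topology. Evaluation at an open set is lower semicontinuous, and a Dynkin argument
    extends measurability to all Borel sets. *)
Lemma measurable_prob_ev (R : realType) (T : polishType R) (B : set (borel T)) :
  measurable B ->
  measurable_fun setT (fun mu : borel (prob R T) => (mu : prob R T) B).
Proof.
have openI : setI_closed (@open T) by move=> *; exact: openI.
apply: (measurable_prob_dynkin measurableT erefl openI) => O oO.
apply: (measurability _ (ErealGenOInfty.measurableE R)).
move=> /= _ [_ [r ->] <-]; apply: measurableI => //.
rewrite preimage_itvoy; apply: open_borel.
exact: open_prob_gt.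
Qed.

Lemma continuous_measurable_borel (T U : ptopologicalType) (f : T -> U) :
  continuous f -> measurable_fun setT (f : borel T -> borel U).
Proof.
move=> cf; apply: (@measurability _ _ (borel T) (borel U) setT f open erefl).
move=> _ [V oV <-]; rewrite setTI; apply: open_borel.
by apply: open_comp => // x _; exact: cf.
Qed.

Lemma measurable_fun_borel_pair (T U : ptopologicalType) d (aT : measurableType d)
    (D : set aT) (f : aT -> T) (g : aT -> U) :
  countable_basis T -> countable_basis U ->
  measurable_fun D (f : aT -> borel T) -> measurable_fun D (g : aT -> borel U) ->
  measurable_fun D ((fun x => (f x, g x)) : aT -> borel (T * U)%type).
Proof.
move=> [b bb] [c bc] mf mg.
apply: (@measurable_fun_basis _ (nat * nat)%type _ (indexed_basis_setX bb bc)).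
move=> mD p; rewrite (_ : _ `&` _ = (D `&` f @^-1` b p.1) `&` (D `&` g @^-1` c p.2)).
  apply: measurableI.
    by apply: mf => //; apply: open_borel; case: bb.
  by apply: mg => //; apply: open_borel; case: bc.
by apply/seteqP; split => [x [Dx []]|x [[Dx ?] [_ ?]]].
Qed.

Lemma measurable_fun_borel_prod (I : countType) (T : I -> ptopologicalType) d
    (aT : measurableType d) (D : set aT) (f : aT -> prod_topology T) :
  (forall i, countable_basis (T i)) ->
  (forall i, measurable_fun D ((fun x => f x i) : aT -> borel (T i))) ->
  measurable_fun D (f : aT -> borel (prod_topology T)).
Proof.
move=> h mf; pose b i := sval (cid (h i)).
have bb i : indexed_basis (b i) by exact: (svalP (cid (h i))).
apply: (@measurable_fun_basis _ _ _ (indexed_basis_proj_sets bb)).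
move=> mD; elim => [|p s ih].
  rewrite (_ : f @^-1` _ = setT) ?setIT//.
  by apply/seteqP; split.
rewrite (_ : _ `&` _ = (D `&` (fun x => f x p.1) @^-1` b p.1 p.2) `&`
    (D `&` f @^-1` proj_sets b s)).
  by apply: measurableI => //; apply: mf => //; apply: open_borel; case: (bb p.1).
apply/seteqP; split => [x [Dx xs]|x [[Dx xp] [_ xs]]].
  split; split => //; first by apply: xs; exact: mem_head.
  by move=> q qs; apply: xs; rewrite inE qs orbT.
by split => // q; rewrite inE => /predU1P[->|/xs].
Qed.

(** * Integration against probability measures and kernels *)

Section probability_integral.
Context d (T : measurableType d) (R : realType).
Local Open Scope ereal_scope.

Lemma integral_prob_cst (mu : probability T R) (c : \bar R) : \int[mu]_x c = c.
Proof.
by rewrite (@integral_cst _ T R mu setT measurableT c) [X in _ * X]probability_setT mule1.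
Qed.

(** Illegal moves and plays outside the game carry no mass; comparisons of integrals are therefore
    made on a measurable set [F] of measure one. *)
Lemma ge0_integral_full (mu : probability T R) (F : set T) (f : T -> \bar R) :
  measurable F -> mu F = 1 -> (forall x, 0 <= f x) -> measurable_fun setT f ->
  \int[mu]_x f x = \int[mu]_(x in F) f x.
Proof.
move=> mF F1 f0 mf.
rewrite (@ge0_negligible_integral _ T R mu setT (~` F))//.
- by rewrite setDE setCK setTI.
- exact: measurableC.
- by rewrite [LHS]probability_setC// F1 subee.
Qed.

Lemma ge0_le_integral_full (mu : probability T R) (F : set T) (f g : T -> \bar R) :
  measurable F -> mu F = 1 -> (forall x, 0 <= f x) -> measurable_fun setT f ->
  (forall x, 0 <= g x) -> measurable_fun setT g ->
  (forall x, F x -> f x <= g x) -> \int[mu]_x f x <= \int[mu]_x g x.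
Proof.
move=> mF F1 f0 mf g0 mg fg; rewrite !(ge0_integral_full mF F1)//.
by apply: ge0_le_integral => //; exact: measurable_funTS.
Qed.

Lemma eq_integral_full (mu : probability T R) (F : set T) (f g : T -> \bar R) :
  measurable F -> mu F = 1 -> (forall x, 0 <= f x) -> measurable_fun setT f ->
  (forall x, 0 <= g x) -> measurable_fun setT g ->
  (forall x, F x -> f x = g x) -> \int[mu]_x f x = \int[mu]_x g x.
Proof.
move=> mF F1 f0 mf g0 mg fg; rewrite !(ge0_integral_full mF F1)//.
by apply: eq_integral => x /set_mem; exact: fg.
Qed.

Lemma probability_bigcap1 (mu : probability T R) (F : nat -> set T) :
  (forall k, measurable (F k)) -> (forall k, mu (F k) = 1) -> mu (\bigcap_k F k) = 1.
Proof.
move=> mF F1; rewrite -[X in mu X]setCK setC_bigcap [LHS]probability_setC; last first.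
  by apply: bigcupT_measurable => k; exact: measurableC.
rewrite measure_negligible ?sube0//.
  by apply: bigcupT_measurable => k; exact: measurableC.
apply: negligible_bigcup => k; apply/negligibleP; first exact: measurableC.
by rewrite [LHS]probability_setC// F1 subee.
Qed.

Lemma probability_full_subset (mu : probability T R) (A B : set T) :
  measurable A -> measurable B -> A `<=` B -> mu A = 1 -> mu B = 1.
Proof.
move=> mA mB AB A1; apply/eqP; rewrite eq_le probability_le1//=.
by rewrite -A1 le_measure ?inE.
Qed.

Lemma eq_integral_prob (mu nu : probability T R) (f : T -> \bar R) :
  (forall B, measurable B -> mu B = nu B) ->
  \int[mu]_x f x = \int[nu]_x f x.
Proof. by move=> munu; apply: eq_measure_integral => B mB _; exact: munu. Qed.

End probability_integral.

Section kernel_integral.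
Context d d' (X : measurableType d) (Y : measurableType d') (R : realType).
Variable k : X -> probability Y R.
Hypothesis mk : forall B, measurable B -> measurable_fun setT (fun x => k x B).
Local Open Scope ereal_scope.

Let ker : X -> {measure set Y -> \bar R} := k.

HB.instance Definition _ := isKernel.Build _ _ X Y R ker mk.

Let ker1 x : ker x setT = 1. Proof. exact: probability_setT. Qed.

HB.instance Definition _ := Kernel_isProbability.Build _ _ X Y R ker ker1.

Lemma measurable_fun_integral_prob (f : X * Y -> \bar R) :
  (forall p, 0 <= f p) -> measurable_fun setT f ->
  measurable_fun setT (fun x => \int[k x]_y f (x, y)).
Proof.
move=> f0 mf.
exact: (measurable_fun_integral_finite_kernel f ker).
Qed.

Section disintegration.
Variables (l : probability X R) (mu : probability Y R).

Let g : X -> giry Y R := k.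

Let mg : measurable_fun setT g.
Proof. by apply: measurable_giry_codensity => //; exact: mk. Qed.

Let bindE (B : set Y) : measurable B ->
  giry_bind (l : giry X R) mg B = \int[l]_x k x B.
Proof.
move=> mB.
have := @giry_int_bind _ _ X Y R (l : giry X R) g mg (EFin \o \1_B).
rewrite /giry_int integral_indic// setIT => -> //.
- by apply: eq_integral => x _; rewrite integral_indic// setIT.
- by apply/measurable_EFinP; exact: measurable_indic.
- by move=> x; rewrite lee_fin.
Qed.

(** The mixture of the measures [k x] with weights [l] is a bind in the Giry monad, which comes with
    this integration formula. *)
Lemma integral_disintegration (f : Y -> \bar R) :
  (forall B, measurable B -> mu B = \int[l]_x k x B) ->
  (forall y, 0 <= f y) -> measurable_fun setT f ->
  \int[mu]_y f y = \int[l]_x \int[k x]_y f y.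
Proof.
move=> muE f0 mf.
rewrite -[RHS](@giry_int_bind _ _ X Y R (l : giry X R) g mg f mf f0).
by apply: eq_measure_integral => B mB _; exact: (etrans (muE B mB) (esym (bindE mB))).
Qed.

Lemma disintegration_unique (G : set (set Y)) :
  @measurable _ Y = <<s G >> -> setI_closed G -> G setT ->
  (forall A, G A -> mu A = \int[l]_x k x A) ->
  forall B, measurable B -> mu B = \int[l]_x k x B.
Proof.
move=> GE GI GT muE B mB; rewrite -(bindE mB).
have mG A : G A -> measurable A by rewrite GE; exact: sub_sigma_algebra.
apply: (@measure_unique _ R Y G (fun=> setT) GE) => //.
- by rewrite bigcup_const//; exists 0%N.
- by move=> A GA; exact: (etrans (muE A GA) (esym (bindE (mG A GA)))).
- by move=> _; rewrite /= probability_setT ltry.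
Qed.

End disintegration.

End kernel_integral.

(** Stated as an existence so that the bundling of [f] as a measurable function stays inside the
    proof. *)
Lemma image_prob_exists d d' (X : measurableType d) (Y : measurableType d')
    (R : realType) (mu : probability X R) (f : X -> Y) : measurable_fun setT f ->
  exists nu : probability Y R, (forall A, nu A = mu (f @^-1` A)) /\
    forall phi : Y -> \bar R, (forall y, 0 <= phi y)%E -> measurable_fun setT phi ->
      (\int[nu]_y phi y = \int[mu]_x phi (f x))%E.
Proof.
move=> mf; pose F : {mfun X >-> Y} := HB.pack f (isMeasurableFun.Build _ _ _ _ _ mf).
exists (distribution mu F); split => // phi phi0 mphi.
by rewrite /distribution ge0_integral_pushforward.
Qed.

Section within_continuous.
Variables (T : ptopologicalType) (D : set T).

Lemma within_continuous_open (U : topologicalType) (f : T -> U) (V : set U) :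
  {within D, continuous f} -> open V ->
  exists2 O : set T, open O & D `&` f @^-1` V = D `&` O.
Proof.
move=> cf oV; have /open_subspaceP[W oW WD] : open (f @^-1` V : set (subspace D)).
  by apply: open_comp => // x _; exact: cf.
by exists W => //; rewrite setIC -WD setIC.
Qed.

Lemma within_continuous_measurable_borel (U : ptopologicalType) (f : T -> U) :
  {within D, continuous f} -> measurable_fun (D : set (borel T)) (f : borel T -> borel U).
Proof.
move=> cf mD; apply: (@measurability _ _ (borel T) (borel U) D f open erefl) => //.
move=> _ [V oV <-]; have [W oW ->] := within_continuous_open cf oV.
by apply: measurableI => //; exact: open_borel.
Qed.

Lemma within_continuous_measurable (R : realType) (f : T -> R) :
  {within D, continuous f} -> measurable_fun (D : set (borel T)) (f : borel T -> R).
Proof.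
move=> cf mD; apply: (measurability _ (RGenOInfty.measurableE R)) => //.
move=> _ [_ [r ->] <-].
have [|W oW ->] := @within_continuous_open R f `]r, +oo[%classic cf.
  exact: interval_open.
by apply: measurableI => //; exact: open_borel.
Qed.

End within_continuous.

(** * Supports of Borel probability measures *)

Section support.
Variables (R : realType) (T : polishType R).

Lemma polish_hausdorff : hausdorff_space T.
Proof. exact: metric_hausdorff. Qed.

Lemma closed_point (x : T) : closed [set x].
Proof. by apply: accessible_closed_set1; exact/hausdorff_accessible/polish_hausdorff. Qed.

Lemma closed_prob_support (mu : prob R T) : closed (prob_support mu).
Proof. by apply: closed_bigI => C []. Qed.

(** The support is an intersection of possibly uncountably many closed sets of measure one. A
    countable base helps: the complement is covered by those basic sets that are null. *)
Lemma prob_support1 (mu : prob R T) : mu (prob_support mu) = 1%E.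
Proof.
have [b [ob bP]] := polish_countable_basis T.
have mS : measurable (prob_support mu : set (borel T)).
  by apply: closed_borel; exact: closed_prob_support.
pose N n : set (borel T) := if mu (b n) == 0%E then b n else set0.
have N0 : mu (\bigcup_n N n) = 0%E.
  have mN n : measurable (N n).
    by rewrite /N; case: ifP => // _; exact: open_borel.
  apply: measure_negligible; first exact: bigcupT_measurable.
  apply: negligible_bigcup => n; apply/negligibleP; first exact: mN.
  by rewrite /N; case: ifPn => [/eqP//|_]; rewrite measure0.
have SN : ~` prob_support mu `<=` \bigcup_n N n.
  move=> x /existsNP[C /not_implyP[[cC C1] nCx]].
  have mC : measurable (C : set (borel T)) by exact: closed_borel.
  have [n bnx bnC] := bP x (~` C) (open_nbhs_nbhs (conj (closed_openC cC) nCx)).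
  exists n => //; rewrite /N ifT//; apply/eqP.
  apply: (@subset_measure0 _ (borel T) R mu (b n) (~` C)) => //.
  - exact: open_borel.
  - exact: measurableC.
  - by rewrite [LHS]probability_setC// C1 subee.
have S0 : mu (~` prob_support mu) = 0%E.
  apply: (@subset_measure0 _ (borel T) R mu _ (\bigcup_n N n)) => //.
    exact: measurableC.
  by apply: bigcupT_measurable => n; rewrite /N; case: ifP => // _; exact: open_borel.
rewrite -[X in mu X]setCK [LHS]probability_setC ?S0 ?sube0//.
exact: measurableC.
Qed.

Lemma prob_support_min (mu : prob R T) (C : set T) :
  closed C -> mu C = 1%E -> prob_support mu `<=` C.
Proof. by move=> cC C1 x; apply. Qed.

Lemma prob_support_full (mu : prob R T) (C : set (borel T)) :
  measurable C -> prob_support mu `<=` C -> mu C = 1%E.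
Proof.
move=> mC SC; apply: (probability_full_subset _ mC SC); last exact: prob_support1.
by apply: closed_borel; exact: closed_prob_support.
Qed.

Lemma is_dirac_support (mu : prob R T) (x : T) :
  prob_support mu `<=` [set x] -> is_dirac mu x.
Proof.
move=> /(prob_support_full (closed_borel (@closed_point x))) x1 B mB.
rewrite /dirac_prob /= diracE; case: (boolP (x \in B)) => [/set_mem Bx|].
  apply: (probability_full_subset _ mB _ x1); last by move=> _ ->.
  by apply: closed_borel; exact: closed_point.
move=> /negP nBx; apply: (@subset_measure0 _ (borel T) R mu B (~` [set x])) => //.
- by apply: measurableC; apply: closed_borel; exact: closed_point.
- by move=> y By yx; apply: nBx; rewrite inE -yx.
- rewrite [LHS]probability_setC ?x1 ?subee//.
  by apply: closed_borel; exact: closed_point.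
Qed.

Lemma dirac_prob_support (x : T) (C : set T) :
  closed C -> C x -> prob_support (dirac_prob R x) `<=` C.
Proof.
by move=> cC Cx; apply: prob_support_min => //; rewrite /dirac_prob /= diracE mem_set.
Qed.

End support.

(** * The Ionescu-Tulcea theorem *)

Section ionescu_tulcea.
Variables (R : realType) (S : nat -> ptopologicalType).
Hypothesis bS : forall i, countable_basis (S i).

Let Omega : ptopologicalType := prod_topology S.

Variable kappa : forall m, Omega -> prob R (S m).

(** Kernels take whole sequences as arguments and are only required to respect [agree m]. This
    avoids separate types of finite sequences. *)
Definition agree m (w w' : Omega) := forall k, (k < m)%N -> w k = w' k.

Hypothesis kappa_measurable : forall m (B : set (borel (S m))), measurable B ->
  measurable_fun setT ((fun w => kappa m w B) : borel Omega -> \bar R).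
Hypothesis kappa_past : forall m w w', agree m w w' -> kappa m w = kappa m w'.

Local Open Scope ereal_scope.

Definition upd m (w : Omega) (z : S m) : Omega := dfwith w m z.

Lemma updE m w (z : S m) : upd w z m = z.
Proof. exact: dfwithin. Qed.

Lemma upd_other m w (z : S m) k : k != m -> upd w z k = w k.
Proof. by move=> km; rewrite /upd dfwithout// eq_sym. Qed.

Lemma agree_upd m w w' (z : S m) : agree m w w' -> agree m.+1 (upd w z) (upd w' z).
Proof.
move=> ww' k; rewrite ltnS leq_eqVlt => /predU1P[->|km]; first by rewrite !updE.
by rewrite !upd_other ?ww'// ltn_eqF.
Qed.

Lemma agree_upd_self m w (z : S m) : agree m (upd w z) w.
Proof. by move=> k km; rewrite upd_other// ltn_eqF. Qed.

Lemma agree_le m n w w' : (m <= n)%N -> agree n w w' -> agree m w w'.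
Proof. by move=> mn ww' k km; apply: ww'; exact: leq_trans mn. Qed.

Lemma agree_sym m w w' : agree m w w' -> agree m w' w.
Proof. by move=> h k /h. Qed.

Lemma measurable_coord i : measurable_fun setT ((fun w => w i) : borel Omega -> borel (S i)).
Proof. by apply: continuous_measurable_borel; exact: proj_continuous. Qed.

Lemma measurable_upd m : measurable_fun setT
  ((fun p => upd p.1 p.2) : borel Omega * borel (S m) -> borel Omega).
Proof.
apply: measurable_fun_borel_prod => // i.
have [im|im] := eqVneq i m.
  subst i; rewrite (_ : (fun x => _) = snd); first exact: measurable_snd.
  by apply/funext => p; rewrite updE.
rewrite (_ : (fun x => _) = (fun w => w i) \o fst).
  exact: (measurableT_comp (@measurable_coord i) measurable_fst).
by apply/funext => p; rewrite /= upd_other.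
Qed.

Lemma measurable_upd2 m w : measurable_fun setT
  ((fun z => upd w z) : borel (S m) -> borel Omega).
Proof. by apply: continuous_measurable_borel; exact: dfwith_continuous. Qed.

Definition step m (phi : Omega -> \bar R) (w : Omega) : \bar R :=
  \int[kappa m w]_z phi (upd w z).

(** Iterated integral over the coordinates [m] to [m + n - 1], the last coordinate being
    innermost. *)
Fixpoint steps m n phi := if n is n'.+1 then step m (steps m.+1 n' phi) else phi.

Definition depends_before m (phi : Omega -> \bar R) :=
  forall w w', agree m w w' -> phi w = phi w'.

Definition nonneg_measurable (phi : Omega -> \bar R) :=
  (forall w, 0 <= phi w) /\ measurable_fun setT (phi : borel Omega -> \bar R).

Lemma step_nonneg_measurable m phi : nonneg_measurable phi ->
  nonneg_measurable (step m phi).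
Proof.
move=> [phi0 mphi]; split => [w|]; first by apply: integral_ge0.
apply: (@measurable_fun_integral_prob _ _ (borel Omega) (borel (S m)) R (kappa m) _
  (fun p => phi (upd p.1 p.2))) => //.
  exact: kappa_measurable.
exact: (measurableT_comp mphi (@measurable_upd m)).
Qed.

Lemma steps_nonneg_measurable m n phi : nonneg_measurable phi ->
  nonneg_measurable (steps m n phi).
Proof.
by move=> phi0; elim: n m => //= n ih m; exact/step_nonneg_measurable/ih.
Qed.

Lemma measurable_section m w phi : nonneg_measurable phi ->
  measurable_fun setT ((fun z => phi (upd w z)) : borel (S m) -> \bar R).
Proof. by move=> [_ mphi]; exact: (measurableT_comp mphi (@measurable_upd2 m w)). Qed.

Lemma step_depends m phi : depends_before m.+1 phi -> depends_before m (step m phi).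
Proof.
move=> dphi w w' ww'; rewrite /step (kappa_past ww'); apply: eq_integral => z _.
by apply: dphi; exact: agree_upd.
Qed.

Lemma step_id m phi : depends_before m phi -> step m phi = phi.
Proof.
move=> dphi; apply/funext => w; rewrite /step.
under eq_integral do rewrite (dphi _ _ (@agree_upd_self m w _)).
exact: integral_prob_cst.
Qed.

Lemma depends_before_le m n phi : (m <= n)%N -> depends_before m phi ->
  depends_before n phi.
Proof. by move=> mn dphi w w' /(agree_le mn)/dphi. Qed.

Lemma steps_depends m n phi : depends_before (m + n) phi ->
  depends_before m (steps m n phi).
Proof.
elim: n m => [|n ih] m; first by rewrite addn0.
by rewrite addnS -addSn => /ih; exact: step_depends.
Qed.

(** Integrating over a coordinate on which the function does not depend changes nothing, so once all
    relevant coordinates are integrated out, further steps have no effect. *)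
Lemma steps_add m n k phi : depends_before (m + n) phi ->
  steps m (n + k) phi = steps m n phi.
Proof.
elim: n m => [|n ih] m; last by rewrite addnS -addSn => /ih /= ->.
rewrite addn0 add0n; elim: k m => //= k ih m dphi.
by rewrite ih ?step_id//; exact: depends_before_le dphi.
Qed.

Lemma steps_level m n n' phi : depends_before (m + n) phi ->
  depends_before (m + n') phi -> steps m n phi = steps m n' phi.
Proof.
move=> dn dn'; rewrite -(steps_add n' dn) -(steps_add n dn').
by rewrite addnC.
Qed.

Lemma stepD m phi psi : nonneg_measurable phi -> nonneg_measurable psi ->
  step m (phi \+ psi) = step m phi \+ step m psi.
Proof.
move=> mphi mpsi; apply/funext => w; rewrite /step ge0_integralD//.
- by move=> z _; case: mphi.
- exact: measurable_section.
- by move=> z _; case: mpsi.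
- exact: measurable_section.
Qed.

Lemma stepsD m n phi psi : nonneg_measurable phi -> nonneg_measurable psi ->
  steps m n (phi \+ psi) = steps m n phi \+ steps m n psi.
Proof.
move=> mphi mpsi; elim: n m => //= n ih m.
by rewrite ih stepD//; exact: steps_nonneg_measurable.
Qed.

Definition cylinder : set (set Omega) := [set C |
  measurable (C : set (borel Omega)) /\
  exists m, forall w w', agree m w w' -> C w -> C w'].

Let ind (C : set Omega) (w : Omega) : \bar R := (\1_C w)%:E.

Let ind_nm C : cylinder C -> nonneg_measurable (ind C).
Proof.
move=> [mC _]; split => [w|]; first by rewrite lee_fin.
by apply/measurable_EFinP; exact: measurable_indic.
Qed.

Let ind_depends m (C : set Omega) : (forall w w', agree m w w' -> C w -> C w') ->
  depends_before m (ind C).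
Proof.
move=> dC w w' ww'; rewrite /ind !indicE (_ : (w \in C) = (w' \in C))//.
apply/idP/idP => /set_mem; first by move=> Cw; rewrite inE; exact: dC Cw.
by move=> Cw; rewrite inE; apply: dC Cw; exact: agree_sym.
Qed.

(** Any number of coordinates that determines [C] would do; [cyl_probE] makes the choice
    immaterial. *)
Definition level (C : set Omega) : nat :=
  xget 0%N [set m | forall w w', agree m w w' -> C w -> C w'].

Lemma levelP C : cylinder C -> depends_before (level C) (ind C).
Proof.
move=> [_ [m mC]]; apply: ind_depends.
exact: (@xgetPex _ 0%N [set m | forall w w', agree m w w' -> C w -> C w'] (ex_intro _ m mC)).
Qed.

(** The conditional probability of [C] when the coordinates of [w] below [m] are kept and the later
    ones are drawn by [kappa]. Whatever [m] is, [level C] steps from [m] on reach past all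
    coordinates that matter. *)
Definition cyl_prob m (w : Omega) (C : set Omega) : \bar R :=
  steps m (level C) (ind C) w.

Lemma cyl_probE m n w C : cylinder C -> depends_before (m + n) (ind C) ->
  cyl_prob m w C = steps m n (ind C) w.
Proof.
move=> cC dC; rewrite /cyl_prob (@steps_level m (level C) n)//.
by apply: depends_before_le (levelP cC); exact: leq_addl.
Qed.

Lemma cyl_prob_step m w C : cylinder C ->
  cyl_prob m w C = \int[kappa m w]_z cyl_prob m.+1 (upd w z) C.
Proof.
move=> cC; rewrite (@cyl_probE m (level C).+1)//.
by apply: depends_before_le (levelP cC); lia.
Qed.

Lemma cyl_prob_past m w C : cylinder C -> (level C <= m)%N ->
  cyl_prob m w C = (\1_C w)%:E.
Proof.
move=> cC lC; rewrite (@cyl_probE m 0)//.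
by apply: depends_before_le (levelP cC); lia.
Qed.

Lemma cyl_prob_nm m C : cylinder C ->
  nonneg_measurable (fun w => cyl_prob m w C).
Proof. by move=> cC; apply: steps_nonneg_measurable; exact: ind_nm. Qed.

Lemma cyl_prob_depends m C : cylinder C -> depends_before m (fun w => cyl_prob m w C).
Proof.
move=> cC; apply: steps_depends.
by apply: depends_before_le (levelP cC); exact: leq_addl.
Qed.

Lemma cylinder0 : cylinder set0.
Proof. by split => //; exists 0%N. Qed.

Lemma cylinderC C : cylinder C -> cylinder (~` C).
Proof.
move=> [mC [m dC]]; split; first exact: measurableC.
by exists m => w w' ww' nCw Cw'; apply: nCw; apply: dC Cw'; exact: agree_sym.
Qed.

Lemma cylinderU C D : cylinder C -> cylinder D -> cylinder (C `|` D).
Proof.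
move=> [mC [m dC]] [mD [n dD]]; split; first exact: measurableU.
exists (maxn m n) => w w' ww' [Cw|Dw]; [left; apply: dC Cw|right; apply: dD Dw].
  by apply: agree_le ww'; exact: leq_maxl.
by apply: agree_le ww'; exact: leq_maxr.
Qed.

Lemma cyl_prob0 m w : cyl_prob m w set0 = 0.
Proof.
rewrite /cyl_prob; move: (level set0) => n; elim: n m w => [|n ih] m w /=.
  by rewrite /ind indic0.
by rewrite /step integral0_eq.
Qed.

Lemma cyl_probU m w C D : cylinder C -> cylinder D -> C `&` D = set0 ->
  cyl_prob m w (C `|` D) = cyl_prob m w C + cyl_prob m w D.
Proof.
move=> cC cD CD0; pose n := maxn (level C) (maxn (level D) (level (C `|` D))).
have cU := cylinderU cC cD.
rewrite (@cyl_probE m n w C cC); last by apply: depends_before_le (levelP cC); lia.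
rewrite (@cyl_probE m n w D cD); last by apply: depends_before_le (levelP cD); lia.
rewrite (@cyl_probE m n w _ cU); last by apply: depends_before_le (levelP cU); lia.
rewrite (_ : ind (C `|` D) = ind C \+ ind D) ?stepsD//; try exact: ind_nm.
apply/funext => v; rewrite /ind /= !indicE in_setU -EFinD.
case: (boolP (v \in C)) => /= [/set_mem vC|_]; last by rewrite add0r.
case: (boolP (v \in D)) => /= [/set_mem vD|_]; last by rewrite addr0.
by have : (C `&` D) v by []; rewrite CD0.
Qed.

(* If the total mass of the [F n] is less than that of [C], then this remains so
   for some choice of the next coordinate.  Repeated choices build a point of [C]
   that lies in no [F n]. *)
Lemma cyl_prob_subadditive m w C (F : nat -> set Omega) : cylinder C ->
  (forall n, cylinder (F n)) -> C `<=` \bigcup_n F n ->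
  cyl_prob m w C <= \sum_(n <oo) cyl_prob m w (F n).
Proof.
move=> cC cF CF.
pose bad m w := \sum_(n <oo) cyl_prob m w (F n) < cyl_prob m w C.
rewrite leNgt; apply/negP => bad0.
have bad_step k v : bad k v -> exists z, bad k.+1 (@upd k v z).
  apply: contraPP => /forallNP nbad; apply/negP; rewrite -leNgt cyl_prob_step//.
  under eq_eseriesr do rewrite cyl_prob_step//.
  rewrite -integral_nneseries//; last 2 first.
  - by move=> n; apply: measurable_section; exact: cyl_prob_nm.
  - by move=> n z _; case: (cyl_prob_nm k.+1 (cF n)).
  apply: ge0_le_integral => //.
  - by move=> z _; case: (cyl_prob_nm k.+1 cC).
  - by apply: measurable_section; exact: cyl_prob_nm.
  - apply: ge0_emeasurable_sum => [n z _ _|n _].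
      by case: (cyl_prob_nm k.+1 (cF n)).
    by apply: measurable_section; exact: cyl_prob_nm.
  - by move=> z _; rewrite leNgt; exact/negP/nbad.
pose next k v := if pselect (bad k v) is left h then upd v (sval (cid (bad_step k v h))) else v.
pose W := fix W j := if j is j'.+1 then next (m + j')%N (W j') else w.
have badW j : bad (m + j)%N (W j).
  elim: j => [|j ih]; first by rewrite addn0.
  rewrite addnS /= /next; case: pselect => // h.
  exact: (svalP (cid (bad_step _ _ h))).
have W_fix i j k : (i <= j)%N -> (k < m + i)%N -> W j k = W i k.
  move=> + kmi; elim: j => [|j ih]; first by rewrite leqn0 => /eqP->.
  rewrite leq_eqVlt => /predU1P[<-//|]; rewrite ltnS => ij.
  rewrite -ih// /= /next; case: pselect => // h; rewrite upd_other//.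
  by apply/eqP; lia.
(* [W j] no longer changes below [m + j], so coordinate [k] is final in [W k.+1], also when [m] is
   zero. *)
pose v : Omega := fun k => W k.+1 k.
have vW j : agree (m + j) v (W j).
  move=> k kmj; rewrite /v; have [kj|jk] := leqP k.+1 j.
    by rewrite (W_fix _ _ _ kj)//; lia.
  by rewrite (W_fix j)//; lia.
have badv j : bad (m + j)%N v.
  have := badW j; rewrite /bad (cyl_prob_depends cC (vW j)).
  by under eq_eseriesr do rewrite -(cyl_prob_depends (cF _) (vW j)).
have Cv : C v.
  have := badv (level C); rewrite /bad cyl_prob_past//; last by lia.
  rewrite indicE; case: (boolP (v \in C)) => [/set_mem//|_].
  by rewrite ltNge nneseries_ge0// => n _ _; case: (cyl_prob_nm (m + level C) (cF n)).
have [n _ Fnv] := CF v Cv.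
(* Beyond both levels the conditional probabilities at [v] are indicators, and the term of [F n],
   equal to one, already makes up for that of [C]. *)
have := badv (maxn (level C) (level (F n))); apply/negP; rewrite -leNgt.
rewrite cyl_prob_past//; last by lia.
rewrite (@le_trans _ _ 1)//; first by rewrite lee_fin indicE lern1 leq_b1.
set l := (m + _)%N.
rewrite (@le_trans _ _ (cyl_prob l v (F n)))//.
  rewrite cyl_prob_past//; last by rewrite /l; lia.
  by rewrite indicE mem_set.
rewrite (nneseriesD1 (n := n))//; last first.
  by move=> k _; case: (cyl_prob_nm l (cF k)).
by rewrite leeDl// nneseries_ge0// => k _ _; case: (cyl_prob_nm l (cF k)).
Qed.

(** An alias that carries the algebra of cylinders, from which the measure is extended. *)
Definition cylinder_space := Omega.

HB.instance Definition _ := Pointed.on cylinder_space.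

Definition cylinder_display : measure_display. Proof. exact. Qed.

HB.instance Definition _ := @isAlgebraOfSets.Build cylinder_display cylinder_space
  cylinder cylinder0 cylinderU cylinderC.

Section extension.
Variables (m : nat) (w : Omega).

Let mu (C : set cylinder_space) : \bar R := cyl_prob m w C.

Let mu_ge0 C : 0 <= mu C.
Proof.
rewrite /mu /cyl_prob; move: (level C) m w => n; elim: n => [|n ih] k v /=.
  by rewrite lee_fin.
by apply: integral_ge0.
Qed.

Let mu_semi_additive : measure_function.semi_additive mu.
Proof.
apply/(additive2P (cyl_prob0 m w)) => A B cA cB AB0; exact: cyl_probU.
Qed.

HB.instance Definition _ := isContent.Build _ cylinder_space R mu mu_ge0 mu_semi_additive.

Let mu_sigma_subadditive : measurable_subset_sigma_subadditive mu.
Proof. by move=> A F mF mA AF; exact: cyl_prob_subadditive. Qed.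

HB.instance Definition _ :=
  Content_SigmaSubAdditive_isMeasure.Build _ _ _ mu mu_sigma_subadditive.

(** The countable bases of the factors matter here: they make every open set of the product a
    countable union of open cylinders, so that the extension from cylinders reaches all Borel sets
    of the product topology. *)
Lemma borel_cylinder : @measurable _ (borel Omega) = <<s cylinder >>.
Proof.
pose b i := sval (cid (bS i)).
have bb i : indexed_basis (b i) by exact: (svalP (cid (bS i))).
apply: (borel_sigma (indexed_basis_proj_sets bb)); last by move=> C [].
move=> s; apply: sub_sigma_algebra; split.
  by apply: open_borel; case: (indexed_basis_proj_sets bb).
exists (\max_(p <- s) p.1).+1 => v v' vv' vs p ps; rewrite -vv'; first exact: vs.
by rewrite ltnS; exact: (@leq_bigmax_seq _ _ _ (fun p : nat * nat => p.1)).
Qed.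

Definition path_prob : set (borel Omega) -> \bar R := measure_extension mu.

Let path_prob0 : path_prob set0 = 0.
Proof. exact: measure0. Qed.

Let path_prob_ge0 A : 0 <= path_prob A.
Proof. exact: measure_ge0. Qed.

Let path_prob_sigma_additive : semi_sigma_additive path_prob.
Proof.
move=> F mF tF mUF; rewrite borel_cylinder in mUF.
apply: (@measure_semi_sigma_additive _ _ _ (measure_extension mu)) => // n.
by have := mF n; rewrite borel_cylinder.
Qed.

HB.instance Definition _ := isMeasure.Build _ _ _ path_prob
  path_prob0 path_prob_ge0 path_prob_sigma_additive.

Lemma path_probE C : cylinder C -> path_prob C = cyl_prob m w C.
Proof. by move=> cC; exact: (measurable_mu_extE mu). Qed.

Let path_probT : path_prob setT = 1.
Proof.
rewrite path_probE; last by rewrite -setC0; exact/cylinderC/cylinder0.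
rewrite /cyl_prob; move: (level setT) m w => n; elim: n => [|n ih] k v /=.
  by rewrite /ind indicT.
by rewrite /step; under eq_integral do rewrite ih; exact: integral_prob_cst.
Qed.

HB.instance Definition _ :=
  Measure_isProbability.Build _ _ _ path_prob path_probT.

End extension.

Definition trajectory m w : prob R Omega := path_prob m w.

Lemma cylinderI : setI_closed cylinder.
Proof.
move=> C D cC cD; rewrite -[_ `&` _]setCK setCI.
by apply/cylinderC/cylinderU; exact/cylinderC.
Qed.

Lemma cylinderT : cylinder setT.
Proof. by rewrite -setC0; exact/cylinderC/cylinder0. Qed.

Lemma trajectory_past m n w C : measurable (C : set (borel Omega)) -> (n <= m)%N ->
  (forall v v', agree n v v' -> C v -> C v') -> trajectory m w C = (\1_C w)%:E.
Proof.
move=> mC nm dC; have cC : cylinder C by split => //; exists n.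
rewrite /trajectory /= path_probE// (@cyl_probE m 0)// addn0.
by apply: ind_depends => v v' /(agree_le nm); exact: dC.
Qed.

Lemma measurable_trajectory m (B : set (borel Omega)) : measurable B ->
  measurable_fun setT ((fun w => trajectory m w B) : borel Omega -> \bar R).
Proof.
apply: (@measurable_prob_dynkin R Omega _ (borel Omega) setT (trajectory m) cylinder
  measurableT borel_cylinder cylinderI) => C cC.
rewrite /trajectory /= (_ : (fun w => _) = fun w => cyl_prob m w C).
  by case: (cyl_prob_nm m cC).
by apply/funext => w; rewrite path_probE.
Qed.

Lemma measurable_trajectory_upd m w (B : set (borel Omega)) : measurable B ->
  measurable_fun setT ((fun z => trajectory m.+1 (@upd m w z) B) : borel (S m) -> \bar R).
Proof.
by move=> mB; exact: (measurableT_comp (@measurable_trajectory m.+1 B mB) (@measurable_upd2 m w)).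
Qed.

(** On cylinders this is the recursion for [cyl_prob]; both sides are measures in [B], and cylinders
    are stable under intersection. *)
Lemma trajectory_step m w (B : set (borel Omega)) : measurable B ->
  trajectory m w B = \int[kappa m w]_z trajectory m.+1 (upd w z) B.
Proof.
apply: (disintegration_unique (@measurable_trajectory_upd m w) borel_cylinder cylinderI
  cylinderT) => C cC.
rewrite /trajectory /= path_probE// cyl_prob_step//.
by apply: eq_integral => z _; rewrite path_probE.
Qed.

Lemma integral_trajectory_step m w (f : Omega -> \bar R) : nonneg_measurable f ->
  \int[trajectory m w]_v f v = \int[kappa m w]_z \int[trajectory m.+1 (upd w z)]_v f v.
Proof.
move=> [f0 mf]; apply: integral_disintegration => //.
  by move=> B mB; exact: measurable_trajectory_upd.
by move=> B mB; exact: trajectory_step.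
Qed.

End ionescu_tulcea.

(** * Histories, plays and their laws *)

Lemma second_countable_basis (T : topologicalType) :
  @second_countable T -> countable_basis T.
Proof.
move=> [B cB [oB bB]].
have BU x U : nbhs x U -> exists2 V, B V /\ V x & V `<=` U.
  by move=> /bB[V [BV Vx] VU]; exists V.
have [B0|[f]] := pfcard_geP cB.
  exists (fun=> set0); split => [_|x U /BU[V []]]; first exact: open0.
  by rewrite B0.
exists f; split => [k|x U /BU[V [BV Vx] VU]]; first by apply: oB; exact: funS.
by have [k _ fk] := @surj _ _ _ _ f V BV; exists k; rewrite fk.
Qed.

Section spaces_theory.
Variables (n : nat) (R : realType) (E : spaces n R).

Lemma stage_basis t : countable_basis (stage E t).
Proof.
case: t => [|t] /=.
  apply: countable_basis_prod; last exact: polish_countable_basis.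
  (* Separability of the space of starting actions is not given but follows from its compactness. *)
  apply: second_countable_basis.
  exact: (@compact_second_countable R (start_act E) (@start_act_compact n R E)).
apply: countable_basis_prod; last exact: polish_countable_basis.
by apply: countable_basis_prod_topology => i; exact: polish_countable_basis.
Qed.

Lemma hist_basis t : countable_basis (hist E t).
Proof.
elim: t => [|t ih]; first exact: stage_basis.
by apply: countable_basis_prod => //; exact: stage_basis.
Qed.

Lemma trunc_continuous t : continuous (@trunc n R E t).
Proof.
elim: t => [|t ih] w; first exact: proj_continuous.
have h := @cvg_pair _ _ _ (nbhs w) (nbhs (trunc t w)) (nbhs (w t.+1)) _ _ _ _ _
  (ih w) (@proj_continuous nat (stage E) t.+1 w).
exact: h.
Qed.

Lemma agree_trunc t (w w' : play E) :
  agree t.+1 w w' <-> trunc t w = trunc t w'.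
Proof.
split => [|+ k].
  elim: t => [|t ih] ww' /=; first exact: (ww' 0%N (ltnSn 0)).
  by rewrite (ww' t.+1 (ltnSn _)) (ih (fun k kt => ww' k (ltnW kt))).
elim: t k => [|t ih] k /=; first by move=> ww'; rewrite ltnS leqn0 => /eqP->.
move=> [ww' wt]; rewrite ltnS leq_eqVlt => /predU1P[->//|]; exact: ih.
Qed.

(** A section of [trunc t]. The later coordinates are a dummy [point], so [extend h] is in general
    no play of the game; it serves only for what is determined by the stages up to [t]. *)
Fixpoint extend t : hist E t -> play E :=
  match t return hist E t -> play E with
  | 0 => fun h => @dfwith nat (stage E) point 0%N h
  | t'.+1 => fun h => @dfwith nat (stage E) (@extend t' h.1) t'.+1 h.2
  end.

Lemma trunc_upd t k (w : play E) (z : stage E k) : (t < k)%N ->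
  trunc t (upd w z) = trunc t w.
Proof.
move=> tk; apply/agree_trunc; apply: (@agree_le _ _ k) => //.
exact: agree_upd_self.
Qed.

Lemma extendK t (h : hist E t) : trunc t (extend h) = h.
Proof.
elim: t h => [|t ih] /= h; first by rewrite dfwithin.
by rewrite (@trunc_upd t t.+1)// ih dfwithin; case: h.
Qed.

Lemma measurable_trunc t : measurable_fun setT
  (@trunc n R E t : borel (play E) -> borel (hist E t)).
Proof. by apply: continuous_measurable_borel; exact: trunc_continuous. Qed.

Lemma measurable_fst_borel t : measurable_fun setT
  ((fun h => h.1) : borel (hist E t.+1) -> borel (hist E t)).
Proof. by apply: continuous_measurable_borel => -[x y]; exact: cvg_fst. Qed.

Lemma measurable_snd_borel t : measurable_fun setT
  ((fun h => h.2) : borel (hist E t.+1) -> borel (stage E t.+1)).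
Proof. by apply: continuous_measurable_borel => -[x y]; exact: cvg_snd. Qed.

Lemma extend_continuous t : continuous (@extend t).
Proof.
elim: t => [|t ih] h; apply: cvg_prod_topology => i.
  have [->|i0] := eqVneq i 0%N.
    rewrite (_ : (fun x => _) = id); last by apply/funext => x /=; rewrite dfwithin.
    by rewrite /= dfwithin; exact: cvg_id.
  rewrite (_ : (fun x => _) = cst point).
    by rewrite /= dfwithout 1?eq_sym//; exact: cvg_cst.
  by apply/funext => x /=; rewrite dfwithout// eq_sym.
have [->|it] := eqVneq i t.+1.
  rewrite (_ : (fun x => _) = snd); last by apply/funext => x /=; rewrite dfwithin.
  by rewrite /= dfwithin; case: h => h z; exact: cvg_snd.
rewrite (_ : (fun x => _) = (fun w : play E => w i) \o (@extend t) \o fst); last first.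
  by apply/funext => x /=; rewrite dfwithout// eq_sym.
rewrite /= dfwithout 1?eq_sym//.
have c1 : fst @ h --> h.1 by case: h => h z; exact: cvg_fst.
have c2 := @cvg_comp _ _ _ fst (@extend t) (nbhs h) (nbhs h.1) _ c1 (ih h.1).
exact: (@cvg_comp _ _ _ _ (fun w : play E => w i) (nbhs h) (nbhs (extend h.1)) _ c2
  (@proj_continuous nat (stage E) i (extend h.1))).
Qed.

Lemma measurable_extend t : measurable_fun setT
  (@extend t : borel (hist E t) -> borel (play E)).
Proof. by apply: continuous_measurable_borel; exact: extend_continuous. Qed.

End spaces_theory.

Section game_sets.
Variables (n : nat) (R : realType) (G : game n R).
Local Notation X := (act_space G).
Local Notation H := (hist_set (action G)).

Lemma action_closed t i h : H t h -> closed (action G t i h).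
Proof.
by move=> Hh; apply: compact_closed; [exact: polish_hausdorff|exact: action_compact].
Qed.

Lemma stage_act_continuous t i :
  continuous ((fun z => z.1 i) : stage G t.+1 -> X t i).
Proof.
move=> [x s]; have := @cvg_comp _ _ _ (fst : stage G t.+1 -> _) (fun x => x i)
  (nbhs (x, s)) (nbhs x) (nbhs (x i)) cvg_fst (@proj_continuous _ (X t) i x).
exact.
Qed.

Lemma hist_set_closed t : closed (H t).
Proof.
elim: t => [|t ih] /=; first exact: closedT.
rewrite -openC openE => -[h [x s]] /= nH.
have c1 : (fun q : hist G t.+1 => q.1) @ (h, (x, s)) --> h by exact: cvg_fst.
have c2 i : (fun q : hist G t.+1 => q.2.1 i) @ (h, (x, s)) --> x i.
  have h2 : (fun q : hist G t.+1 => q.2) @ (h, (x, s)) --> (x, s) by exact: cvg_snd.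
  have := @cvg_comp _ _ _ (fun q : hist G t.+1 => q.2) (fun z : stage G t.+1 => z.1 i)
    (nbhs (h, (x, s))) (nbhs (x, s)) (nbhs (x i)) h2 (@stage_act_continuous t i (x, s)).
  exact.
have [Hh|nHh] := pselect (H t h); last first.
  have nH1 : nbhs (h, (x, s)) [set q : hist G t.+1 | ~ H t q.1].
    exact: (c1 _ (open_nbhs_nbhs (conj (closed_openC ih) nHh))).
  by rewrite /interior; apply: filterS nH1 => q nq [].
have [i nA] : exists i, ~ action G t i h (x i).
  by apply: contrapT => /forallNP nn; apply: nH; split => // i; apply: contrapT.
have nAx : nbhs (x i) (~` action G t i h).
  by apply: open_nbhs_nbhs; split => //; apply: closed_openC; exact: action_closed.
have [U xU UA] := @uniform_regular (X t i) (x i) _ nAx.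
have oV : open (~` closure U) by apply: closed_openC; exact: closed_closure.
have AV : action G t i h `<=` ~` closure U by move=> y Ay /UA.
have := @action_uhc n R G t i h Hh _ oV AV.
rewrite near_withinE => n0.
have n1 : nbhs (h, (x, s)) [set q : hist G t.+1 |
    H t q.1 -> action G t i q.1 `<=` ~` closure U] by exact: (c1 _ n0).
have n2 : nbhs (h, (x, s)) [set q : hist G t.+1 | U (q.2.1 i)] by exact: (c2 i _ xU).
rewrite /interior; apply: filterS (filterI n1 n2) => q /= [q1 q2] [Hq Aq].
exact: (q1 Hq _ (Aq i) (subset_closure q2)).
Qed.

Lemma measurable_hist_set t : measurable (H t : set (borel (hist G t))).
Proof. by apply: closed_borel; exact: hist_set_closed. Qed.

Lemma measurable_play_set : measurable (play_set (action G) : set (borel (play G))).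
Proof.
rewrite (_ : play_set _ = \bigcap_t (trunc t @^-1` H t)).
  apply: bigcapT_measurable => t; rewrite -[X in measurable X]setTI.
  by apply: measurable_trunc => //; exact: measurable_hist_set.
by apply/seteqP; split => [w Hw t _|w Hw t]; exact: Hw.
Qed.

Lemma hist_set_trunc t k w : (k <= t)%N -> H t (trunc t w) -> H k (trunc k w).
Proof.
elim: t => [|t ih]; first by rewrite leqn0 => /eqP->.
by rewrite leq_eqVlt => /predU1P[->//|kt] /= [Hw _]; exact: ih.
Qed.

End game_sets.

(** * Product measures on the moves of one stage *)

Section product.
Variables (n : nat) (R : realType) (G : game n R) (t : nat).
Local Notation X := (act_space G).

Definition stage_box (C : forall i, set (X t i)) (D : set (nat_space G t)) :
  set (stage G t.+1) := [set z | (forall i, C i (z.1 i)) /\ D z.2].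

Definition stage_boxes : set (set (stage G t.+1)) := [set B |
  exists (C : forall i, set (borel (X t i))) (D : set (borel (nat_space G t))),
  [/\ forall i, measurable (C i), measurable D & B = stage_box C D]].

Lemma stage_box_measurable C D :
  (forall i, measurable (C i : set (borel (X t i)))) ->
  measurable (D : set (borel (nat_space G t))) ->
  measurable (stage_box C D : set (borel (stage G t.+1))).
Proof.
move=> mC mD.
rewrite (_ : stage_box C D = (\bigcap_(i in [set: 'I_n]) ((fun z => z.1 i) @^-1` C i)) `&` (snd @^-1` D)).
  apply: measurableI.
    apply: fin_bigcap_measurable => // i _; rewrite -[X in measurable X]setTI.
    apply: (@continuous_measurable_borel (stage G t.+1) _ (fun z => z.1 i)) => //.
    exact: stage_act_continuous.
  rewrite -[X in measurable X]setTI.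
  by apply: (@continuous_measurable_borel (stage G t.+1) _ snd) => // -[x s]; exact: cvg_snd.
by apply/seteqP; split => [z [zC zD]|z [zC zD]]; split => // i; [move=> _|]; exact: zC.
Qed.

Lemma stage_boxesI : setI_closed stage_boxes.
Proof.
move=> _ _ [C [D [mC mD ->]]] [C' [D' [mC' mD' ->]]].
exists (fun i => C i `&` C' i), (D `&` D'); split.
- by move=> i; exact: measurableI.
- exact: measurableI.
- apply/seteqP; split => z; first by move=> [[Cz Dz] [C'z D'z]]; split.
  by move=> [CC [Dz D'z]]; split; split => // i; have [] := CC i.
Qed.

Lemma stage_boxesT : stage_boxes setT.
Proof. by exists (fun=> setT), setT; split => //; apply/seteqP; split. Qed.

Lemma borel_stage_boxes : @measurable _ (borel (stage G t.+1)) = <<s stage_boxes >>.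
Proof.
pose b i := sval (cid (polish_countable_basis (X t i))).
have bb i : indexed_basis (b i) by exact: (svalP (cid (polish_countable_basis (X t i)))).
have [c bc] := polish_countable_basis (nat_space G t).
apply: (@borel_sigma (stage G t.+1) (seq ('I_n * nat) * nat)%type
  _ (indexed_basis_setX (indexed_basis_proj_sets bb) bc)); last first.
  by move=> _ [C [D [mC mD ->]]]; exact: stage_box_measurable.
move=> [s m]; apply: sub_sigma_algebra.
(* The list [s] may constrain a player several times or not at all; the intersection covers both
   cases. *)
exists (fun i => \bigcap_(k in [set k | (i, k) \in s]) b i k), (c m); split.
- move=> i; apply: bigcap_measurableType => k _; apply: open_borel.
  by case: (bb i).
- by apply: open_borel; case: bc.
- apply/seteqP; split => [z [zs zm]|z [zs zm]]; split => //.
    by move=> i k /zs.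
  by move=> [i k] ks; exact: zs.
Qed.

Lemma is_product_unique (mu : forall i, prob R (X t i)) nu p q :
  is_product mu nu p -> is_product mu nu q ->
  forall B : set (borel (stage G t.+1)), measurable B -> p B = q B.
Proof.
move=> pP qP B mB.
apply: (@measure_unique _ R (borel (stage G t.+1)) stage_boxes (fun=> setT)
  borel_stage_boxes stage_boxesI) => //.
- by move=> _; exact: stage_boxesT.
- by rewrite bigcup_const//; exists 0%N.
- by move=> _ [C [D [mC mD ->]]]; rewrite [LHS]pP// [RHS]qP.
- by move=> _; rewrite /= [X in (X < _)%E](probability_setT p) ltry.
Qed.

Lemma measurable_dfwith_stage i (b : forall i, X t i) : measurable_fun setT
  ((fun q => (@dfwith _ (X t) b i q.1, q.2)) :
    borel (X t i) * borel (nat_space G t) -> borel (stage G t.+1)).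
Proof.
apply: measurable_fun_borel_pair.
- by apply: countable_basis_prod_topology => j; exact: polish_countable_basis.
- exact: polish_countable_basis.
- have md : measurable_fun setT
      (@dfwith _ (X t) b i : borel (X t i) -> borel (prod_topology (X t))).
    by apply: continuous_measurable_borel; exact: dfwith_continuous.
  exact: (measurableT_comp md measurable_fst).
- exact: measurable_snd.
Qed.

Section dirac.
Variables (mu : forall i, prob R (X t i)) (nu : prob R (nat_space G t)).
Variables (i : 'I_n) (b : forall i, X t i).
Hypothesis mub : forall j, j != i -> is_dirac (mu j) (b j).

(** Since all players but [i] move deterministically, the product is the image of [mu i \x nu] under
    the map that fills in [b] for the others. Only a product of two measures is needed, and the
    integral formula is Tonelli's theorem. *)
Lemma is_product_dirac : exists p, is_product mu nu p /\
  forall phi : stage G t.+1 -> \bar R, (forall z, 0 <= phi z)%E ->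
    measurable_fun setT (phi : borel (stage G t.+1) -> \bar R) ->
  (\int[p]_z phi z = \int[mu i]_y \int[nu]_s phi (@dfwith _ (X t) b i y, s))%E.
Proof.
pose f (q : borel (X t i) * borel (nat_space G t)) : borel (stage G t.+1) :=
  (@dfwith _ (X t) b i q.1, q.2).
have mf : measurable_fun setT f by exact: measurable_dfwith_stage.
have [p [pE pint]] := image_prob_exists (mu i \x nu)%E mf.
exists p; split; last first.
  move=> phi phi0 mphi; rewrite pint//.
  exact: (@fubini_tonelli1 _ _ _ _ R (mu i) nu (phi \o f) (measurableT_comp mphi mf)
    (fun q => phi0 (f q))).
move=> C D mC mD; rewrite [LHS]pE.
have [Cb|/existsNP[j /not_implyP[ji nCb]]] := pselect (forall j, j != i -> C j (b j)).
  rewrite (_ : _ @^-1` _ = C i `*` D).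
    apply: (etrans (@product_measure1E _ _ _ _ R (mu i) nu _ _ (mC i) mD)).
    rewrite (bigD1 i)//= big1 ?mule1// => j ji.
    by rewrite (mub ji)// /dirac_prob/= diracE mem_set//; exact: Cb.
  apply/seteqP; split => [[y s] [/= Cy Ds]|[y s] [/= Cy Ds]]; split => //.
    by have := Cy i; rewrite dfwithin.
  move=> j; have [->|ji] := eqVneq j i; first by rewrite dfwithin.
  by rewrite dfwithout 1?eq_sym//; exact: Cb.
rewrite (_ : _ @^-1` _ = set0).
  rewrite [LHS]measure0 (bigD1 j)//= (mub ji)// /dirac_prob/= diracE memNset//.
  by rewrite !mul0e.
rewrite -subset0 => -[y s] [/= /(_ j)].
by rewrite dfwithout// eq_sym.
Qed.

Lemma integral_is_product p (phi : stage G t.+1 -> \bar R) : is_product mu nu p ->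
  (forall z, 0 <= phi z)%E ->
  measurable_fun setT (phi : borel (stage G t.+1) -> \bar R) ->
  (\int[p]_z phi z = \int[mu i]_y \int[nu]_s phi (@dfwith _ (X t) b i y, s))%E.
Proof.
move=> pP phi0 mphi; have [q [qP <-//]] := is_product_dirac.
by apply: eq_integral_prob => B mB; exact: (is_product_unique pP qP).
Qed.

End dirac.
End product.

(* Nature may move randomly at the same time as player [i]. *)
Definition one_mover n (R : realType) (G : game n R) := forall t h,
  hist_set (action G) t h -> exists (i : 'I_n) (b : forall i, act_space G t i),
  forall j, j != i -> action G t j h = [set b j].

Section outcomes.
Variables (n : nat) (R : realType) (G : game n R).
Hypothesis moverG : one_mover G.
Local Notation X := (act_space G).
Local Notation H := (hist_set (action G)).
Local Notation Hinf := (play_set (action G)).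

(* Constant outside [H t], so that [move] is a kernel on all histories. *)
Definition move (p : forall i, strategy G i) t (h : hist G t) : prob R (stage G t.+1) :=
  xget (dirac_prob R point)
    [set q | H t h /\ is_product (fun i => p i t h) (nature G t h) q].

Section profile.
Variable p : forall i, strategy G i.
Arguments p : clear implicits.
Hypothesis mp : mixed_profile p.
Arguments mp : clear implicits.

Lemma strategy_support i t h : H t h -> prob_support (p i t h) `<=` action G t i h.
Proof. by move=> Hh; have [_] := mp i t; exact. Qed.

Lemma strategy_dirac i t h x : H t h -> action G t i h = [set x] ->
  is_dirac (p i t h) x.
Proof. by move=> Hh Ax; apply: is_dirac_support; rewrite -Ax; exact: strategy_support. Qed.

Lemma move_product t h : H t h ->
  is_product (fun i => p i t h) (nature G t h) (move p h).
Proof.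
move=> Hh; have [i [b Ab]] := moverG Hh.
have [j ji|q [qP _]] := @is_product_dirac n R G t (fun i => p i t h) (nature G t h) i b.
  by apply: strategy_dirac => //; exact: Ab.
by have := @xgetPex _ (dirac_prob R point) [set q | H t h /\
  is_product (fun i => p i t h) (nature G t h) q] (ex_intro _ q (conj Hh qP)); case.
Qed.

Lemma measurable_strategy i t (B : set (borel (X t i))) : measurable B ->
  measurable_fun (H t : set (borel (hist G t))) (fun h => p i t h B).
Proof.
move=> mB; have [mpi _] := mp i t.
exact: (measurableT_comp (@measurable_prob_ev R _ B mB) mpi).
Qed.

Lemma measurable_nature t (B : set (borel (nat_space G t))) : measurable B ->
  measurable_fun (H t : set (borel (hist G t))) (fun h => nature G t h B).
Proof.
move=> mB; apply: (measurableT_comp (@measurable_prob_ev R _ B mB)).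
by apply: within_continuous_measurable_borel; exact: nature_continuous.
Qed.

(** On [H t] the probability of a box is a finite product of measurable functions, and boxes
    generate; off [H t] the kernel is constant. *)
Lemma measurable_move t (B : set (borel (stage G t.+1))) : measurable B ->
  measurable_fun setT ((fun h => move p h B) : borel (hist G t) -> \bar R).
Proof.
move=> mB; have mH := @measurable_hist_set _ _ G t.
rewrite -(setUv (H t : set (borel (hist G t)))); apply/measurable_funU => //.
  exact: measurableC.
split.
  apply: (@measurable_prob_dynkin R (stage G t.+1) _ (borel (hist G t)) (H t)
    (@move p t) _ mH (@borel_stage_boxes _ _ G t) (@stage_boxesI _ _ G t)) mB.
  move=> _ [C [D [mC mD ->]]].
  apply: (@eq_measurable_fun _ _ (borel (hist G t)) (\bar R) (H t)
    (fun h => (\big[mule/1]_(i < n) p i t h (C i)) * nature G t h D)%E).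
    by move=> h /set_mem Hh; rewrite (move_product Hh).
  apply: emeasurable_funM; last exact: measurable_nature.
  elim: (index_enum _) => [|i s ih].
    rewrite (_ : (fun h => _) = cst 1%E); first exact: measurable_cst.
    by apply/funext => h; rewrite big_nil.
  rewrite (_ : (fun h => _) =
      (fun h => p i t h (C i) * \big[mule/1]_(i <- s) p i t h (C i))%E).
    by apply: emeasurable_funM => //; exact: measurable_strategy.
  by apply/funext => h; rewrite big_cons.
apply: (@eq_measurable_fun _ _ (borel (hist G t)) (\bar R) _ (cst (dirac_prob R point B))).
  move=> h /set_mem nHh; rewrite /move xgetPN// => q [Hh _].
  exact: nHh.
exact: measurable_cst.
Qed.

Definition allowed t (h : hist G t) : set (stage G t.+1) :=
  [set z | forall i, action G t i h (z.1 i)].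

Lemma allowed_box t (h : hist G t) :
  allowed h = stage_box (fun i => action G t i h) setT.
Proof. by apply/seteqP; split => [z hz|z []]. Qed.

Lemma measurable_allowed t h : H t h ->
  measurable (@allowed t h : set (borel (stage G t.+1))).
Proof.
move=> Hh; rewrite allowed_box; apply: stage_box_measurable => // i.
by apply: closed_borel; exact: action_closed.
Qed.

Lemma move_allowed t h : H t h -> move p h (@allowed t h) = 1%E.
Proof.
move=> Hh; have mA i : measurable (action G t i h : set (borel (X t i))).
  by apply: closed_borel; exact: action_closed.
rewrite allowed_box [LHS](move_product Hh)// [X in (_ * X)%E]probability_setT mule1.
apply: big1 => i _; apply: prob_support_full => //.
exact: strategy_support.
Qed.

(* The value at [0] is irrelevant: trajectories start at stages [t.+1]. *)
Definition transition m : play G -> prob R (stage G m) :=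
  match m return play G -> prob R (stage G m) with
  | 0 => fun=> dirac_prob R point
  | t.+1 => fun w => move p (trunc t w)
  end.

Lemma measurable_transition m (B : set (borel (stage G m))) : measurable B ->
  measurable_fun setT ((fun w => transition m w B) : borel (play G) -> \bar R).
Proof.
case: m B => [|t] B mB /=; first exact: measurable_cst.
exact: (measurableT_comp (@measurable_move t B mB) (@measurable_trunc _ _ G t)).
Qed.

Lemma transition_past m (w w' : play G) : agree m w w' -> transition m w = transition m w'.
Proof. by case: m => [|t] //= /agree_trunc ->. Qed.

(** A history of [hist G t] fixes the coordinates [0] to [t], so the first random one is [t.+1]. *)
Definition outcome_prob t (h : hist G t) : prob R (play G) :=
  trajectory (@stage_basis _ _ G) measurable_transition transition_past t.+1 (extend h).

Lemma measurable_outcome_prob t (B : set (borel (play G))) : measurable B ->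
  measurable_fun setT ((fun h => outcome_prob h B) : borel (hist G t) -> \bar R).
Proof.
move=> mB; exact: (measurableT_comp
  (@measurable_trajectory _ _ (@stage_basis _ _ G) _ measurable_transition transition_past t.+1 B mB)
  (@measurable_extend _ _ G t)).
Qed.

Lemma outcome_prob_step t h (B : set (borel (play G))) : measurable B ->
  (outcome_prob h B = \int[move p h]_z @outcome_prob t.+1 (h, z) B)%E.
Proof.
by move=> mB; rewrite /outcome_prob trajectory_step//= extendK.
Qed.

Lemma integral_outcome_prob_step t h (f : play G -> \bar R) : nonneg_measurable f ->
  (\int[outcome_prob h]_w f w =
   \int[move p h]_z \int[@outcome_prob t.+1 (h, z)]_w f w)%E.
Proof. by move=> nf; rewrite /outcome_prob integral_trajectory_step//= extendK. Qed.

Lemma outcome_prob_past t h k (A : set (borel (hist G k))) : measurable A ->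
  (k <= t)%N -> @outcome_prob t h (trunc k @^-1` A) = (\1_A (trunc k (extend h)))%:E.
Proof.
move=> mA kt; rewrite /outcome_prob (@trajectory_past _ _ _ _ _ _ t.+1 k.+1)//.
  by rewrite -[X in measurable X]setTI; exact: measurable_trunc.
by move=> v v' /agree_trunc vv'; rewrite /preimage /= vv'.
Qed.

Lemma integral_outcome_prob_past t (h : hist G t) (f : play G -> \bar R) :
  nonneg_measurable f -> depends_before t.+1 f ->
  (\int[outcome_prob h]_w f w = f (extend h))%E.
Proof.
move=> [f0 mf] df; pose F := [set w | f w = f (extend h)].
have mF : measurable (F : set (borel (play G))).
  rewrite -[X in measurable X]setTI; apply: (mf measurableT [set f (extend h)]).
  exact: emeasurable_set1.
have F1 : outcome_prob h F = 1%E.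
  rewrite /outcome_prob (@trajectory_past _ _ _ _ _ _ t.+1 t.+1)//.
    by rewrite indicE mem_set.
  by move=> v v' vv'; rewrite /F /= (df _ _ vv').
rewrite -[RHS](integral_prob_cst (outcome_prob h)).
by apply: (@eq_integral_full _ (borel (play G)) R _ F).
Qed.

Lemma measurable_pair_hist t (h : hist G t) : measurable_fun setT
  ((fun z => (h, z)) : borel (stage G t.+1) -> borel (hist G t.+1)).
Proof.
apply: (@continuous_measurable_borel (stage G t.+1) (hist G t.+1)) => z.
exact: (@cvg_pair _ _ _ (nbhs z) (nbhs h) (nbhs z) _ _ _ (cst h) id (cvg_cst h) cvg_id).
Qed.

Lemma measurable_integral_outcome t (f : play G -> \bar R) : nonneg_measurable f ->
  measurable_fun setT
    ((fun h => \int[outcome_prob h]_w f w)%E : borel (hist G t) -> \bar R).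
Proof.
move=> [f0 mf]; apply: measurable_fun_integral_kernel => //.
exact: measurable_outcome_prob.
Qed.

(** The comparison at stage [k] is carried back one move at a time; moves are allowed with
    probability one, so only histories in [H] matter. With a function settled by stage [k] on one
    side this plays the part of the tower property. *)
Lemma integral_outcome_le k (f g : play G -> \bar R) :
  nonneg_measurable f -> nonneg_measurable g ->
  (forall h : hist G k, H k h ->
    \int[outcome_prob h]_w f w <= \int[outcome_prob h]_w g w)%E ->
  forall t (h : hist G t), (t <= k)%N -> H t h ->
  (\int[outcome_prob h]_w f w <= \int[outcome_prob h]_w g w)%E.
Proof.
move=> nf ng fg t h tk; have [d kE] : exists d, k = (t + d)%N.
  by exists (k - t)%N; rewrite subnKC.
elim: d t h kE {tk} => [|d ih] t h kE Hh.
  by rewrite addn0 in kE; subst k; exact: fg.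
rewrite !integral_outcome_prob_step//.
have mstep (f' : play G -> \bar R) : nonneg_measurable f' -> measurable_fun setT
    ((fun z => \int[@outcome_prob t.+1 (h, z)]_w f' w)%E :
      borel (stage G t.+1) -> \bar R).
  move=> nf'; exact: (measurableT_comp (@measurable_integral_outcome t.+1 f' nf')
    (@measurable_pair_hist t h)).
apply: (@ge0_le_integral_full _ (borel (stage G t.+1)) R _ (@allowed t h)).
- exact: measurable_allowed.
- exact: move_allowed.
- by move=> z; apply: integral_ge0 => w _; case: nf.
- exact: mstep.
- by move=> z; apply: integral_ge0 => w _; case: ng.
- exact: mstep.
- by move=> z hz; apply: ih; [rewrite kE addnS addSn|split].
Qed.

Lemma integral_outcome_eq k (f g : play G -> \bar R) :
  nonneg_measurable f -> nonneg_measurable g ->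
  (forall h : hist G k, H k h ->
    \int[outcome_prob h]_w f w = \int[outcome_prob h]_w g w)%E ->
  forall t (h : hist G t), (t <= k)%N -> H t h ->
  (\int[outcome_prob h]_w f w = \int[outcome_prob h]_w g w)%E.
Proof.
move=> nf ng fg t h tk Hh; apply/eqP; rewrite eq_le; apply/andP; split.
  by apply: (integral_outcome_le nf ng _ tk Hh) => h' /fg ->.
by apply: (integral_outcome_le ng nf _ tk Hh) => h' /fg ->.
Qed.

Lemma nonneg_measurable_trunc k (f : hist G k -> \bar R) :
  (forall h, 0 <= f h)%E -> measurable_fun setT (f : borel (hist G k) -> \bar R) ->
  nonneg_measurable (fun w => f (trunc k w)).
Proof.
move=> f0 mf; split => [w|]; first exact: f0.
exact: (measurableT_comp mf (@measurable_trunc _ _ G k)).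
Qed.

Lemma nonneg_measurable_indic (B : set (play G)) :
  measurable (B : set (borel (play G))) -> @nonneg_measurable R _ (fun w => (\1_B w)%:E).
Proof.
move=> mB; split => [w|]; first by rewrite lee_fin.
by apply/measurable_EFinP; exact: measurable_indic.
Qed.

Lemma measurable_trunc_preimage k (A : set (borel (hist G k))) : measurable A ->
  measurable (trunc k @^-1` A : set (borel (play G))).
Proof. by move=> mA; rewrite -[X in measurable X]setTI; exact: measurable_trunc. Qed.

Lemma integral_outcome_indic t (h : hist G t) (B : set (borel (play G))) :
  measurable B -> (\int[outcome_prob h]_w (\1_B w)%:E)%E = outcome_prob h B.
Proof. by move=> mB; rewrite integral_indic// setIT. Qed.

Lemma outcome_prob_hist t (h : hist G t) k : (t <= k)%N -> H t h ->
  outcome_prob h (trunc k @^-1` H k) = 1%E.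
Proof.
move=> tk Hh; have mE := measurable_trunc_preimage (@measurable_hist_set _ _ G k).
rewrite -integral_outcome_indic//.
rewrite (@integral_outcome_eq k _ (cst 1%E) _ _ _ t h tk Hh).
- exact: integral_prob_cst.
- exact: nonneg_measurable_indic.
- by split => [w|]; [exact: lee01|exact: measurable_cst].
- move=> h' Hh'; rewrite integral_outcome_indic// integral_prob_cst.
  rewrite (outcome_prob_past _ (@measurable_hist_set _ _ G k))// extendK.
  by rewrite indicE mem_set.
Qed.

Lemma outcome_prob_play t (h : hist G t) : H t h -> outcome_prob h Hinf = 1%E.
Proof.
move=> Hh; rewrite (_ : Hinf = \bigcap_k (trunc k @^-1` H k)); last first.
  by apply/seteqP; split => [w Hw k _|w Hw k]; exact: Hw.
apply: probability_bigcap1 => k.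
  exact: (measurable_trunc_preimage (@measurable_hist_set _ _ G k)).
have [tk|/ltnW kt] := leqP t k; first exact: outcome_prob_hist.
apply: (probability_full_subset _ _ _ (outcome_prob_hist (leqnn t) Hh)).
- exact: (measurable_trunc_preimage (@measurable_hist_set _ _ G t)).
- exact: (measurable_trunc_preimage (@measurable_hist_set _ _ G k)).
- by move=> w; exact: hist_set_trunc.
Qed.

(** The integrand of [is_diamond], with the domain of integration absorbed into an indicator. *)
Definition restricted_move k (A : set (hist G k)) (B : set (stage G k.+1)) (h : hist G k) :=
  (move p h B * (\1_(H k `&` A) h)%:E)%E.

Lemma restricted_move_ge0 k A B h : (0 <= @restricted_move k A B h)%E.
Proof. by apply: mule_ge0 => //; rewrite lee_fin. Qed.

Lemma measurable_restricted_move k (A : set (borel (hist G k)))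
    (B : set (borel (stage G k.+1))) : measurable A -> measurable B ->
  measurable_fun setT (restricted_move A B : borel (hist G k) -> \bar R).
Proof.
move=> mA mB; apply: emeasurable_funM; first exact: measurable_move.
apply/measurable_EFinP; apply: measurable_indic.
by apply: measurableI => //; exact: measurable_hist_set.
Qed.

Lemma measurable_rectangle k (A : set (borel (hist G k)))
    (B : set (borel (stage G k.+1))) : measurable A -> measurable B ->
  measurable (A `*` B : set (borel (hist G k.+1))).
Proof.
move=> mA mB; rewrite (_ : A `*` B = (fst @^-1` A) `&` (snd @^-1` B))//.
apply: measurableI; rewrite -[X in measurable X]setTI.
  exact: (@measurable_fst_borel _ _ G k).
exact: (@measurable_snd_borel _ _ G k).
Qed.

(** It suffices to compare the two integrals when play starts at stage [k] itself, where one
    unfolding of the outcome gives both. *)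
Lemma outcome_prob_diamond t (h : hist G t) k (A : set (borel (hist G k)))
    (B : set (borel (stage G k.+1))) :
  (t <= k)%N -> H t h -> measurable A -> measurable B ->
  outcome_prob h (trunc k.+1 @^-1` (A `*` B)) =
  (\int[outcome_prob h]_w restricted_move A B (trunc k w))%E.
Proof.
move=> tk Hh mA mB; have mE := measurable_trunc_preimage (measurable_rectangle mA mB).
rewrite -integral_outcome_indic//.
have nm := nonneg_measurable_trunc (@restricted_move_ge0 k A B)
  (measurable_restricted_move mA mB).
apply: (integral_outcome_eq _ _ _ tk Hh) => //; first exact: nonneg_measurable_indic.
move=> {t h tk Hh} h Hh; rewrite integral_outcome_indic//.
rewrite integral_outcome_prob_past//; last first.
  by move=> w w' /agree_trunc ->.
rewrite extendK outcome_prob_step//.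
under eq_integral => z _.
  rewrite (outcome_prob_past (k := k.+1) _ (measurable_rectangle mA mB))// extendK.
  over.
rewrite /restricted_move indicE; have [hA|hA] := boolP (h \in H k `&` A).
  rewrite mule1 -[X in _ = move p h X]setIT -integral_indic//.
  apply: eq_integral => z _; rewrite !indicE (_ : ((h, z) \in _) = (z \in B))//.
  move: hA; rewrite inE => -[_ Ah]; apply/idP/idP; rewrite !inE; first by case.
  by move=> Bz; split.
rewrite mule0 integral0_eq// => z _; rewrite indicE memNset// => -[/= Ah _].
by move/negP: hA; apply; rewrite inE.
Qed.

End profile.
End outcomes.

(** * Existence and uniqueness of the outcome measure *)

Section outcome_law.
Variables (n : nat) (R : realType) (G : game n R).
Hypothesis moverG : one_mover G.
Local Notation X := (act_space G).
Local Notation H := (hist_set (action G)).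
Local Notation Hinf := (play_set (action G)).
Variable p : forall i, strategy G i.
Arguments p : clear implicits.
Hypothesis mp : mixed_profile p.
Local Notation P := (outcome_prob moverG mp).

Definition rectangles k : set (set (hist G k.+1)) := [set C |
  exists (A : set (borel (hist G k))) (B : set (borel (stage G k.+1))),
  [/\ measurable A, measurable B & C = A `*` B]].

Lemma rectanglesI k : setI_closed (@rectangles k).
Proof.
move=> _ _ [A [B [mA mB ->]]] [A' [B' [mA' mB' ->]]].
exists (A `&` A'), (B `&` B'); split; try exact: measurableI.
by rewrite setXI.
Qed.

Lemma rectanglesT k : @rectangles k setT.
Proof. by exists setT, setT; split => //; rewrite setXTT. Qed.

Lemma borel_rectangles k :
  @measurable _ (borel (hist G k.+1)) = <<s @rectangles k >>.
Proof.
have [b bb] := @hist_basis _ _ G k; have [c bc] := @stage_basis _ _ G k.+1.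
apply: (@borel_sigma (hist G k.+1) (nat * nat)%type _ (indexed_basis_setX bb bc)).
  move=> q; apply: sub_sigma_algebra; exists (b q.1), (c q.2); split => //.
    by apply: open_borel; case: bb.
  by apply: open_borel; case: bc.
by move=> _ [A [B [mA mB ->]]]; exact: measurable_rectangle.
Qed.

Lemma hist_law t (h : hist G t) k : exists q : prob R (hist G k),
  (forall A, q A = P h (trunc k @^-1` A)) /\
  forall phi : hist G k -> \bar R, (forall y, 0 <= phi y)%E ->
    measurable_fun setT (phi : borel (hist G k) -> \bar R) ->
    (\int[q]_y phi y = \int[P h]_w phi (trunc k w))%E.
Proof. exact: (image_prob_exists (P h) (@measurable_trunc _ _ G k)). Qed.

Lemma integral_restricted_move k (q : prob R (hist G k)) A B :
  (\int[q]_(h in H k `&` A) move p h B = \int[q]_h restricted_move p A B h)%E.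
Proof. by rewrite integral_mkcond epatch_indic. Qed.

Lemma outcome_exists t (h : hist G t) : H t h -> outcome p h (P h).
Proof.
move=> Hh; pose q k := sval (cid (hist_law h k)).
have [qE qint] : (forall k A, q k A = P h (trunc k @^-1` A)) /\
  forall k (phi : hist G k -> \bar R), (forall y, 0 <= phi y)%E ->
    measurable_fun setT (phi : borel (hist G k) -> \bar R) ->
    (\int[q k]_y phi y = \int[P h]_w phi (trunc k w))%E.
  by split => k; case: (svalP (cid (hist_law h k))).
exists q, (fun k h' => move p h'); split => //.
- by move=> B mB; rewrite qE (outcome_prob_past moverG mp h mB)// extendK.
- by move=> k h' _; exact: move_product.
- move=> k tk A B mA mB; rewrite qE integral_restricted_move qint.
  + exact: outcome_prob_diamond.
  + by move=> h'; exact: restricted_move_ge0.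
  + exact: measurable_restricted_move.
Qed.

(** Induction on the stage determines the marginals, because rectangles generate the Borel sets of
    histories; the marginals determine the measure, because cylinders generate those of plays. *)
Lemma outcome_unique t (h : hist G t) tau : H t h -> outcome p h tau ->
  forall B : set (borel (play G)), measurable B -> tau B = P h B.
Proof.
move=> Hh [lambda [nu [lt nuP dia tauE]]].
have lambdaE k : (t <= k)%N -> forall A : set (borel (hist G k)), measurable A ->
    lambda k A = P h (trunc k @^-1` A).
  move=> tk; rewrite -(subnKC tk); elim: (k - t)%N => [|d ih] {tk k}.
    rewrite addn0 => A mA; rewrite [LHS](lt A mA).
    by rewrite (outcome_prob_past moverG mp h mA)// extendK.
  rewrite addnS; set k := (t + d)%N in ih *; have tk : (t <= k)%N by exact: leq_addr.
  have [q [qE qint]] := hist_law h k; have [q' [q'E _]] := hist_law h k.+1.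
  move=> A mA; rewrite -q'E.
  apply: (@measure_unique _ R (borel (hist G k.+1)) (@rectangles k) (fun=> setT)
    (borel_rectangles k) (@rectanglesI k)) => //.
  - by move=> _; exact: rectanglesT.
  - by rewrite bigcup_const//; exists 0%N.
  - move=> _ [C [D [mC mD ->]]]; rewrite [LHS](dia k tk C D mC mD).
    rewrite [RHS]q'E (outcome_prob_diamond moverG mp tk Hh mC mD).
    rewrite -(qint (restricted_move p C D)); last 2 first.
    + by move=> h'; exact: restricted_move_ge0.
    + exact: measurable_restricted_move.
    rewrite -integral_restricted_move.
    (* [nu] is constrained only at histories of the game, which is where the integral is taken. *)
    transitivity (\int[lambda k]_(h' in H k `&` C) move p h' D)%E.
      apply: eq_integral => h' /set_mem[Hh' _].
      exact: (is_product_unique (nuP k h' tk Hh') (move_product moverG mp Hh')).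
    apply: eq_measure_integral => E mE _; rewrite [RHS]qE.
    exact: ih.
  - by move=> _; rewrite /= [X in (X < _)%E](probability_setT (lambda k.+1)) ltry.
move=> B mB.
apply: (@measure_unique _ R (borel (play G)) (@cylinder (stage G)) (fun=> setT)
    (borel_cylinder (@stage_basis _ _ G)) (@cylinderI (stage G))) => //.
- by move=> _; exact: cylinderT.
- by rewrite bigcup_const//; exists 0%N.
- move=> C [mC [m dC]]; pose k := maxn t m.
  (* As [C] is determined by the coordinates below [m], it can be read off the truncation at [k]. *)
  have CE : C = trunc k @^-1` (@extend _ _ G k @^-1` C).
    have ag w : agree m w (extend (trunc k w)).
      apply: (@agree_le _ _ k.+1); first by rewrite /k; lia.
      by apply/agree_trunc; rewrite extendK.
    apply/seteqP; split => w /=; first by apply: dC; exact: ag.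
    by apply: dC; apply: agree_sym; exact: ag.
  have mC' : measurable (@extend _ _ G k @^-1` C : set (borel (hist G k))).
    by rewrite -[X in measurable X]setTI; exact: measurable_extend.
  have tk : (t <= k)%N by exact: leq_maxl.
  by rewrite [in LHS]CE [in RHS]CE [LHS](tauE k _ tk mC') [LHS](lambdaE k tk).
- by move=> _; rewrite /= [X in (X < _)%E](probability_setT tau) ltry.
Qed.

(** The set to which [get] is applied has exactly one element, by existence and uniqueness of the
    outcome. *)
Lemma payoff_integral t (h : hist G t) i : H t h ->
  payoff p h i = \int[P h]_(w in Hinf) utility G i w.
Proof.
move=> Hh; rewrite /payoff; apply: get_unique.
  by exists (P h) => //; exact: outcome_exists.
move=> v [tau /(outcome_unique Hh) tauE ->].
rewrite /Rintegral; congr fine.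
by apply: eq_measure_integral => B mB _; exact: tauE.
Qed.

End outcome_law.

(** * Values of subgames *)

Section shifted_utility.
Variables (n : nat) (R : realType) (G : game n R).
Local Notation X := (act_space G).
Local Notation H := (hist_set (action G)).
Local Notation Hinf := (play_set (action G)).

(** This allows a strategy to be changed at a single history without losing measurability, and the
    outcome measure to be located on the plays through one history. *)
Lemma measurable_hist1 t (h : hist G t) : measurable ([set h] : set (borel (hist G t))).
Proof.
elim: t h => [[a s]|t ih [h [x s]]].
  rewrite (_ : [set _] = [set a] `*` [set s]).
    rewrite (_ : _ `*` _ = (fst @^-1` [set a]) `&` (snd @^-1` [set s]))//.
    apply: measurableI; apply: closed_borel.
      apply: closed_comp => [z _|]; first by case: z => z1 z2; exact: cvg_fst.
      apply: accessible_closed_set1; apply: hausdorff_accessible.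
      exact: (@metric_hausdorff R (start_act G)).
    apply: closed_comp => [z _|]; first by case: z => z1 z2; exact: cvg_snd.
    exact: (@closed_point R (start_nat G)).
  by apply/seteqP; split => [_ ->//|[a' s'] [/= -> ->]].
rewrite (_ : [set _] = [set h] `*` stage_box (fun i => [set x i]) [set s]).
  apply: measurable_rectangle; first exact: ih.
  apply: stage_box_measurable => [i|]; apply: closed_borel.
    exact: (@closed_point R (X t i)).
  exact: (@closed_point R (nat_space G t)).
apply/seteqP; split => [_ ->//|[h' [x' s']] [/= -> [/= xx' ->]]].
by congr (_, (_, _)); apply: functional_extensionality_dep => i; exact: xx'.
Qed.

Definition bound i : R := sval (cid (@utility_bounded n R G i)).

Lemma boundP i w : Hinf w -> `|utility G i w| <= bound i.
Proof. exact: (svalP (cid (@utility_bounded n R G i))). Qed.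

Definition shifted i (w : play G) : R := if `[< Hinf w >] then utility G i w + bound i else 0.

Lemma shiftedE i w : Hinf w -> shifted i w = utility G i w + bound i.
Proof. by move=> Hw; rewrite /shifted asboolT. Qed.

Lemma shifted_ge0 i w : 0 <= shifted i w.
Proof.
rewrite /shifted; case: asboolP => // Hw.
by have := boundP i Hw; rewrite ler_norml => /andP[? _]; lra.
Qed.

Lemma measurable_shifted i : measurable_fun setT (shifted i : borel (play G) -> R).
Proof.
have mH := @measurable_play_set _ _ G.
rewrite -(setUv (Hinf : set (borel (play G)))); apply/measurable_funU => //.
  exact: measurableC.
split.
  apply: (@eq_measurable_fun _ _ (borel (play G)) R Hinf
      (fun w => utility G i w + bound i)).
    by move=> w /set_mem Hw; rewrite shiftedE.
  apply: measurable_funD; last exact: measurable_cst.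
  by apply: within_continuous_measurable; exact: utility_continuous.
apply: (@eq_measurable_fun _ _ (borel (play G)) R _ (cst 0)).
  by move=> w /set_mem nHw; rewrite /shifted asboolF.
exact: measurable_cst.
Qed.

Lemma nonneg_measurable_shifted i : nonneg_measurable (fun w => (shifted i w)%:E).
Proof.
split => [w|]; first by rewrite lee_fin shifted_ge0.
by apply/measurable_EFinP; exact: measurable_shifted.
Qed.

Local Notation osc := (oscillation (action G) (utility G)).

Lemma oscillation_bound i T w w' : Hinf w -> Hinf w' -> trunc T w = trunc T w' ->
  `|utility G i w - utility G i w'| <= osc T.
Proof.
move=> Hw Hw' ww'; apply: sup_upper_bound; last by exists i, w, w'.
split; first by exists `|utility G i w - utility G i w'|, i, w, w'.
(* The supremum runs over all players, so the bound has to serve all of them at once. *)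
exists (\sum_(j < n) (bound j + bound j)) => _ [j [v [v' [Hv Hv' _ ->]]]].
have bj k : 0 <= bound k by exact: le_trans (boundP k Hv).
rewrite (bigD1 j)//= ler_wpDr ?sumr_ge0// => [k _|]; first exact: addr_ge0.
by rewrite (le_trans (ler_normB _ _))// lerD//; exact: boundP.
Qed.

Lemma oscillation_ge0 T : 0 <= osc T.
Proof.
rewrite /oscillation; set A := [set r | _].
have [->|/set0P[r Ar]] := eqVneq A set0; first by rewrite sup0.
have [i [w [w' [Hw Hw' ww' rE]]]] := Ar.
exact: le_trans (oscillation_bound i Hw Hw' ww').
Qed.

Lemma shifted_osc i T w w' : Hinf w -> Hinf w' -> trunc T w = trunc T w' ->
  shifted i w <= shifted i w' + osc T.
Proof.
move=> Hw Hw' ww'; rewrite !shiftedE//.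
by have := oscillation_bound i Hw Hw' ww'; rewrite ler_norml => /andP[_ ?]; lra.
Qed.

(* The payoff is shifted by a bound of the utility, which makes it an integral of
   a nonnegative function. *)
Definition value (p : forall i, strategy G i) i t (h : hist G t) : R :=
  if `[< H t h >] then payoff p h i + bound i else 0.

Section profile.
Hypothesis moverG : one_mover G.
Variable p : forall i, strategy G i.
Arguments p : clear implicits.
Hypothesis mp : mixed_profile p.
Local Notation P := (outcome_prob moverG mp).

Lemma value_payoff i t (h : hist G t) : H t h -> value p i h = payoff p h i + bound i.
Proof. by move=> Hh; rewrite /value asboolT. Qed.

Lemma value_integral i t (h : hist G t) : H t h ->
  (value p i h)%:E = (\int[P h]_w (shifted i w)%:E)%E.
Proof.
move=> Hh; have mH := @measurable_play_set _ _ G.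
have H1 := outcome_prob_play moverG mp Hh.
have [s0 ms] := nonneg_measurable_shifted i.
rewrite value_payoff// (payoff_integral moverG mp)// (ge0_integral_full mH H1)//.
have mu : measurable_fun (Hinf : set (borel (play G))) (utility G i : borel (play G) -> R).
  by apply: within_continuous_measurable; exact: utility_continuous.
have iu : (P h).-integrable (Hinf : set (borel (play G))) (EFin \o utility G i).
  apply: measurable_bounded_integrable => //.
    by rewrite (le_lt_trans (probability_le1 _ _))// ltry.
  exists (bound i); split; first exact: num_real.
  by move=> M bM w Hw /=; rewrite (le_trans (boundP i Hw))// ltW.
have ib : (P h).-integrable (Hinf : set (borel (play G))) (EFin \o cst (bound i)).
  by apply: finite_measure_integrable_cst.
transitivity (\int[P h]_(w in Hinf) (utility G i w + bound i)%:E)%E; last first.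
  by apply: eq_integral => w /set_mem Hw; rewrite shiftedE.
under [RHS]eq_integral do rewrite EFinD.
rewrite (integralD mH iu ib) EFinD; congr (_ + _)%E.
  rewrite /Rintegral fineK//; exact: integrable_fin_num.
have := @integral_cst _ (borel (play G)) R (P h) Hinf mH (bound i)%:E.
by rewrite [X in (_ * X)%E]H1 mule1.
Qed.

Lemma value_ge0 i t (h : hist G t) : 0 <= value p i h.
Proof.
have [Hh|nHh] := pselect (H t h); last by rewrite /value asboolF.
by rewrite -lee_fin value_integral//; apply: integral_ge0 => w _; rewrite lee_fin shifted_ge0.
Qed.

Lemma value_le i t (h : hist G t) : value p i h <= `|bound i| + `|bound i|.
Proof.
have [Hh|nHh] := pselect (H t h); last by rewrite /value asboolF// addr_ge0.
have [s0 ms] := nonneg_measurable_shifted i.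
rewrite -lee_fin value_integral// -[leRHS](integral_prob_cst (P h)).
apply: ge0_le_integral => // w _; rewrite lee_fin /shifted.
case: asboolP => [Hw|_]; last by rewrite addr_ge0.
rewrite lerD// ?ler_norm// (le_trans (ler_norm _))// (le_trans (boundP i Hw))//.
exact: ler_norm.
Qed.

Lemma measurable_value i t :
  measurable_fun setT (@value p i t : borel (hist G t) -> R).
Proof.
have mH := @measurable_hist_set _ _ G t.
rewrite -(setUv (H t : set (borel (hist G t)))); apply/measurable_funU => //.
  exact: measurableC.
split.
  apply/measurable_EFinP.
  apply: (@eq_measurable_fun _ _ (borel (hist G t)) (\bar R) (H t)
      (fun h => \int[P h]_w (shifted i w)%:E)%E).
    by move=> h /set_mem Hh; rewrite /= value_integral.
  apply: measurable_funTS; apply: measurable_integral_outcome.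
  exact: nonneg_measurable_shifted.
apply: (@eq_measurable_fun _ _ (borel (hist G t)) R _ (cst 0)).
  by move=> h /set_mem nHh; rewrite /value asboolF.
exact: measurable_cst.
Qed.

Lemma measurable_value_stage i t (h : hist G t) : measurable_fun setT
  ((fun z => (@value p i t.+1 (h, z))%:E) : borel (stage G t.+1) -> \bar R).
Proof.
apply/measurable_EFinP.
exact: (measurableT_comp (@measurable_value i t.+1) (@measurable_pair_hist _ _ G t h)).
Qed.

Lemma value_step i t (h : hist G t) : H t h ->
  (value p i h)%:E = (\int[move p h]_z (@value p i t.+1 (h, z))%:E)%E.
Proof.
move=> Hh; have nf := nonneg_measurable_shifted i.
rewrite value_integral// integral_outcome_prob_step//.
apply: (@eq_integral_full _ (borel (stage G t.+1)) R _ (@allowed _ _ G t h)).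
- exact: measurable_allowed.
- exact: move_allowed.
- by move=> z; apply: integral_ge0 => w _; rewrite lee_fin shifted_ge0.
- exact: (measurableT_comp (@measurable_integral_outcome _ _ _ moverG _ mp t.+1 _ nf)
    (@measurable_pair_hist _ _ G t h)).
- by move=> z; rewrite lee_fin value_ge0.
- exact: measurable_value_stage.
- by move=> z hz; rewrite value_integral.
Qed.

(** The outcome measure lives on the plays through [trunc k w], and the utilities of any two of
    these differ by at most [osc k]. *)
Lemma value_osc i k w : Hinf w ->
  `|value p i (trunc k w) - shifted i w| <= osc k.
Proof.
move=> Hw; have Hh : H k (trunc k w) by exact: Hw.
have [s0 ms] := nonneg_measurable_shifted i.
pose F := Hinf `&` (trunc k @^-1` [set trunc k w]) : set (borel (play G)).
have mE := measurable_trunc_preimage (measurable_hist1 (trunc k w)).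
have mH := @measurable_play_set _ _ G.
have mF : measurable F by exact: measurableI.
have F1 : P (trunc k w) F = 1%E.
  rewrite /F -bigcap2E; apply: probability_bigcap1 => -[|[|j]] //=.
  - exact: outcome_prob_play.
  - rewrite (outcome_prob_past moverG mp _ (measurable_hist1 (trunc k w)))//.
    by rewrite extendK indicE mem_set.
  - exact: probability_setT.
have cst_nm (c : R) : 0 <= c -> nonneg_measurable (cst c%:E : play G -> \bar R).
  by move=> c0; split => [v|]; [rewrite lee_fin|exact: measurable_cst].
have low : shifted i w <= value p i (trunc k w) + osc k.
  rewrite -lee_fin EFinD value_integral//.
  rewrite -[leLHS](integral_prob_cst (P (trunc k w))).
  rewrite -[X in (_ <= _ + X)%E](integral_prob_cst (P (trunc k w))).
  rewrite -ge0_integralD//;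
    try by move=> v _; rewrite lee_fin ?shifted_ge0 ?oscillation_ge0.
  apply: (@ge0_le_integral_full _ (borel (play G)) R _ F) => //.
  - by move=> v; rewrite adde_ge0// lee_fin oscillation_ge0.
  - exact: emeasurable_funD.
  - move=> v [Hv kv]; rewrite -EFinD lee_fin.
    by apply: shifted_osc => //; rewrite -kv.
have up : value p i (trunc k w) <= shifted i w + osc k.
  rewrite -lee_fin value_integral// -[leRHS](integral_prob_cst (P (trunc k w))).
  apply: (@ge0_le_integral_full _ (borel (play G)) R _ F) => //.
  - by move=> v; rewrite lee_fin addr_ge0 ?shifted_ge0 ?oscillation_ge0.
  - by move=> v [Hv kv]; rewrite lee_fin; exact: shifted_osc.
by rewrite ler_norml; apply/andP; split; lra.
Qed.

(** Iterating the one-step inequality up to stage [t + K] bounds the expectation of [W] there by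
    [W t h]. At that stage [W] dominates the utility up to an oscillation, which vanishes as [K]
    grows, so no limit of [W] along plays is needed. [W] will be the value under another profile
    than [p]. *)
Lemma value_le_supermartingale i t (h : hist G t) (W : forall k, hist G k -> R) :
  (forall k h, 0 <= W k h) ->
  (forall k, measurable_fun setT (W k : borel (hist G k) -> R)) ->
  (forall k (h' : hist G k), (t <= k)%N -> H k h' ->
    (\int[move p h']_z (W k.+1 (h', z))%:E <= (W k h')%:E)%E) ->
  (forall k w, Hinf w -> shifted i w <= W k (trunc k w) + osc k) ->
  H t h -> value p i h <= W t h.
Proof.
move=> W0 mW Wstep Wosc Hh; have [s0 ms] := nonneg_measurable_shifted i.
have nmW k : nonneg_measurable (fun w => (W k (trunc k w))%:E).
  have m : measurable_fun setT ((fun h => (W k h)%:E) : borel (hist G k) -> \bar R).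
    by apply/measurable_EFinP; exact: mW.
  apply: (nonneg_measurable_trunc _ m) => h'.
  by rewrite lee_fin.
have past k (h' : hist G k) : (\int[P h']_w (W k (trunc k w))%:E = (W k h')%:E)%E.
  rewrite (integral_outcome_prob_past moverG mp h' (nmW k)) ?extendK//.
  by move=> v v' /agree_trunc ->.
have down d : (\int[P h]_w (W (t + d)%N (trunc (t + d) w))%:E <= (W t h)%:E)%E.
  elim: d => [|d ih]; first by rewrite addn0 past.
  apply: le_trans ih; rewrite addnS; set k := (t + d)%N.
  apply: (@integral_outcome_le _ _ _ moverG _ mp k _ _ (nmW k.+1) (nmW k) _ _ h
    (leq_addr d t) Hh).
  move=> h' Hh'; rewrite (integral_outcome_prob_step moverG mp h' (nmW k.+1)) past.
  apply: le_trans (Wstep _ h' (leq_addr d t) Hh').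
  by under eq_integral do rewrite past.
apply/ler_addgt0Pr => e e0.
have /cvgrPdist_lt/(_ e e0)[K _ oscK] := @continuous_at_infinity _ _ G.
have := oscK (t + K)%N (leq_addl t K); rewrite sub0r normrN => oK.
rewrite -lee_fin EFinD value_integral//.
apply: (@le_trans _ _ (\int[P h]_w ((W (t + K)%N (trunc (t + K) w))%:E + (osc (t + K))%:E))%E).
  apply: (@ge0_le_integral_full _ (borel (play G)) R _ Hinf) => //.
  - exact: measurable_play_set.
  - exact: outcome_prob_play.
  - by move=> w; rewrite -EFinD lee_fin addr_ge0// oscillation_ge0.
  - by apply: emeasurable_funD => //; case: (nmW (t + K)%N).
  - by move=> w Hw; rewrite -EFinD lee_fin; exact: Wosc.
rewrite ge0_integralD//; last 3 first.
- by move=> w _; rewrite lee_fin.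
- by case: (nmW (t + K)%N).
- by move=> w _; rewrite lee_fin oscillation_ge0.
rewrite integral_prob_cst; apply: leeD; first exact: down.
by rewrite lee_fin ltW// (le_lt_trans _ oK)// ler_norm.
Qed.

End profile.
End shifted_utility.

(** * Lower semicontinuity of integrals *)

(** If the integral were [c], then [c - f], which is nonnegative on [F], would have integral zero
    and vanish almost everywhere, contrary to strictness on the charged set [U]. *)
Lemma integral_lt_cst d (T : measurableType d) (R : realType) (mu : probability T R)
    (F U : set T) (f : T -> R) (c : R) :
  measurable F -> mu F = 1%E -> measurable U -> (0 < mu U)%E ->
  (forall x, 0 <= f x) -> measurable_fun setT f ->
  (forall x, F x -> f x <= c) -> (forall x, F x -> U x -> f x < c) ->
  (\int[mu]_x (f x)%:E < c%:E)%E.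
Proof.
move=> mF F1 mU U0 f0 mf fc fUc.
have mf' : measurable_fun F (EFin \o f).
  by apply: measurable_funTS; exact/measurable_EFinP.
have mg : measurable_fun F (fun x => (c - f x)%:E).
  apply/measurable_EFinP; apply: measurable_funB => //.
  by apply: measurable_funTS.
have f0E x : (0 <= (f x)%:E)%E by rewrite lee_fin.
have FE : (\int[mu]_x (f x)%:E = \int[mu]_(x in F) (f x)%:E)%E.
  by apply: ge0_integral_full => //; exact/measurable_EFinP.
have fg : (\int[mu]_(x in F) (f x)%:E + \int[mu]_(x in F) (c - f x)%:E = c%:E)%E.
  rewrite -ge0_integralD//; last by move=> x Fx; rewrite lee_fin subr_ge0 fc.
  under eq_integral do rewrite -EFinD addrC subrK.
  by have := @integral_cst _ T R mu F mF c%:E; rewrite [X in (_ * X)%E]F1 mule1.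
have g0 : (0 <= \int[mu]_(x in F) (c - f x)%:E)%E.
  by apply: integral_ge0 => x Fx; rewrite lee_fin subr_ge0 fc.
have fle : (\int[mu]_x (f x)%:E <= c%:E)%E by rewrite FE -fg leeDl.
rewrite lt_neqAle fle andbT; apply/eqP => fE.
have g0E : (\int[mu]_(x in F) `|(c - f x)%:E| = 0)%E.
  under eq_integral => x /set_mem Fx do rewrite gee0_abs ?lee_fin ?subr_ge0 ?fc//.
  have addc0 (y : \bar R) : (c%:E + y = c%:E)%E -> y = 0%E.
    by case: y => [r| |] //=; rewrite -EFinD => -[cr]; congr _%:E; lra.
  by apply: addc0; rewrite -[in RHS]fg -FE fE.
have [N [mN N0 subN]] := (ae_eq_integral_abs mu mF mg).1 g0E.
have UN : U `<=` N `|` ~` F.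
  move=> x Ux; have [Fx|nFx] := pselect (F x); [left|by right].
  apply: subN => /= /(_ Fx) /eqP; rewrite eqe subr_eq0 => /eqP cf.
  by have := fUc x Fx Ux; rewrite -cf ltxx.
have : mu U = 0%E.
  apply: (subset_measure0 mU _ UN); first by apply: measurableU => //; exact: measurableC.
  rewrite [LHS]measureU0//; first exact: measurableC.
  by rewrite [LHS]probability_setC// F1 subee.
by move: U0 => /[swap] ->; rewrite ltxx.
Qed.

(* The counting behind the layer-cake approximation of [x] by multiples of [eta]. *)
Lemma layers_le (R : realType) (eta x : R) (e : nat -> bool) N : 0 <= eta -> 0 <= x ->
  (forall k, e k -> k.+1%:R * eta <= x) -> \sum_(k < N) eta * (e k)%:R <= x.
Proof.
move=> eta0 x0 ex; have sN m : \sum_(k < m) eta * (e k)%:R <= m%:R * eta.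
  elim: m => [|m ih]; first by rewrite big_ord0 mul0r.
  rewrite big_ord_recr /= -natr1 mulrDl mul1r lerD//.
  by case: (e m); rewrite ?mulr1// mulr0.
elim: N => [|N ih]; first by rewrite big_ord0.
rewrite big_ord_recr /=; case: (boolP (e N)) => [eN|_]; last by rewrite mulr0 addr0.
rewrite mulr1; apply: le_trans (ex N eN).
by rewrite -natr1 mulrDl mul1r lerD2r; exact: sN.
Qed.

Lemma layers_ge (R : realType) (eta x : R) (e : nat -> bool) N : 0 <= eta ->
  (forall k, k.+1%:R * eta < x -> e k) -> x <= N%:R * eta ->
  x <= \sum_(k < N) eta * (e k)%:R + eta.
Proof.
move=> eta0 ex.
have s0 m : 0 <= \sum_(k < m) eta * (e k)%:R.
  by apply: sumr_ge0 => k _; rewrite mulr_ge0.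
have sN m : m%:R * eta < x -> m%:R * eta <= \sum_(k < m) eta * (e k)%:R.
  elim: m => [|m ih] mx; first by rewrite big_ord0 mul0r.
  rewrite big_ord_recr /= (ex m)// mulr1 -natr1 mulrDl mul1r lerD2r.
  by apply: ih; apply: le_lt_trans mx; rewrite -natr1 mulrDl mul1r lerDl.
elim: N => [|N ih] xN.
  by rewrite mul0r in xN; rewrite (le_trans xN)// addr_ge0.
rewrite big_ord_recr /=; have [Nx|xN'] := ltP (N%:R * eta) x.
  have := sN _ Nx; rewrite -natr1 mulrDl mul1r in xN.
  have : 0 <= eta * (e N)%:R by rewrite mulr_ge0.
  lra.
have := ih xN'; have : 0 <= eta * (e N)%:R by rewrite mulr_ge0.
lra.
Qed.

Section lower_semicontinuity.
Variables (R : realType) (Y : topologicalType) (S : polishType R).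
Variables (D : set Y) (kappa : Y -> prob R S).
Hypothesis kappa_continuous : forall y, D y -> forall V (r : R), open V ->
  (r%:E < kappa y V)%E -> \forall y' \near within D (nbhs y), (r%:E < kappa y' V)%E.

Lemma open_section (O : set (Y * S)) y : open O -> open [set s | O (y, s)].
Proof.
move=> oO; apply: (open_comp (f := fun s : S => (y, s))) => // s _.
exact: (@cvg_pair _ _ _ (nbhs s) (nbhs y) (nbhs s) _ _ _ (cst y) id (cvg_cst y) cvg_id).
Qed.

(** Both the measure and the section vary with [y]. By continuity from below, finitely many basic
    sets inside the section at [y] already carry mass above [r]; their union lies in the sections at
    all nearby points, so only the measure still has to vary. *)
Lemma prob_section_lsc (O : set (Y * S)) y (r : R) : open O -> D y ->
  (r%:E < kappa y [set s | O (y, s)])%E ->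
  \forall y' \near within D (nbhs y), (r%:E < kappa y' [set s | O (y', s)])%E.
Proof.
move=> oO Dy rO; have [b [ob bP]] := polish_countable_basis S.
pose J := [set j | exists2 N, nbhs y N & N `*` b j `<=` O].
pose U m := \bigcup_(j in [set j | (j < m)%N /\ J j]) b j.
have oU m : open (U m) by apply: bigcup_open => j _; exact: ob.
have OU : [set s | O (y, s)] = \bigcup_m U m.
  apply/seteqP; split => [s Os|s [m _ [j [_ [N yN NO]] bs]]]; last first.
    by apply: NO; split => //=; exact: nbhs_singleton.
  have : nbhs (y, s) O by exact: open_nbhs_nbhs.
  move=> [[N V]] /= [yN sV] NVO; have [j bjs bjV] := bP s V sV.
  exists j.+1 => //; exists j => //; split => //; exists N => // -[y' s'] [/= Ny' bs'].
  by apply: NVO; split => //=; exact: bjV.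
have ndU : nondecreasing_seq U.
  move=> m m' mm'; apply/subsetPset => s [j [jm Jj] bs]; exists j => //; split => //.
  exact: leq_trans mm'.
have [m rU] : exists m, (r%:E < kappa y (U m))%E.
  apply: nondecreasing_measure_gt => //; last by rewrite -OU.
  by move=> m; exact: open_borel.
have UO k : \forall y' \near y, U k `<=` [set s | O (y', s)].
  elim: k => [|k ih]; first by apply: nearW => y' s [j []].
  have [[N yN NO]|nJ] := pselect (J k).
    have nb := @filterI _ (nbhs y) (nbhs_filter y) _ _ yN ih.
    apply: (filterS _ nb) => y' [Ny' ih'] s [j []].
    rewrite ltnS leq_eqVlt => /predU1P[->|jm] Jj bs; first exact: NO.
    by apply: ih'; exists j.
  apply: (@filterS _ (nbhs y) _ _ _ _ ih) => y' ih' s [j []].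
  rewrite ltnS leq_eqVlt => /predU1P[-> /nJ//|jm] Jj bs.
  by apply: ih'; exists j.
have := kappa_continuous Dy (oU m) rU; rewrite !near_withinE => near1.
have nb := @filterI _ (nbhs y) (nbhs_filter y) _ _ near1 (UO m).
apply: (@filterS _ (nbhs y) _ _ _ _ nb) => y' [near1' UO'] Dy'.
apply: (lt_le_trans (near1' Dy')); apply: le_measure => //; rewrite inE.
  exact: open_borel.
by apply: open_borel; exact: open_section.
Qed.

(** Layer cake: the integral is compared with [eta] times the sum of the masses of finitely many
    open layers, each of which is lower semicontinuous by [prob_section_lsc]. *)
Lemma integral_lsc (v : Y * S -> R) (delta M : R) :
  0 <= delta ->
  (forall p, 0 <= v p) -> (forall p, v p <= M) ->
  (forall y, measurable_fun setT ((fun s => v (y, s)) : borel S -> R)) ->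
  (forall y s eta, D y -> 0 < eta ->
    \forall q \near (y, s), D q.1 -> v (y, s) - delta - eta < v q) ->
  forall y (r : R), D y -> ((r + delta)%:E < \int[kappa y]_s (v (y, s))%:E)%E ->
  \forall y' \near within D (nbhs y), (r%:E < \int[kappa y']_s (v (y', s))%:E)%E.
Proof.
move=> delta0 v0 vM mv vlsc y r Dy rv.
have intE y' : exists2 I : R, (\int[kappa y']_s (v (y', s))%:E)%E = I%:E & 0 <= I.
  have i0 : (0 <= \int[kappa y']_s (v (y', s))%:E)%E.
    by apply: integral_ge0 => s _; rewrite lee_fin.
  have iM : (\int[kappa y']_s (v (y', s))%:E <= M%:E)%E.
    rewrite -[leRHS](integral_prob_cst (kappa y')); apply: ge0_le_integral => //.
    - by move=> s _; rewrite lee_fin.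
    - exact/measurable_EFinP.
    - by move=> s _; rewrite lee_fin.
  exists (fine (\int[kappa y']_s (v (y', s))%:E)%E); last exact: fine_ge0.
  by rewrite fineK// ge0_fin_numE// (le_lt_trans iM)// ltry.
have [I IE I0] := intE y; rewrite IE lte_fin in rv.
(* The slack is spent in two equal parts: on rounding to multiples of [eta], and on the loss of mass
   of the layers near [y]. *)
pose eta := (I - delta - r) / 2; have eta0 : 0 < eta by rewrite /eta; lra.
pose N := Num.truncn (M / eta); have MN : M <= N.+1%:R * eta.
  by rewrite -ler_pdivrMr// ltW// truncnS_gt.
(* Superlevel sets of [v] need not be open. Their interiors still contain every point over [D] where
   [v - delta] exceeds the level, so the defect enters only in [upper]. *)
pose O k := (interior [set q | D q.1 -> k.+1%:R * eta < v q]) : set (Y * S).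
have oO k : open (O k) by exact: open_interior.
have mO k y' : measurable ([set s | O k (y', s)] : set (borel S)).
  by apply: open_borel; exact: open_section.
pose m k y' : R := fine (kappa y' [set s | O k (y', s)]).
have mE k y' : (kappa y' [set s | O k (y', s)] = (m k y')%:E)%E.
  by rewrite /m fineK// fin_num_measure.
pose e k y' s := (s \in [set s | O k (y', s)]).
have sumE y' : (\int[kappa y']_s (\sum_(k < N.+1) eta * (e k y' s)%:R)%:E =
    (\sum_(k < N.+1) eta * m k y')%:E)%E.
  under eq_integral do rewrite -sumEFin.
  rewrite ge0_integral_sum//; last 2 first.
  - move=> k; apply/measurable_EFinP; apply: measurable_funM => //.
    exact: (measurable_indic (mO k y')).
  - by move=> k s _; rewrite lee_fin mulr_ge0// ltW.
  rewrite -sumEFin; apply: eq_bigr => k _.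
  under eq_integral do rewrite EFinM.
  have mek : measurable_fun setT ((fun s => (e k y' s)%:R%:E) : borel S -> \bar R).
    by apply/measurable_EFinP; exact: (measurable_indic (mO k y')).
  rewrite (ge0_integralZl (kappa y') measurableT mek); last 2 first.
  - by move=> s _; rewrite lee_fin.
  - by rewrite lee_fin ltW.
  rewrite [RHS]EFinM; congr (_ * _)%E; rewrite -(mE k y').
  by rewrite -[X in kappa y' X]setIT -integral_indic.
have msum y' : measurable_fun setT
    ((fun s => (\sum_(k < N.+1) eta * (e k y' s)%:R)%:E) : borel S -> \bar R).
  apply/measurable_EFinP; apply: measurable_sum => k; apply: measurable_funM => //.
  exact: (measurable_indic (mO k y')).
have sum0 y' s : 0 <= \sum_(k < N.+1) eta * (e k y' s)%:R.
  by apply: sumr_ge0 => k _; rewrite mulr_ge0// ltW.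
have lower y' I' : D y' -> (\int[kappa y']_s (v (y', s))%:E)%E = I'%:E ->
    \sum_(k < N.+1) eta * m k y' <= I'.
  move=> Dy' I'E; rewrite -lee_fin -I'E -sumE; apply: ge0_le_integral => //.
  - by move=> s _; rewrite lee_fin.
  - exact/measurable_EFinP.
  - move=> s _; rewrite lee_fin; apply: (@layers_le R eta _ (fun k => e k y' s)) => //.
      exact: ltW.
    move=> k; rewrite /e inE => Ok; apply: ltW.
    by have := @interior_subset _ _ (y', s) Ok; apply.
have upper : I - delta <= \sum_(k < N.+1) eta * m k y + eta.
  rewrite lerBlDr -addrA -lee_fin -IE EFinD -sumE.
  rewrite -[X in (_ <= _ + X)%E](integral_prob_cst (kappa y)) -ge0_integralD//; last 2 first.
  - by move=> s _; rewrite lee_fin.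
  - by move=> s _; rewrite lee_fin addr_ge0// ltW.
  apply: ge0_le_integral => //.
  - by move=> s _; rewrite lee_fin.
  - exact/measurable_EFinP.
  - exact: emeasurable_funD.
  move=> s _; rewrite -EFinD lee_fin addrA -lerBlDr.
  apply: (@layers_ge R eta _ (fun k => e k y s)).
  - exact: ltW.
  - move=> k kv; rewrite /e inE /= /O /interior /=.
    have := vlsc y s (v (y, s) - delta - k.+1%:R * eta) Dy; rewrite subr_gt0 => /(_ kv).
    by apply: filterS => q + Dq => /(_ Dq); rewrite opprB addrC subrK.
  - by rewrite (le_trans _ MN)// (le_trans _ (vM (y, s)))// lerBlDr lerDl.
(* There are [N.+1] layers, whose losses of at most [eps] add up to less than one. *)
pose eps := (N.+2%:R)^-1 : R.
have eps0 : 0 < eps by rewrite invr_gt0.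
have near1 k : \forall y' \near within D (nbhs y), m k y - eps < m k y'.
  have := @prob_section_lsc (O k) y (m k y - eps) (oO k) Dy.
  rewrite mE lte_fin => /(_ _); rewrite ltrBlDr ltrDl => /(_ eps0).
  by apply: filterS => y'; rewrite mE lte_fin.
have near2 : \forall y' \near within D (nbhs y), forall k : 'I_N.+1, m k y - eps < m k y'.
  by apply: filter_forall => k; exact: near1.
rewrite near_withinE; move: near2; rewrite near_withinE; apply: filterS => y' near2 Dy'.
have [I' I'E _] := intE y'; rewrite I'E lte_fin.
apply: (lt_le_trans _ (lower y' I' Dy' I'E)).
have : \sum_(k < N.+1) eta * m k y - eta < \sum_(k < N.+1) eta * m k y'.
  apply: (@lt_le_trans _ _ (\sum_(k < N.+1) (eta * m k y - eta * eps))).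
    rewrite sumrB sumr_const card_ord ltrD2l ltrN2 -mulrnAr -[ltRHS]mulr1 ltr_pM2l//.
    by rewrite /eps -mulr_natl -ltr_pdivlMr ?invr_gt0// invrK mul1r ltr_nat.
  apply: ler_sum => k _; rewrite -mulrBr ler_pM2l//.
  by rewrite ltW// near2.
by rewrite /eta in upper *; lra.
Qed.

End lower_semicontinuity.

(** * One-step deviations *)

Lemma two_players (i j k : 'I_2) : i != j -> k != i -> k = j.
Proof.
move=> ij ki; apply: val_inj; move: (ltn_ord i) (ltn_ord j) (ltn_ord k) ij ki.
by rewrite -!val_eqE /=; lia.
Qed.

Lemma sum_two (V : nmodType) (i j : 'I_2) (F : 'I_2 -> V) : i != j ->
  \sum_(k < 2) F k = F i + F j.
Proof.
move=> ij; rewrite (bigD1 i)//= (bigD1 j)//=; last by rewrite eq_sym.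
rewrite big1 ?addr0// => k /andP[ki kj].
by have := two_players ij ki; move/eqP: kj.
Qed.

Lemma one_mover_perfect_information (R : realType) (G : game 2 R) :
  perfect_information G -> one_mover G.
Proof.
move=> pi t h Hh; have [/(_ _) mover _] := pi t h Hh.
have [[i nsi]|/forallNP all1] :=
    pselect (exists i, ~ single_point (action G t i h)).
  have [single _] := mover i nsi.
  exists i, (fun j => xget point (action G t j h)) => j /single[x ->].
  by rewrite (@xget_unique _ point [set x] x).
(* No player has a choice here, though Nature may; any player can be called the mover. *)
exists ord0, (fun j => xget point (action G t j h)) => j _.
by have /contrapT[x ->] := all1 j; rewrite (@xget_unique _ point [set x] x).
Qed.

Section one_step.
Variables (n : nat) (R : realType) (G : game n R).
Hypothesis moverG : one_mover G.
Local Notation X := (act_space G).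
Local Notation H := (hist_set (action G)).

Definition expected_value (p : forall i, strategy G i) i t (h : hist G t)
    (b : forall i, X t i) : R :=
  fine (\int[nature G t h]_s (@value _ _ _ p i t.+1 (h, (b, s)))%:E)%E.

(** A deviation at the single history [h0]: the strategy at all later stages is untouched, so
    continuation values stay the same. *)
Definition deviate i (fi : strategy G i) t0 (h0 : hist G t0) (a : X t0 i) : strategy G i :=
  @dfwith nat (fun t => hist G t -> prob R (X t i)) fi t0
    (fun h => if `[< h = h0 >] then dirac_prob R a else fi t0 h).

Lemma deviate_at i fi t0 h0 a : @deviate i fi t0 h0 a t0 h0 = dirac_prob R a.
Proof. by rewrite /deviate dfwithin asboolT. Qed.

Lemma deviate_other i fi t0 h0 a t : t0 != t -> @deviate i fi t0 h0 a t = fi t.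
Proof. by move=> tt; rewrite /deviate dfwithout. Qed.

Lemma deviate_mixed i fi t0 h0 a : mixed_strategy fi -> H t0 h0 ->
  action G t0 i h0 a -> mixed_strategy (@deviate i fi t0 h0 a).
Proof.
move=> mfi Hh0 Aa t; have [mt st] := mfi t.
have [<-|tt] := eqVneq t0 t; last by rewrite deviate_other.
have {mt st}[mt st] := mfi t0; rewrite /deviate dfwithin; split; last first.
  move=> h Hh; case: asboolP => [->|_]; last exact: st.
  by apply: dirac_prob_support => //; exact: action_closed.
have mH := @measurable_hist_set _ _ G t0; have m1 := measurable_hist1 h0.
rewrite (_ : H t0 = (H t0 `&` [set h0]) `|` (H t0 `\` [set h0])); last first.
  by rewrite setDE -setIUr setUv setIT.
apply/measurable_funU; [exact: measurableI|exact: measurableD|split].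
  apply: (@eq_measurable_fun _ _ (borel (hist G t0)) (borel (prob R (X t0 i))) _
    (cst (dirac_prob R a))); last exact: measurable_cst.
  by move=> h /set_mem[_ /= ->]; rewrite asboolT.
apply: (@eq_measurable_fun _ _ (borel (hist G t0)) (borel (prob R (X t0 i))) _ (fi t0)).
  by move=> h /set_mem[_ /= hh0]; rewrite asboolF.
by apply: measurable_funS mt => // h [].
Qed.

Lemma payoff_later (p q : forall i, strategy G i) i t (h : hist G t) :
  (forall j k h', (t <= k)%N -> p j k h' = q j k h') -> payoff p h i = payoff q h i.
Proof.
move=> pq; rewrite /payoff; congr get; apply/funext => v; apply/propext.
have pqE k h' : (t <= k)%N -> (fun j => p j k h') = (fun j => q j k h').
  by move=> tk; apply: functional_extensionality_dep => j; exact: pq.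
split=> -[tau [lambda [nu [l1 l2 l3 l4]]] vE]; exists tau => //; exists lambda, nu.
  by split => // k h' tk Hh'; rewrite -pqE//; exact: l2.
by split => // k h' tk Hh'; rewrite pqE//; exact: l2.
Qed.

Section profile.
Variable p : forall i, strategy G i.
Arguments p : clear implicits.
Hypothesis mp : mixed_profile p.

Lemma measurable_value_section i t (h : hist G t) k (b : forall i, X t i) :
  measurable_fun setT
    ((fun q => (@value _ _ _ p i t.+1 (h, (@dfwith _ (X t) b k q.1, q.2)))%:E) :
      borel (X t k) * borel (nat_space G t) -> \bar R).
Proof.
exact: (measurableT_comp (@measurable_value_stage _ _ _ moverG _ mp i t h)
  (@measurable_dfwith_stage _ _ G t k b)).
Qed.

Lemma measurable_value_nature i t (h : hist G t) (b : forall i, X t i) :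
  measurable_fun setT ((fun s => @value _ _ _ p i t.+1 (h, (b, s))) :
    borel (nat_space G t) -> R).
Proof.
apply/measurable_EFinP; apply: (measurableT_comp (@measurable_value_stage _ _ _ moverG _ mp i t h)).
apply: (@continuous_measurable_borel _ (stage G t.+1) (fun s => (b : prod_topology (X t), s))).
move=> s; exact: (@cvg_pair _ _ _ (nbhs s) (nbhs (b : prod_topology (X t))) (nbhs s)
  _ _ _ (cst (b : prod_topology (X t))) id (cvg_cst _) cvg_id).
Qed.

Lemma expected_valueE i t (h : hist G t) (b : forall i, X t i) :
  ((expected_value p i h b)%:E =
    \int[nature G t h]_s (@value _ _ _ p i t.+1 (h, (b, s)))%:E)%E.
Proof.
have v0 z : 0 <= @value _ _ _ p i t.+1 (h, z) by exact: value_ge0.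
rewrite /expected_value fineK// ge0_fin_numE; last first.
  by apply: integral_ge0 => s _; rewrite lee_fin.
apply: (@le_lt_trans _ _ (`|bound G i| + `|bound G i|)%:E); last exact: ltry.
rewrite -[leRHS](integral_prob_cst (nature G t h)); apply: ge0_le_integral => //.
- by move=> s _; rewrite lee_fin.
- by apply/measurable_EFinP; exact: measurable_value_nature.
- by move=> s _; rewrite lee_fin; exact: value_le.
Qed.

Lemma expected_value_ge0 i t (h : hist G t) b : 0 <= expected_value p i h b.
Proof.
rewrite /expected_value fine_ge0//; apply: integral_ge0 => s _; rewrite lee_fin.
exact: value_ge0.
Qed.

Lemma measurable_expected_value i t (h : hist G t) k (b : forall i, X t i) :
  measurable_fun setT
    ((fun y => expected_value p i h (@dfwith _ (X t) b k y)) : borel (X t k) -> R).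
Proof.
apply/measurable_EFinP.
have := @measurable_fun_integral_prob _ _ (borel (X t k)) (borel (nat_space G t)) R
  (fun=> nature G t h) _ _ _ (@measurable_value_section i t h k b).
rewrite (_ : (fun x => _) = EFin \o (fun y => expected_value p i h (@dfwith _ (X t) b k y))).
  by apply => [B _|q]; [exact: measurable_cst|rewrite lee_fin value_ge0].
by apply/funext => y /=; rewrite expected_valueE.
Qed.

Lemma value_dirac i t (h : hist G t) k (b : forall i, X t i) : H t h ->
  (forall j, j != k -> is_dirac (p j t h) (b j)) ->
  ((value p i h)%:E =
    \int[p k t h]_y (expected_value p i h (@dfwith _ (X t) b k y))%:E)%E.
Proof.
move=> Hh pb; rewrite (value_step moverG mp i Hh).
rewrite (integral_is_product (mu := fun j => p j t h) pb (move_product moverG mp Hh)); last 2 first.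
- by move=> z; rewrite lee_fin value_ge0.
- exact: measurable_value_stage.
by apply: eq_integral => y _; rewrite expected_valueE.
Qed.

End profile.
End one_step.

(** * Securing the value in one move *)

Section fixed_sum_games.
Variables (R : realType) (G : game 2 R).
Hypothesis perfG : perfect_information G.
Hypothesis fixG : fixed_sum G.
Local Notation X := (act_space G).
Local Notation H := (hist_set (action G)).
Local Notation Hinf := (play_set (action G)).

Let moverG := one_mover_perfect_information perfG.

Definition total (i j : 'I_2) : R := sval (cid fixG) + bound G i + bound G j.

Lemma shifted_sum i j (w : play G) : i != j -> Hinf w ->
  shifted i w + shifted j w = total i j.
Proof.
move=> ij Hw; rewrite !shiftedE// /total -(svalP (cid fixG) w Hw) (sum_two _ ij).
lra.
Qed.

Section profile.
Variable p : forall i, strategy G i.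
Arguments p : clear implicits.
Hypothesis mp : mixed_profile p.

Lemma value_sum i j t (h : hist G t) : i != j -> H t h ->
  value p i h + value p j h = total i j.
Proof.
move=> ij Hh; apply/EFin_inj; rewrite EFinD !(value_integral moverG mp)//.
have [si mi] := @nonneg_measurable_shifted _ _ G i.
have [sj mj] := @nonneg_measurable_shifted _ _ G j.
have mH := @measurable_play_set _ _ G.
have H1 := outcome_prob_play moverG mp Hh.
rewrite -ge0_integralD// (ge0_integral_full mH H1)//; last 2 first.
- by move=> w; rewrite adde_ge0.
- exact: emeasurable_funD.
under eq_integral => w /set_mem Hw do rewrite -EFinD (shifted_sum ij Hw).
have := @integral_cst _ (borel (play G)) R (outcome_prob moverG mp h) Hinf mH (total i j)%:E.
by rewrite [X in (_ * X)%E]H1 mule1.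
Qed.

Lemma expected_value_sum i j t (h : hist G t) (b : forall i, X t i) : i != j -> H t h ->
  (forall k, action G t k h (b k)) ->
  expected_value p i h b + expected_value p j h b = total i j.
Proof.
move=> ij Hh Ab; apply/EFin_inj; rewrite EFinD !(expected_valueE moverG mp).
have v0 k s : (0 <= (@value _ _ _ p k t.+1 (h, (b, s)))%:E)%E.
  by rewrite lee_fin (value_ge0 moverG).
have mv k : measurable_fun setT
    ((fun s => (@value _ _ _ p k t.+1 (h, (b, s)))%:E) : borel (nat_space G t) -> \bar R).
  by apply/measurable_EFinP; exact: measurable_value_nature.
rewrite -ge0_integralD//.
under eq_integral => s _ do rewrite -EFinD value_sum//.
exact: integral_prob_cst.
Qed.

End profile.

Section equilibrium.
Variable f : forall i, strategy G i.
Arguments f : clear implicits.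
Hypothesis spe : subgame_perfect f.

Let mf : mixed_profile f := spe.1.

(** The equilibrium condition for the deviation of [i] to [b i] at [h] alone. The opponent may still
    mix, whence the integral over [f j t h]; the component [b j] is overwritten. *)
Lemma deviation_le i j t (h : hist G t) (b : forall i, X t i) :
  i != j -> H t h -> action G t i h (b i) ->
  (\int[f j t h]_y (expected_value f i h (@dfwith _ (X t) b j y))%:E <=
   (value f i h)%:E)%E.
Proof.
move=> ij Hh Ab; pose d := deviate (f i) h (b i).
have md : mixed_strategy d by apply: deviate_mixed => //; exact: mf.
pose f' := @dfwith _ (strategy G) f i d.
have mf' : mixed_profile f'.
  move=> k; have [->|ki] := eqVneq k i; first by rewrite /f' dfwithin.
  by rewrite /f' dfwithout 1?eq_sym//; exact: mf.
have f'j : f' j t h = f j t h by rewrite /f' dfwithout.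
have le : value f' i h <= value f i h.
  rewrite !value_payoff// lerD2r; exact: spe.2.
apply: (@le_trans _ _ (value f' i h)%:E); last by rewrite lee_fin.
rewrite (@value_dirac _ _ _ moverG f' mf' i t h j b Hh); last first.
  move=> k kj; have -> : k = i by apply: (two_players _ kj); rewrite eq_sym.
  by rewrite /f' dfwithin /d deviate_at.
rewrite f'j le_eqVlt; apply/orP; left; apply/eqP; apply: eq_integral => y _.
(* From stage [t.+1] on the deviation coincides with [f]. *)
congr (fine _)%:E; apply: eq_integral => s _; congr _%:E.
rewrite /value; case: asboolP => // _; congr (_ + _).
apply: payoff_later => k l h' tl; rewrite /f'.
have [->|ki] := eqVneq k i; last by rewrite dfwithout 1?eq_sym.
by rewrite dfwithin /d deviate_other// ltn_eqF.
Qed.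

Lemma integral_dirac_expected i j t (h : hist G t) b (mu : prob R (X t j)) x :
  is_dirac mu x ->
  (\int[mu]_y (expected_value f i h (@dfwith _ (X t) b j y))%:E =
   (expected_value f i h (@dfwith _ (X t) b j x))%:E)%E.
Proof.
move=> mux; have m := @measurable_expected_value _ _ _ moverG f mf i t h j b.
rewrite (eq_integral_prob _ mux) integral_dirac//; last exact/measurable_EFinP.
by rewrite diracT mul1e.
Qed.

Lemma dfwith_id t (b : forall i, X t i) j : @dfwith _ (X t) b j (b j) = b.
Proof. by apply: functional_extensionality_dep => k; case: dfwithP. Qed.

Lemma deviation_dirac i j t (h : hist G t) (b : forall i, X t i) :
  i != j -> H t h -> action G t i h (b i) -> action G t j h = [set b j] ->
  expected_value f i h b <= value f i h.
Proof.
move=> ij Hh Ai Aj; rewrite -lee_fin; apply: le_trans (deviation_le ij Hh Ai).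
by rewrite (integral_dirac_expected i h b (strategy_dirac mf Hh Aj)) dfwith_id.
Qed.

Lemma measurable_action i t (h : hist G t) : H t h ->
  measurable (action G t i h : set (borel (X t i))).
Proof. by move=> Hh; apply: closed_borel; exact: action_closed. Qed.

Lemma strategy_action i t (h : hist G t) : H t h -> f i t h (action G t i h) = 1%E.
Proof.
move=> Hh; apply: prob_support_full; first exact: measurable_action.
exact: strategy_support.
Qed.

Lemma value_ge_secured i j t (h : hist G t) a (r : R) : i != j -> H t h ->
  action G t i h a ->
  (forall b : forall i, X t i, b i = a -> action G t j h (b j) ->
    r <= expected_value f i h b) ->
  r <= value f i h.
Proof.
(* The comparison of integrals is for nonnegative functions; a nonpositive [r] is below the shifted
   value anyway. *)
move=> ij Hh Aa rb; have [r0|r0] := leP r 0; first by rewrite (le_trans r0)// (value_ge0 moverG).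
pose b := @dfwith _ (X t) point i a.
have bi : b i = a by rewrite /b dfwithin.
have := @deviation_le i j t h b ij Hh; rewrite bi => /(_ Aa).
rewrite -lee_fin; apply: le_trans; rewrite -[leLHS](integral_prob_cst (f j t h)).
have m := @measurable_expected_value _ _ _ moverG f mf i t h j b.
apply: (@ge0_le_integral_full _ (borel (X t j)) R _ (action G t j h)) => //.
- exact: measurable_action.
- exact: strategy_action.
- by move=> y; rewrite lee_fin ltW.
- by move=> y; rewrite lee_fin (expected_value_ge0 moverG).
- exact/measurable_EFinP.
- move=> y Ay; rewrite lee_fin; apply: rb; last by rewrite dfwithin.
  by rewrite dfwithout// eq_sym.
Qed.

(** If [i] is the mover, the value is an average over the available actions and cannot exceed all of
    them strictly. If [j] is the mover, the action of [i] is forced, no reply gives [j] more than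
    the equilibrium value, and so by the fixed sum every reply leaves [i] at least the equilibrium
    value. *)
Lemma securing_action i j t (h : hist G t) : i != j -> H t h ->
  exists2 a, action G t i h a &
  forall b : forall i, X t i, b i = a -> action G t j h (b j) ->
    value f i h <= expected_value f i h b.
Proof.
move=> ij Hh; have [k [b0 Ab0]] := moverG Hh; have [ki|kj] := eqVneq k i.
  subst k; have Aj : action G t j h = [set b0 j] by apply: Ab0; rewrite eq_sym.
  apply: contrapT => nsec.
  have lt y : action G t i h y ->
      expected_value f i h (@dfwith _ (X t) b0 i y) < value f i h.
    move=> Ay; rewrite ltNge; apply/negP => le; apply: nsec; exists y => // b bi.
    rewrite Aj /= => bj; rewrite (_ : b = @dfwith _ (X t) b0 i y)//.
    apply: functional_extensionality_dep => l; have [->|li] := eqVneq l i.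
      by rewrite dfwithin.
    by rewrite dfwithout 1?eq_sym// (two_players ij li).
  have : ((value f i h)%:E < (value f i h)%:E)%E; last by rewrite ltxx.
  rewrite [ltLHS](@value_dirac _ _ _ moverG f mf i t h i b0 Hh); last first.
    by move=> l li; apply: (strategy_dirac mf) => //; exact: Ab0.
  apply: (@integral_lt_cst _ (borel (X t i)) R _ (action G t i h) (action G t i h)).
  - exact: measurable_action.
  - exact: strategy_action.
  - exact: measurable_action.
  - by rewrite [ltRHS](strategy_action i Hh) lte01.
  - by move=> y; exact: (expected_value_ge0 moverG).
  - exact: (@measurable_expected_value _ _ _ moverG).
  - by move=> y /lt/ltW.
  - by move=> y /lt.
have Ai : action G t i h = [set b0 i] by apply: Ab0; rewrite eq_sym.
exists (b0 i); first by rewrite Ai.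
move=> b bi Abj; have Abi : action G t i h (b i) by rewrite Ai bi.
have ji : j != i by rewrite eq_sym.
have := deviation_dirac ji Hh Abj; rewrite bi => /(_ Ai).
have Ab l : action G t l h (b l).
  by have [->|li] := eqVneq l i; rewrite // (two_players ij li).
have := value_sum mf ij Hh; have := expected_value_sum mf ij Hh Ab; lra.
Qed.

End equilibrium.
End fixed_sum_games.

(** * Lower semicontinuity of the values *)

Section value_continuity.
Variables (n : nat) (R : realType) (G : game n R).
Hypothesis moverG : one_mover G.
Local Notation X := (act_space G).
Local Notation H := (hist_set (action G)).
Local Notation Hinf := (play_set (action G)).
Local Notation osc := (oscillation (action G) (utility G)).

(** Lower hemicontinuity supplies, at nearby histories, an action close to [x i] for each player
    separately; Nature's state [s] is kept, since every state belongs to the next histories. *)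
Lemma hist_lift t (h : hist G t) (z : stage G t.+1) (N : set (hist G t.+1)) :
  H t.+1 (h, z) -> nbhs ((h, z) : hist G t.+1) N ->
  \forall h' \near within (H t) (nbhs h), exists z', H t.+1 (h', z') /\ N (h', z').
Proof.
case: z => x s [/= Hh Ax] [[N1 N2]] /= [hN1 [[N3 N4]] /= [xN3 sN4] N34] N12.
have [V [sq [oV VN]]] := prod_nbhsP xN3.
have lhc i : \forall h' \near within (H t) (nbhs h), action G t i h' `&` V i !=set0.
  have [oVi xVi] := oV i.
  by apply: (@action_lhc _ _ G t i h Hh (V i) oVi); exists (x i); split => //; exact: Ax.
have lhcs : \forall h' \near within (H t) (nbhs h),
    forall i, action G t i h' `&` V i !=set0 by exact: filter_forall.
rewrite near_withinE in lhcs; rewrite near_withinE.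
have nb := @filterI _ (nbhs h) (nbhs_filter h) _ _ hN1 lhcs.
apply: (filterS _ nb) => h' [Nh' Ah'] Hh'.
have x' i := cid (Ah' Hh' i).
exists ((fun i => sval (x' i)), s); split; first by split => // i; have [] := svalP (x' i).
apply: N12; split => //=; apply: N34; split => /=; last exact: nbhs_singleton.
by apply: VN => i _; have [] := svalP (x' i).
Qed.

(** Iterating [hist_lift] shows that truncation is an open map between histories of the game, so
    plays close to [w] exist through every history close to [trunc t w]. *)
Lemma trunc_lift t d (w : play G) (N : set (hist G (t + d))) :
  H (t + d)%N (trunc (t + d) w) -> nbhs (trunc (t + d) w) N ->
  \forall h' \near within (H t) (nbhs (trunc t w)), exists w',
    [/\ H (t + d)%N (trunc (t + d) w'), N (trunc (t + d) w') & trunc t w' = h'].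
Proof.
elim: d N => [|d ih] N.
  rewrite addn0 in N * => Hw nN; rewrite near_withinE.
  by apply: (filterS _ nN) => h' Nh' Hh'; exists (extend h'); rewrite extendK.
rewrite addnS in N * => Hw nN; set k := (t + d)%N in ih N Hw nN *.
have Hk : H k (trunc k w) by case: Hw.
pose N' := [set q | H k q -> exists z', H k.+1 (q, z') /\ N (q, z')].
have nN' : nbhs (trunc k w) N'.
  by have := @hist_lift k (trunc k w) (w k.+1) N Hw nN; rewrite near_withinE.
have := ih N' Hk nN'; rewrite !near_withinE => nb.
apply: (filterS _ nb) => h' ex Hh'; have [w' [Hw' Nw' w'h']] := ex Hh'.
have [z [Hz Nz]] := Nw' Hw'.
have uE : trunc k.+1 (upd w' z) = (trunc k w', z).
  by rewrite /= (@trunc_upd _ _ G k k.+1)// updE.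
exists (upd w' z); rewrite uE; split => //.
by rewrite (@trunc_upd _ _ G t k.+1)// /k ltnS leq_addr.
Qed.

(** Lower semicontinuity relative to [H t] up to a jump of size [delta]; the usual notion for
    [delta] equal to zero. *)
Definition delta_lsc t (v : hist G t -> R) (delta : R) :=
  forall h, H t h -> forall eta, 0 < eta ->
  \forall h' \near within (H t) (nbhs h), v h - delta - eta < v h'.

Section profile.
Variable p : forall i, strategy G i.
Arguments p : clear implicits.
Hypothesis mp : mixed_profile p.

(* The outcome measure of the subgame at [h] charges the plays through [h]. *)
Lemma play_extension t (h : hist G t) : H t h -> exists2 w, Hinf w & trunc t w = h.
Proof.
move=> Hh; apply: contrapT => nw.
pose F := Hinf `&` (trunc t @^-1` [set h]) : set (borel (play G)).
have F1 : outcome_prob moverG mp h F = 1%E.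
  have mE := measurable_trunc_preimage (measurable_hist1 h).
  have mH := @measurable_play_set _ _ G.
  rewrite /F -bigcap2E; apply: probability_bigcap1 => -[|[|j]] //=.
  - exact: outcome_prob_play.
  - by rewrite (outcome_prob_past moverG mp _ (measurable_hist1 h))// extendK indicE mem_set.
  - exact: probability_setT.
have F0 : F = set0.
  by rewrite -subset0 => w [Hw wh]; apply: nw; exists w.
by move: F1; rewrite F0 measure0 => /eqP; rewrite eq_sym onee_eq0.
Qed.

(** One oscillation is paid for replacing the value at [h] by the utility of a play through [h],
    another for the way back at [h']. In between, continuity of the utility is applied to a nearby
    play through [h']. *)
Lemma value_lsc_oscillation i T :
  delta_lsc (@value _ _ _ p i T) (osc T + osc T).
Proof.
move=> h Hh eta eta0; have [w Hw wh] := play_extension Hh.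
have near_u : nbhs w [set g | Hinf g -> utility G i w - eta < utility G i g].
  have /subspace_continuousP/(_ w Hw) := @utility_continuous _ _ G i.
  move=> /cvgrPdist_lt/(_ eta eta0); rewrite near_withinE; apply: filterS => g ug Hg.
  by have := ug Hg; rewrite ltr_distlC => /andP[].
have [V [s [oV sV]]] := prod_nbhsP near_u.
(* The neighbourhood of [w] constrains finitely many stages; [K] is at least as large as all of them
   and as [T]. *)
pose d := \max_(k <- s) k; pose K := (T + d)%N.
have sK k : k \in s -> (k <= K)%N.
  move=> ks; apply: (leq_trans _ (leq_addl T d)).
  exact: (@leq_bigmax_seq _ _ _ (fun k : nat => k)).
have ext_agree (v : play G) k : (k <= K)%N -> extend (trunc K v) k = v k.
  move=> kK; have /agree_trunc ag : trunc K (extend (trunc K v)) = trunc K v.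
    exact: extendK.
  by rewrite ag.
pose N := [set q : hist G K | forall k, k \in s -> V k (extend q k)].
have nN : nbhs (trunc K w) N.
  have ec := @extend_continuous _ _ G K (trunc K w) [set q | forall k, k \in s -> V k (q k)].
  apply: ec; apply: nbhs_prod_topology => k ks; rewrite ext_agree ?sK//.
  exact: open_nbhs_nbhs.
have := @trunc_lift T d w N (Hw K) nN; rewrite wh !near_withinE => nb.
apply: (filterS _ nb) => h' ex Hh'; have [w' [Hw' Nw' w'h']] := ex Hh'.
(* [w'] is only known to follow the rules up to stage [K], so it is replaced by a genuine play that
   agrees with it up to there. *)
have [w2 Hw2 w2E] := play_extension Hw'.
have w2h' : trunc T w2 = h'.
  rewrite -w'h'; apply/agree_trunc; apply: (@agree_le _ _ K.+1).
    by rewrite ltnS leq_addr.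
  by apply/agree_trunc.
have u2 : utility G i w - eta < utility G i w2.
  apply: sV => // k ks; rewrite -(ext_agree w2) ?sK// w2E.
  exact: Nw'.
have := value_osc moverG mp i T Hw; have := value_osc moverG mp i T Hw2.
rewrite wh w2h' !ler_norml !shiftedE// => /andP[a1 a2] /andP[a3 a4]; lra.
Qed.

End profile.

(** Nature's draw depends on the history, so the integrand and the measure both vary; weak
    continuity of Nature's move, through [open_prob_gt], is what [integral_lsc] requires of the
    measure. *)
Lemma expected_lsc (p : forall i, strategy G i) (mp : mixed_profile p) i t (delta : R) :
  0 <= delta -> delta_lsc (@value _ _ _ p i t.+1) delta ->
  forall (h : hist G t) (b : prod_topology (X t)) (r : R), H t h ->
  (forall k, action G t k h (b k)) -> r + delta < expected_value p i h b ->
  \forall y \near (h, b), H t y.1 -> (forall k, action G t k y.1 (y.2 k)) ->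
    r < expected_value p i y.1 y.2.
Proof.
move=> delta0 vlsc h b r Hh Ab rv.
pose Y : topologicalType := (hist G t * prod_topology (X t))%type.
pose D : set Y := [set y | H t y.1 /\ forall k, action G t k y.1 (y.2 k)].
pose v (q : Y * nat_space G t) := @value _ _ _ p i t.+1 (q.1.1, (q.1.2, q.2)).
have := @integral_lsc R Y (nat_space G t) D (fun y => nature G t y.1) _ v delta
  (`|bound G i| + `|bound G i|) delta0 _ _ _ _ (h, b) r.
rewrite near_withinE; have -> : (\int[nature G t h]_s (v (h, b, s))%:E =
    (expected_value p i h b)%:E)%E by rewrite (expected_valueE moverG mp).
move=> lsc; have nb : nbhs ((h, b) : Y) [set y | D y ->
    (r%:E < \int[nature G t y.1]_s (v (y, s))%:E)%E].
  apply: lsc => //.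
  - move=> y [Hy _] V r' oV rV.
    have /subspace_continuousP/(_ y.1 Hy) := @nature_continuous _ _ G t.
    move=> /(_ _ (open_nbhs_nbhs (conj (@open_prob_gt R _ V r' oV) rV))) nb.
    rewrite near_withinE.
    have fsty : (fst : Y -> _) @ y --> y.1 by case: y {Hy rV nb} => y1 y2; exact: cvg_fst.
    have nb1 : nbhs y [set y' : Y | H t y'.1 -> (r'%:E < nature G t y'.1 V)%E].
      exact: (fsty _ nb).
    by apply: (filterS _ nb1) => y' ny' [Hy' _]; exact: ny'.
  - by move=> q; exact: (value_ge0 moverG).
  - by move=> q; exact: (value_le moverG).
  - by move=> y; exact: (@measurable_value_nature _ _ _ moverG p mp i t y.1 y.2).
  - move=> y s eta [Hy Ay] eta0.
    have Hys : H t.+1 (y.1, (y.2, s)) by split.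
    have := vlsc _ Hys _ eta0; rewrite near_withinE => nb.
    have asc : ((fun q : Y * nat_space G t => (q.1.1, (q.1.2, q.2))) : _ -> hist G t.+1)
        @ (y, s) --> ((y.1, (y.2, s)) : hist G t.+1).
      have c1 : (fun q : Y * nat_space G t => q.1) @ (y, s) --> y by exact: cvg_fst.
      have c2 : (fun q : Y * nat_space G t => q.2) @ (y, s) --> s by exact: cvg_snd.
      have fsty : (fst : Y -> _) @ y --> y.1 by case: (y) => y1 y2; exact: cvg_fst.
      have sndy : (snd : Y -> _) @ y --> y.2 by case: (y) => y1 y2; exact: cvg_snd.
      have c11 := @cvg_comp _ _ _ _ _ _ _ _ c1 fsty.
      have c12 := @cvg_comp _ _ _ _ _ _ _ _ c1 sndy.
      have c3 := @cvg_pair _ _ _ (nbhs (y, s)) (nbhs y.2) (nbhs s) _ _ _ _ _ c12 c2.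
      exact: (@cvg_pair _ _ _ (nbhs (y, s)) (nbhs y.1) (nbhs (y.2, s)) _ _ _ _ _ c11 (c3 _ _ _)).
    have nb1 : nbhs (y, s) [set q | D q.1 -> v (y, s) - delta - eta < v q]; last exact: nb1.
    have nb2 : nbhs (y, s) [set q : Y * nat_space G t | H t.+1 (q.1.1, (q.1.2, q.2)) ->
        v (y, s) - delta - eta < v q] := asc _ nb.
    by apply: (filterS _ nb2) => q nq [Hq Aq]; apply: nq; split.
apply: (filterS _ nb) => y ny Hy Ay; have := ny (conj Hy Ay).
by rewrite -(expected_valueE moverG mp) lte_fin.
Qed.

End value_continuity.

Section compact_tube.
Import finmap.finmap.

(** The tube lemma, with an open [V] around the whole of [K]: upper hemicontinuity will confine the
    replies at nearby histories to [V], though not to [K]. *)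
Lemma compact_tube (A : topologicalType) (B : ptopologicalType) (K : set B) (a : A) (P : A -> B -> Prop) :
  compact K -> (forall y, K y -> \forall q \near (a, y), P q.1 q.2) ->
  exists V : set B, [/\ open V, K `<=` V & \forall a' \near a, forall y, V y -> P a' y].
Proof.
rewrite compact_cover => cK KP.
have EV y : exists EV : set A * set B, K y ->
    [/\ nbhs a EV.1, open EV.2, EV.2 y & forall a' y', EV.1 a' -> EV.2 y' -> P a' y'].
  have [Ky|nKy] := pselect (K y); last by exists (setT, setT).
  have [[E V]] := KP y Ky; move=> /= [aE yV] EVP.
  exists (E, interior V) => _; split => //=; first exact: open_interior.
  by move=> a' y' Ea' Vy'; apply: (EVP (a', y')); split => //=; exact: interior_subset.
pose E y := sval (cid (EV y)).
have EP y : K y -> [/\ nbhs a (E y).1, open (E y).2, (E y).2 y &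
    forall a' y', (E y).1 a' -> (E y).2 y' -> P a' y'] := svalP (cid (EV y)).
have [|y Ky|D' DK KD] := cK _ K (fun y => (E y).2).
- by move=> y Ky; case: (EP y Ky).
- by exists y => //; case: (EP y Ky).
exists (\bigcup_(y in [set` D']) (E y).2); split => //.
  by apply: bigcup_open => y yD; case: (EP y); first exact/set_mem/DK.
have nb : nbhs a (\bigcap_(y in [set` D']) (E y).1).
  by apply: filter_bigI => y yD; case: (EP y); first exact/set_mem/DK.
apply: (filterS _ nb) => a' Ea' y' [y yD Vy'].
have [_ _ _] := EP y (set_mem (DK y yD)); apply; last exact: Vy'.
exact: Ea'.
Qed.

End compact_tube.

Section two_actions.
Variables (n : nat) (R : realType) (G : game n R) (t : nat) (i j : 'I_n).
Local Notation X := (act_space G t).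

(** The action vector as a jointly continuous function of two actions. With two distinct players
    every component of the default [point] is overwritten. *)
Definition two_actions (a : X i) (y : X j) : forall k, X k :=
  @dfwith _ X (@dfwith _ X point i a) j y.

Lemma two_actions_continuous (q : (hist G t * X i) * X j) :
  (fun q => (q.1.1, two_actions q.1.2 q.2 : prod_topology X)) @ q -->
  ((q.1.1, two_actions q.1.2 q.2) : hist G t * prod_topology X).
Proof.
case: q => -[h a] y.
have c1 : (fun q : (hist G t * X i) * X j => q.1) @ (h, a, y) --> (h, a) by exact: cvg_fst.
have c2 : (fun q : (hist G t * X i) * X j => q.2) @ (h, a, y) --> y by exact: cvg_snd.
have c11 := @cvg_comp _ _ _ _ fst _ _ (nbhs h) c1 cvg_fst.
have c12 := @cvg_comp _ _ _ _ snd _ _ (nbhs a) c1 cvg_snd.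
have c3 : (fun q : (hist G t * X i) * X j => two_actions q.1.2 q.2 : prod_topology X)
    @ (h, a, y) --> (two_actions a y : prod_topology X).
  apply: cvg_prod_topology => k; rewrite /two_actions.
  have [->|kj] := eqVneq k j.
    rewrite (_ : (fun x => _) = snd); last by apply/funext => x /=; rewrite dfwithin.
    by rewrite dfwithin; exact: c2.
  rewrite (_ : (fun x => _) = fun x : (hist G t * X i) * X j =>
      @dfwith _ X point i x.1.2 k); last first.
    by apply/funext => x; rewrite dfwithout// eq_sym.
  rewrite dfwithout 1?eq_sym//; have [->|ki] := eqVneq k i.
    rewrite (_ : (fun x => _) = snd \o fst); last first.
      by apply/funext => x /=; rewrite dfwithin.
    by rewrite dfwithin; exact: (c12 _).
  rewrite (_ : (fun x => _) = cst point); last first.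
    by apply/funext => x /=; rewrite dfwithout// eq_sym.
  by rewrite dfwithout 1?eq_sym//; exact: cvg_cst.
exact: (@cvg_pair _ _ _ (nbhs (h, a, y)) (nbhs h) (nbhs (two_actions a y : prod_topology X))
  _ _ _ _ _ (c11 _) c3).
Qed.

End two_actions.

Section fixed_sum_equilibrium.
Variables (R : realType) (G : game 2 R).
Hypothesis perfG : perfect_information G.
Hypothesis fixG : fixed_sum G.
Local Notation X := (act_space G).
Local Notation H := (hist_set (action G)).
Local Notation osc := (oscillation (action G) (utility G)).

Let moverG := one_mover_perfect_information perfG.

Variable f : forall i, strategy G i.
Arguments f : clear implicits.
Hypothesis spe : subgame_perfect f.

Let mf : mixed_profile f := spe.1.

(* An action of [i] that secures the value at [h] almost secures it after a small
   change of history and action.  Lower hemicontinuity makes such an action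
   available at [h'], upper hemicontinuity limits the replies of [j] there. *)
Lemma value_lsc_step i j t (delta : R) : i != j -> 0 <= delta ->
  delta_lsc (@value _ _ _ f i t.+1) delta -> delta_lsc (@value _ _ _ f i t) delta.
Proof.
move=> ij delta0 vlsc h Hh eta eta0.
have [a Aa sec] := securing_action perfG fixG spe ij Hh.
(* A level strictly between the bound to be proved and [value f i h - delta]: the gap above is what
   [expected_lsc] asks for, the gap below makes the conclusion strict. *)
pose r := value f i h - delta - eta / 2.
pose P (q : hist G t * X t i) (y : X t j) := H t q.1 -> action G t i q.1 q.2 ->
  action G t j q.1 y -> r < expected_value f i q.1 (two_actions q.2 y).
have act2 h' a' y : action G t i h' a' -> action G t j h' y ->
    forall k, action G t k h' (two_actions a' y k).
  move=> Aa' Ay k; rewrite /two_actions; have [->|kj] := eqVneq k j.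
    by rewrite dfwithin.
  have -> : k = i by apply: (@two_players j) => //; rewrite eq_sym.
  by rewrite dfwithout 1?eq_sym// dfwithin.
have [y Ay|V [oV AV hV]] := @compact_tube _ _ (action G t j h) (h, a) P
    (@action_compact _ _ G t j h Hh).
  have Ab := act2 h a y Aa Ay.
  have lt : r + delta < expected_value f i h (two_actions a y).
    apply: (@lt_le_trans _ _ (value f i h)); first by rewrite /r; lra.
    apply: sec; last exact: Ab.
    by rewrite /two_actions dfwithout 1?eq_sym// dfwithin.
  have nb := @two_actions_continuous _ _ G t i j (h, a, y) _
    (expected_lsc moverG mf delta0 vlsc Hh Ab lt).
  have nb' : nbhs (h, a, y) [set q : (hist G t * X t i) * X t j | H t q.1.1 ->
      (forall k, action G t k q.1.1 (two_actions q.1.2 q.2 k)) ->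
      r < expected_value f i q.1.1 (two_actions q.1.2 q.2)] := nb.
  by apply: (filterS _ nb') => q rq Hq Aq Aq'; apply: rq => //; exact: act2.
case: hV => -[N U] /= [hN aU] NUP.
have lhc : \forall h' \near within (H t) (nbhs h), action G t i h' `&` U^° !=set0.
  apply: (@action_lhc _ _ G t i h Hh _ (open_interior U)); exists a; split => //.
have uhc := @action_uhc _ _ G t j h Hh _ oV AV.
rewrite !near_withinE in lhc uhc *.
have nb := @filterI _ (nbhs h) (nbhs_filter h) _ _ hN
  (@filterI _ (nbhs h) (nbhs_filter h) _ _ lhc uhc).
apply: (filterS _ nb) => h' [Nh' [Ui Vj]] Hh'.
have [a' [Aa' Ua']] := Ui Hh'.
apply: (@lt_le_trans _ _ r); first by rewrite /r; lra.
apply: (value_ge_secured perfG spe ij Hh' Aa') => b bi Abj.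
have bE : b = two_actions a' (b j).
  apply: functional_extensionality_dep => k; rewrite /two_actions.
  have [->|kj] := eqVneq k j; first by rewrite dfwithin.
  have -> : k = i by apply: (@two_players j) => //; rewrite eq_sym.
  by rewrite dfwithout 1?eq_sym// dfwithin.
rewrite bE ltW//; apply: (NUP (h', a')) => //=; last exact: Vj.
by split => //; exact: interior_subset.
Qed.

(** A backward step does not increase the defect, so stage [t] inherits the defect of every later
    stage [T], and these tend to zero. *)
Lemma value_lsc i j t : i != j -> delta_lsc (@value _ _ _ f i t) 0.
Proof.
move=> ij h Hh eta eta0.
have back d : forall s T, (s + d)%N = T ->
    delta_lsc (@value _ _ _ f i s) (osc T + osc T).
  elim: d => [|d ih] s T sT.
    by rewrite -sT addn0; exact: value_lsc_oscillation.
  apply: (value_lsc_step ij); first by rewrite addr_ge0// oscillation_ge0.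
  by apply: ih; rewrite -sT addSnnS.
(* Two oscillations then cost less than [eta / 2]; the other half is the margin in [delta_lsc]. *)
have /cvgrPdist_lt/(_ (eta / 4)) := @continuous_at_infinity _ _ G.
have e4 : 0 < eta / 4 by lra.
move=> /(_ e4)[N _ NT]; pose T := (t + N)%N.
have := NT T (leq_addl t N); rewrite /= sub0r normrN ger0_norm ?oscillation_ge0// => oT.
have e2 : 0 < eta / 2 by lra.
have := back N t T erefl h Hh (eta / 2) e2; rewrite !near_withinE => nb.
apply: (filterS _ nb) => h' lt Hh'; apply: le_lt_trans (lt Hh'); lra.
Qed.

(* If [j] is the mover and [b j] were bad for [j], then by semicontinuity so would
   be all actions in an open set charged by [f j t h]; since no action gives [j]
   more than its value, the average could not reach that value. *)
Lemma support_expected_le i j t (h : hist G t) (b : forall i, X t i) :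
  i != j -> H t h -> action G t i h (b i) -> prob_support (f j t h) (b j) ->
  expected_value f i h b <= value f i h.
Proof.
move=> ij Hh Abi sbj; have ji : j != i by rewrite eq_sym.
have Abj : action G t j h (b j) by exact: (strategy_support mf Hh).
have [k [b0 Ab0]] := moverG Hh; have [ki|ki] := eqVneq k i.
  apply: (deviation_dirac perfG spe ij Hh Abi).
  have Aj : action G t j h = [set b0 j] by apply: Ab0; rewrite ki.
  by move: Abj; rewrite Aj /= => ->.
have {ki} kj : k = j := two_players ij ki.
have Ai : action G t i h = [set b i].
  have Ai : action G t i h = [set b0 i] by apply: Ab0; rewrite kj.
  by move: Abi; rewrite Ai /= => ->.
rewrite leNgt; apply/negP => lt.
have Ab y : action G t j h y -> forall l, action G t l h (@dfwith _ (X t) b j y l).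
  move=> Ay l; have [->|lj] := eqVneq l j; first by rewrite dfwithin.
  by rewrite dfwithout 1?eq_sym// (two_players ji lj).
have Abb : forall l, action G t l h (b l).
  by rewrite -(dfwith_id b j); exact: Ab.
have lt0 : value f i h + 0 < expected_value f i h b by rewrite addr0.
have nb := expected_lsc moverG mf (lexx 0) (@value_lsc i j t.+1 ij) Hh Abb lt0.
have cb : (fun y => (h, @dfwith _ (X t) b j y : prod_topology (X t))) @ (b j) -->
    ((h, b) : hist G t * prod_topology (X t)).
  have c1 : (@dfwith _ (X t) b j : _ -> prod_topology (X t)) @ (b j) -->
      (b : prod_topology (X t)).
    rewrite -[X in _ --> X](dfwith_id b j); exact: dfwith_continuous.
  exact: (@cvg_pair _ _ _ (nbhs (b j)) (nbhs h) (nbhs (b : prod_topology (X t)))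
    _ _ _ (cst h) _ (cvg_cst h) c1).
pose U := [set y : X t j | H t h ->
    (forall l, action G t l h (@dfwith _ (X t) b j y l)) ->
    value f i h < expected_value f i h (@dfwith _ (X t) b j y)]^°.
have Ub : U (b j) := cb _ nb.
have oU : open U by exact: open_interior.
have mU : measurable (U : set (borel (X t j))) by exact: open_borel.
have U0 : (0 < f j t h U)%E.
  rewrite lt0e measure_ge0 andbT; apply/eqP => fU.
  have : (~` U) (b j).
    apply: sbj; split; first exact: open_closedC.
    apply: (etrans (@probability_setC _ (borel (X t j)) R (f j t h) U mU)).
    by rewrite [X in (1 - X)%E]fU sube0.
  exact.
have : ((value f j h)%:E < (value f j h)%:E)%E; last by rewrite ltxx.
rewrite [ltLHS](@value_dirac _ _ _ moverG f mf j t h j b Hh); last first.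
  move=> l lj; apply: (strategy_dirac mf) => //; by rewrite (two_players ji lj).
have vs := value_sum perfG fixG mf ij Hh.
apply: (@integral_lt_cst _ (borel (X t j)) R _ (action G t j h) U) => //.
- exact: measurable_action.
- exact: (strategy_action spe).
- by move=> y; exact: (expected_value_ge0 moverG).
- exact: (@measurable_expected_value _ _ _ moverG).
- move=> y Ay; apply: (deviation_dirac perfG spe ji Hh (Ab y Ay j)).
  by rewrite dfwithout.
- move=> y Ay Uy; have := interior_subset Uy => /(_ Hh (Ab y Ay)).
  have := expected_value_sum perfG fixG mf ij Hh (Ab y Ay); lra.
Qed.

(** * Pure selections from the supports *)

Section selection.
Variable g : forall i t, hist G t -> X t i.
Arguments g : clear implicits.
Hypothesis pg : pure_profile g.
Hypothesis gf : forall t i h, H t h -> prob_support (f i t h) (g i t h).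

Let q := pure_to_mixed g.

(** The supermartingale is the value under [f], the law that of the profile in which [j] follows
    [g]. [support_expected_le] bounds every action of [i] separately, so [d] may mix and may deviate
    at every stage. *)
Lemma selection_value_le i j (d : strategy G i) t (h : hist G t) :
  i != j -> mixed_strategy d -> H t h ->
  value (@dfwith _ (strategy G) q i d) i h <= value f i h.
Proof.
move=> ij md Hh; set p := @dfwith _ (strategy G) q i d.
have mp : mixed_profile p.
  move=> k; have [->|ki] := eqVneq k i; first by rewrite /p dfwithin.
  by rewrite /p dfwithout 1?eq_sym//; exact: pg.
apply: (value_le_supermartingale moverG mp (W := fun k => @value _ _ _ f i k)) => //.
- by move=> k h'; exact: (value_ge0 moverG).
- by move=> k; exact: (measurable_value moverG).
- move=> k h' _ Hh'; pose b l := g l k h'.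
  have Ab l : action G k l h' (b l).
    by apply: (strategy_support mf Hh'); exact: gf.
  have qb l : l != i -> is_dirac (p l k h') (b l).
    by move=> li; rewrite /p dfwithout 1?eq_sym// => B mB.
  rewrite (integral_is_product (mu := fun l => p l k h') qb
    (move_product moverG mp Hh')); last 2 first.
  + by move=> z; rewrite lee_fin (value_ge0 moverG).
  + exact: (@measurable_value_stage _ _ _ moverG _ mf).
  under eq_integral => y _ do rewrite -(expected_valueE moverG mf).
  rewrite -[leRHS](integral_prob_cst (p i k h')).
  apply: (@ge0_le_integral_full _ (borel (X k i)) R _ (action G k i h')) => //.
  + exact: measurable_action.
  + apply: prob_support_full; first exact: measurable_action.
    exact: (strategy_support mp).
  + by move=> y; rewrite lee_fin (expected_value_ge0 moverG).
  + by apply/measurable_EFinP; exact: (@measurable_expected_value _ _ _ moverG).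
  + by move=> y; rewrite lee_fin (value_ge0 moverG).
  + move=> y Ay; rewrite lee_fin; apply: (support_expected_le ij Hh').
      by rewrite dfwithin.
    by rewrite dfwithout//; exact: gf.
- move=> k w Hw; have := value_osc moverG mf i k Hw; rewrite ler_norml.
  by move=> /andP[u1 u2]; lra.
Qed.

(** A deviation of [i] earns at most the value under [f]. The same bound for [j], with [q j] itself
    as the deviation, shows by the fixed sum that [q] already gives [i] at least that value. *)
Lemma selection_subgame_perfect : subgame_perfect q.
Proof.
split=> // i t h Hh d md.
have [j ij] : exists j : 'I_2, i != j.
  by case: i {d md} => -[|[|]]// ?; [exists ord_max|exists ord0].
have ji : j != i by rewrite eq_sym.
have qE k : @dfwith _ (strategy G) q k (q k) = q.
  by apply: functional_extensionality_dep => l; case: dfwithP.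
have := selection_value_le ij md Hh; have := selection_value_le ji (pg j) Hh.
rewrite qE => qj di; have := value_sum perfG fixG pg ij Hh.
have := value_sum perfG fixG mf ij Hh.
have -> : payoff (@dfwith _ (strategy G) q i d) h i =
    value (@dfwith _ (strategy G) q i d) i h - bound G i by rewrite value_payoff// addrK.
have -> : payoff q h i = value q i h - bound G i by rewrite value_payoff// addrK.
rewrite /q in qj di *; lra.
Qed.

End selection.
End fixed_sum_equilibrium.

Theorem theorem1 (R : realType) (G : game 2 R) :
  perfect_information G -> fixed_sum G ->
  forall f : (forall i, strategy G i), subgame_perfect f ->
  forall g : (forall i t, hist G t -> act_space G t i), pure_profile g ->
  (forall t i h, hist_set (action G) t h -> prob_support (f i t h) (g i t h)) ->
  subgame_perfect (pure_to_mixed g).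
Proof. by move=> pi fs f spe g pg gf; exact: (selection_subgame_perfect pi fs spe pg gf). Qed.
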